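(* For any real numbers $\alpha,\beta,\gamma$ satisfying $\alpha,\beta>\gamma>0$, the Hilbert space $\mathcal{H}^{(\alpha,\beta,\gamma)}$ of holomorphic functions on $\mathbb{D}^2$ with reproducing kernel $B_{(\alpha,\beta,\gamma)}$ is a Möb-homogeneous analytic Hilbert module.
   Context: $\mathbb{D}$ is the open unit disc in $\mathbb{C}$ and Möb is the group of biholomorphic automorphisms of $\mathbb{D}$. A Hilbert space $\mathcal{H}$ is an analytic Hilbert module (over $\mathbb{C}[\boldsymbol z]=\mathbb{C}[z_1,z_2]$, on $\mathbb{D}^2$) if it consists of holomorphic functions on $\mathbb{D}^2$, it possesses a reproducing kernel on $\mathbb{D}^2$, $\mathbb{C}[\boldsymbol z]$ is (contained and) dense in $\mathcal{H}$, and the multiplication operators $M_{z_1},M_{z_2}$ by the coordinate functions are bounded on $\mathcal{H}$. A commuting pair $(T_1,T_2)$ of bounded operators on a complex separable Hilbert space is Möb-homogeneous if its Taylor joint spectrum lies in $\overline{\mathbb{D}}^2$ and $(\varphi(T_1),\varphi(T_2))$ is unitarily equivalent to $(T_1,T_2)$ (by a single unitary intertwining both components) for every $\varphi\in$ Möb. An analytic Hilbert module on $\mathbb{D}^2$ is Möb-homogeneous if the pair $(M_{z_1},M_{z_2})$ is Möb-homogeneous. For $\alpha,\beta>\gamma>0$, $$B_{(\alpha,\beta,\gamma)}(\boldsymbol z,\boldsymbol w)=(1-z_1\overline{w}_1)^{-\alpha}(1-z_2\overline{w}_2)^{-\beta}(1-z_1\overline{w}_2)^{\gamma}(1-z_2\overline{w}_1)^{\gamma},\quad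 \boldsymbol z=(z_1,z_2),\ \boldsymbol w=(w_1,w_2)\in\mathbb{D}^2,$$ (principal branches), which is a non-negative definite function, and $\mathcal{H}^{(\alpha,\beta,\gamma)}$ is its reproducing kernel Hilbert space. *)

(* Defs.v *)
From HB Require Import structures.
From mathcomp Require Import all_boot all_order all_algebra.
From mathcomp Require Import sesquilinear complex.
From mathcomp Require Import all_classical all_reals all_analysis.
Set Implicit Arguments.
Unset Strict Implicit.
Unset Printing Implicit Defensive.
Import Order.TTheory GRing.Theory Num.Theory.
Import numFieldNormedType.Exports.
Local Open Scope classical_set_scope.
Local Open Scope ring_scope.

(* [R[i]^o] is the field of complex numbers, seen as a normed space over
   itself; differentiability of maps between normed spaces over it is complex
   (Frechet) differentiability. *)
Notation Cplx R := (R[i]^o)%type.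

Section Domains.
Variable R : realType.

Definition disc : set (Cplx R) := [set z | `|z| < 1].

Definition bidisc : set (Cplx R * Cplx R) :=
  [set z | `|z.1| < 1 /\ `|z.2| < 1].

Definition closed_bidisc : set (Cplx R * Cplx R) :=
  [set z | `|z.1| <= 1 /\ `|z.2| <= 1].

(* Meant for open sets [A]. *)
Definition holomorphic_on (V : normedModType R[i]) (A : set V)
    (f : V -> Cplx R) : Prop :=
  forall z, A z -> differentiable f z.

(* Automorphisms are represented by total functions, of which only the
   values on the disc matter. *)
Definition Mob (phi : Cplx R -> Cplx R) : Prop :=
  [/\ holomorphic_on disc phi,
      forall z, disc z -> disc (phi z) &
      exists psi : Cplx R -> Cplx R,
        [/\ holomorphic_on disc psi,
            forall z, disc z -> disc (psi z),
            forall z, disc z -> psi (phi z) = z &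
            forall z, disc z -> phi (psi z) = z]].

End Domains.

Arguments disc {R}.
Arguments bidisc {R}.
Arguments closed_bidisc {R}.

Section PrincipalPower.
Variable R : realType.

(* The modulus of [z] as an element of [R] (the norm [`|z|] lives in [R[i]]). *)
Definition modulus (z : R[i]) : R := complex.Re `|z|.

(* Principal argument, in ]-pi, pi], for [z != 0]. *)
Definition Arg (z : R[i]) : R :=
  if 0 <= complex.Im z then acos (complex.Re z / modulus z)
  else - acos (complex.Re z / modulus z).

(* exp (a * Log z), with the principal branch of Log, for [z != 0]. *)
Definition cpow (z : R[i]) (a : R) : R[i] :=
  Complex (modulus z `^ a * cos (a * Arg z)) (modulus z `^ a * sin (a * Arg z)).

Definition Bkernel (alpha beta gamma : R) (z w : Cplx R * Cplx R) : R[i] :=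
  cpow (1 - z.1 * (w.1)^*) (- alpha) * cpow (1 - z.2 * (w.2)^*) (- beta)
  * cpow (1 - z.1 * (w.2)^*) gamma * cpow (1 - z.2 * (w.1)^*) gamma.

End PrincipalPower.

(* The inner product is linear in its first argument. *)
Record hilbertSpace (R : realType) := HilbertSpace {
  hilbert_sort :> completeNormedModType R[i];
  inner : {dot hilbert_sort for Num.conj};
  inner_norm : forall x, inner x x = `|x| ^+ 2
}.

Section Operators.
Variable R : realType.

Definition separable_space (T : topologicalType) : Prop :=
  exists2 D : set T, countable D & dense D.

Definition bounded_op (H K : hilbertSpace R) (T : H -> K) : Prop :=
  exists M : R[i], forall x, `|T x| <= M * `|x|.

Definition unitary_op (H K : hilbertSpace R) (U : H -> K) : Prop :=
  (forall y, exists x, U x = y) /\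
  (forall x y, inner K (U x) (U y) = inner H x y).

Definition unitarily_equivalent (H K : hilbertSpace R)
    (S1 S2 : H -> H) (T1 T2 : K -> K) : Prop :=
  exists U : {linear H -> K},
    [/\ unitary_op U,
        forall x, U (S1 x) = T1 (U x) &
        forall x, U (S2 x) = T2 (U x)].

(* Exactness of the Koszul complex 0 -> H -> H (+) H -> H -> 0 of the
   commuting pair (A1, A2), with differentials h |-> (A1 h, A2 h) and
   (x, y) |-> A1 y - A2 x. *)
Definition koszul_exact (H : hilbertSpace R) (A1 A2 : H -> H) : Prop :=
  [/\ forall h, A1 h = 0 -> A2 h = 0 -> h = 0,
      forall x y, A1 y - A2 x = 0 -> exists h, x = A1 h /\ y = A2 h &
      forall h, exists x y, A1 y - A2 x = h].

Definition taylor_spectrum (H : hilbertSpace R) (T1 T2 : H -> H) :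
    set (Cplx R * Cplx R) :=
  [set l | ~ koszul_exact (fun x => T1 x - (l.1 : R[i]) *: x)
                          (fun x => T2 x - (l.2 : R[i]) *: x)].

(* [S] is phi(T): if phi(z) = \sum_n a_n z^n on the disc, then S is the sum of
   the series \sum_n a_n T^n, convergent in operator norm. A Mobius map is
   holomorphic on a disc of radius > 1, so for an operator with spectrum in the
   closed unit disc this is the holomorphic functional calculus. *)
Definition functional_calculus (H : hilbertSpace R) (phi : Cplx R -> Cplx R)
    (T S : H -> H) : Prop :=
  exists a : nat -> R[i],
    (forall z : Cplx R, disc z ->
       (fun N => \sum_(n < N) a n * z ^+ n : Cplx R) @ \oo --> phi z) /\
    (forall e : R[i], 0 < e -> \forall N \near \oo, forall x : H,
       `|\sum_(n < N) a n *: iter n T x - S x| <= e * `|x|).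

Definition Mob_homogeneous (H : hilbertSpace R) (T1 T2 : {linear H -> H}) :
    Prop :=
  [/\ separable_space H,
      bounded_op T1 /\ bounded_op T2,
      forall x, T1 (T2 x) = T2 (T1 x),
      taylor_spectrum T1 T2 `<=` closed_bidisc &
      forall phi, Mob phi -> exists S1 S2 : {linear H -> H},
        [/\ functional_calculus phi T1 S1,
            functional_calculus phi T2 S2 &
            unitarily_equivalent S1 S2 T1 T2]].

End Operators.

(* A Hilbert space whose elements are functions on the bidisc: [ev f] is the
   function associated with [f], and only its values on the bidisc are
   meaningful. *)
Record hilbertFunctionSpace (R : realType) := HilbertFunctionSpace {
  hfs_sort :> hilbertSpace R;
  ev : hfs_sort -> Cplx R * Cplx R -> Cplx R;
  ev_linear : forall z, bidisc z -> forall (a : R[i]) f g,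
    ev (a *: f + g) z = a * ev f z + ev g z;
  ev_inj : forall f g, (forall z, bidisc z -> ev f z = ev g z) -> f = g
}.

Section Modules.
Variables (R : realType) (H : hilbertFunctionSpace R).

Definition reproducing_kernel (K : Cplx R * Cplx R -> Cplx R * Cplx R -> R[i]) :
    Prop :=
  forall w, bidisc w -> exists k : H,
    (forall z, bidisc z -> ev k z = K z w) /\
    (forall f : H, inner H f k = ev f w).

Definition represents (f : H) (p : {poly {poly R[i]}}) : Prop :=
  forall z, bidisc z -> ev f z = p.[z.1 : R[i], z.2].

Definition multiplication_op (g : Cplx R * Cplx R -> Cplx R) (M : H -> H) :
    Prop :=
  forall f z, bidisc z -> ev (M f) z = g z * ev f z.

Definition analytic_Hilbert_module : Prop :=
  [/\ forall f : H, holomorphic_on bidisc (ev f),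
      exists K, reproducing_kernel K,
      forall p, exists f, represents f p,
      dense [set f : H | exists p, represents f p] &
      exists M1 M2 : {linear H -> H},
        [/\ multiplication_op fst M1, multiplication_op snd M2,
            bounded_op M1 & bounded_op M2]].

(* The multiplication operators are uniquely determined, by [ev_inj]. *)
Definition Mob_homogeneous_module : Prop :=
  exists M1 M2 : {linear H -> H},
    [/\ multiplication_op fst M1, multiplication_op snd M2 &
        Mob_homogeneous M1 M2].

End Modules.

(* Main.v *)
(* Write [a = alpha - gamma], [b = beta - gamma], [w'] for the conjugate of [w] and [x_i = z_i w_i'].
   Expanding logarithms, the kernel is [exp Q] with
     Q(z, w) = sum_n (a x_1^n + b x_2^n + gamma (z_1^n - z_2^n) (w_1'^n - w_2'^n)) / n,
   a limit of nonnegative combinations of rank-one kernels. Positive for the same reason are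
   [exp Q - 1] (hence [1] is in [H]), [exp Q - (1 + Q_N/n)^n] for the partial sums [Q_N] of [Q]
   (hence the kernel functions are limits of polynomials, and polynomials are dense) and
   [(D - x_i^m) exp Q] for [D = 1 + m/a], resp. [1 + m/b] (hence [|M_i^m|^2 <= D]; this linear
   growth puts the spectrum in the closed bidisc and makes the power series of a Moebius map
   converge in operator norm). Each of these is turned into a statement about [H] by Aronszajn's
   criterion: [g] is in the ball of radius [r] of [H] iff [r^2 exp Q - g(z) g(w)'] is positive.
   Functions in [H] are locally uniform limits of polynomials, whose difference quotients are
   controlled by Schwarz' lemma.
   A disc automorphism [phi] is a Moebius map by Schwarz' lemma, which rests on Goursat's theorem;
   then [K(phi z, phi w) = j(z) K(z, w) j(w)'], so composition with the inverse of [phi], weighted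
   by [j], is a unitary that intertwines [phi(M_i)] and [M_i]. *)
Require Import Defs.
From HB Require Import structures.
From mathcomp Require Import all_boot all_order all_algebra.
From mathcomp Require Import sesquilinear complex.
From mathcomp Require Import all_classical all_reals all_analysis.
From mathcomp Require Import ring lra.
Set Implicit Arguments.
Unset Strict Implicit.
Unset Printing Implicit Defensive.
Import Order.TTheory GRing.Theory Num.Theory.
Import numFieldNormedType.Exports.
Local Open Scope classical_set_scope.
Local Open Scope ring_scope.

(** * Complex numbers *)

Section Modulus.
Variable R : realType.
Local Notation C := R[i].
Implicit Types (x y z : C) (r : R).

(** The bounds obtained for [|M_i^m|] exceed 1 for every [m >= 1], so nothing can be drawn from
    contractivity; what replaces it is that geometrically decaying coefficients beat linear growth.
    A Moebius map and the resolvent at a point outside the closed disc both have such coefficients.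
    The principal branches are harmless because every base [1 - z_i w_j'] lies in the right
    half-plane: arguments stay below [pi / 2] in absolute value, and an identity between four such
    logarithms that holds after exponentiation holds as it stands. Neither contour integrals nor
    power series of general holomorphic functions appear. The vanishing of contour integrals is
    replaced by the decay of Riemann sums under refinement, and holomorphy in two variables comes
    from inequalities between finitely many values of a function, which pass from polynomials to
    their pointwise limits. *)

Lemma normE z : `|z| = (modulus z)%:C%C.
Proof. by []. Qed.

Lemma modulus_ge0 z : 0 <= modulus z.
Proof. by rewrite -ler0c -normE. Qed.

Lemma modulusM x y : modulus (x * y) = modulus x * modulus y.
Proof. by rewrite /modulus/= Normc.normcM. Qed.

Lemma modulusD x y : modulus (x + y) <= modulus x + modulus y.
Proof. by rewrite -lecR rmorphD/= -!normE ler_normD. Qed.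

Lemma modulusN x : modulus (- x) = modulus x.
Proof. by rewrite /modulus normrN. Qed.

Lemma modulusBC x y : modulus (x - y) = modulus (y - x).
Proof. by rewrite -modulusN opprB. Qed.

Lemma modulusB x y : modulus (x - y) <= modulus x + modulus y.
Proof. by rewrite -[modulus y]modulusN modulusD. Qed.

Lemma modulus0 : modulus (0 : C) = 0.
Proof. by rewrite /modulus normr0. Qed.

Lemma modulus1 : modulus (1 : C) = 1.
Proof. by rewrite /modulus normr1. Qed.

Lemma modulus_eq0 z : (modulus z == 0) = (z == 0).
Proof.
apply/eqP/eqP => [h|->]; last exact: modulus0.
by apply/eqP; rewrite -normr_eq0 normE h.
Qed.

Lemma modulus_gt0 z : (0 < modulus z) = (z != 0).
Proof. by rewrite lt_def modulus_eq0 modulus_ge0 andbT. Qed.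

Lemma modulusV z : modulus z^-1 = (modulus z)^-1.
Proof. by rewrite /modulus/= Normc.normcV. Qed.

Lemma modulusX z n : modulus (z ^+ n) = modulus z ^+ n.
Proof.
by elim: n => [|n IH]; rewrite ?expr0 ?modulus1// !exprS modulusM IH.
Qed.

Lemma modulus_real r : modulus r%:C%C = `|r|.
Proof. by rewrite /modulus normc_def/= expr0n/= addr0 sqrtr_sqr. Qed.

Lemma modulus_ge0r r : 0 <= r -> modulus r%:C%C = r.
Proof. by move=> ?; rewrite modulus_real ger0_norm. Qed.

Lemma modulus_conj z : modulus z^* = modulus z.
Proof. by rewrite /modulus norm_conjC. Qed.

Lemma modulus_nat n : modulus (n%:R : C) = n%:R.
Proof. by rewrite -(rmorph_nat (real_complex R)) modulus_ge0r. Qed.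

Lemma modulus_sum (I : Type) (s : seq I) (P : pred I) (F : I -> C) :
  modulus (\sum_(i <- s | P i) F i) <= \sum_(i <- s | P i) modulus (F i).
Proof.
elim/big_rec2: _ => [|i a b _ h]; first by rewrite modulus0.
by rewrite (le_trans (modulusD _ _))// lerD2l.
Qed.

Lemma norm_le z r : (`|z| <= r%:C%C) = (modulus z <= r).
Proof. by rewrite normE lecR. Qed.

Lemma norm_lt z r : (`|z| < r%:C%C) = (modulus z < r).
Proof. by rewrite normE ltcR. Qed.

Lemma norm_lt1 z : (`|z| < 1) = (modulus z < 1).
Proof. by rewrite -norm_lt. Qed.

Lemma norm_le1 z : (`|z| <= 1) = (modulus z <= 1).
Proof. by rewrite -norm_le. Qed.

Lemma Re_le_modulus z : `|complex.Re z| <= modulus z.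
Proof. by rewrite -lecR -normE normc_ge_Re. Qed.

Lemma modulus_mulCi z : modulus ('i%C * z) = modulus z.
Proof.
by rewrite modulusM /modulus normc_def/= expr0n expr1n/= add0r sqrtr1 mul1r.
Qed.

Lemma Im_le_modulus z : `|complex.Im z| <= modulus z.
Proof.
rewrite -modulus_mulCi mulrC -[`|complex.Im _|]normrN -ReiNIm; exact: Re_le_modulus.
Qed.

Lemma modulus_le_ReIm z : modulus z <= `|complex.Re z| + `|complex.Im z|.
Proof.
by rewrite {1}[z]complexE (le_trans (modulusD _ _))// modulus_mulCi !modulus_real.
Qed.

Lemma sqr_modulus z : modulus z ^+ 2 = complex.Re z ^+ 2 + complex.Im z ^+ 2.
Proof.
rewrite /modulus normc_def/= sqr_sqrtr//.
by rewrite addr_ge0// sqr_ge0.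
Qed.

Lemma mulC_conj z : z * z^* = (modulus z ^+ 2)%:C%C.
Proof. by rewrite -normCK normE rmorphXn. Qed.

Lemma ReD x y : complex.Re (x + y) = complex.Re x + complex.Re y.
Proof. by case: x; case: y. Qed.
Lemma ImD x y : complex.Im (x + y) = complex.Im x + complex.Im y.
Proof. by case: x; case: y. Qed.
Lemma ReN x : complex.Re (- x) = - complex.Re x.
Proof. by case: x. Qed.
Lemma ImN x : complex.Im (- x) = - complex.Im x.
Proof. by case: x. Qed.
Lemma ReM x y : complex.Re (x * y) =
  complex.Re x * complex.Re y - complex.Im x * complex.Im y.
Proof. by case: x; case: y. Qed.
Lemma ImM x y : complex.Im (x * y) =
  complex.Re x * complex.Im y + complex.Im x * complex.Re y.
Proof. by case: x; case: y. Qed.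
Lemma ReJ x : complex.Re (x^*) = complex.Re x.
Proof. by case: x. Qed.
Lemma ImJ x : complex.Im (x^*) = - complex.Im x.
Proof. by case: x. Qed.

Lemma addC_conj x : x + x^* = (2 * complex.Re x)%:C%C.
Proof. by rewrite addcJ rmorphM/= rmorph_nat. Qed.

Lemma eqC x y : complex.Re x = complex.Re y -> complex.Im x = complex.Im y -> x = y.
Proof. by case: x => a b; case: y => c d /= -> ->. Qed.

Lemma conjCM x y : (x * y)^* = x^* * y^*. Proof. exact: rmorphM. Qed.
Lemma conjCB x y : (x - y)^* = x^* - y^*. Proof. exact: rmorphB. Qed.
Lemma conjCD x y : (x + y)^* = x^* + y^*. Proof. exact: rmorphD. Qed.
Lemma conjCV x : (x^-1)^* = (x^*)^-1. Proof. exact: fmorphV. Qed.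

Lemma realCM (r s : R) : ((r * s)%:C%C : C) = r%:C%C * s%:C%C. Proof. exact: rmorphM. Qed.

Lemma conj_realC r : (r%:C%C : C)^* = r%:C%C.
Proof. by apply: eqC; rewrite ?ReJ ?ImJ//= oppr0. Qed.

Lemma conj_realM r x : (r%:C%C * x)^* = r%:C%C * x^*.
Proof. by rewrite rmorphM; congr (_ * _); exact: conj_realC. Qed.

Lemma ge0_Re x : 0 <= x -> x = (complex.Re x)%:C%C.
Proof. by move=> h; apply: eqC => //=; exact: ger0_Im. Qed.

Lemma ge0_Re_ge0 x : 0 <= x -> 0 <= complex.Re x.
Proof. by move=> h; rewrite -ler0c -ge0_Re. Qed.

Lemma gt0_Re x : 0 < x -> exists2 r : R, 0 < r & x = r%:C%C.
Proof.
move=> h; exists (complex.Re x); last by apply: ge0_Re; exact: ltW.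
by have e := ge0_Re (ltW h); move: h; rewrite e ltcR.
Qed.

End Modulus.

(** * Limits of complex sequences *)

Section Limits.
Variable R : realType.
Local Notation C := R[i].

(** Weak inequalities between real moduli let limit arguments end in linear arithmetic; [climP]
    gives the link with filters. *)
Definition clim (u : nat -> C) (l : C) :=
  forall e : R, 0 < e -> exists N, forall n, (N <= n)%N -> modulus (u n - l) <= e.

Lemma clim_cst l : clim (fun=> l) l.
Proof. by move=> e e0; exists 0%N => n _; rewrite subrr modulus0 ltW. Qed.

Lemma clim_sub u v l m : clim u l -> (forall e : R, 0 < e ->
  exists N, forall n, (N <= n)%N -> modulus (v n - m) <= modulus (u n - l) + e) -> clim v m.
Proof.
move=> ul h e e0; have e2 : 0 < e / 2 by rewrite divr_gt0.
have [N hN] := ul _ e2; have [M hM] := h _ e2; exists (maxn N M) => n.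
by rewrite geq_max => /andP[/hN h1 /hM h2]; lra.
Qed.

Lemma climD u v l m : clim u l -> clim v m -> clim (fun n => u n + v n) (l + m).
Proof.
move=> hu hv; apply: (clim_sub hu) => e e0; have [N hN] := hv _ e0.
exists N => n /hN; have -> : u n + v n - (l + m) = (u n - l) + (v n - m) by ring.
by have := modulusD (u n - l) (v n - m); lra.
Qed.

Lemma clim_bounded u l : clim u l -> exists2 M : R, 0 < M &
  exists N, forall n, (N <= n)%N -> modulus (u n) <= M.
Proof.
move=> /(_ 1 ltr01)[N hN]; exists (modulus l + 1).
  by rewrite ltr_wpDl// modulus_ge0.
exists N => n /hN; have := modulusD (u n - l) l; rewrite subrK; lra.
Qed.

Lemma climZ (a : C) u l : clim u l -> clim (fun n => a * u n) (a * l).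
Proof.
move=> h e e0; have c1 : 0 < modulus a + 1 by rewrite ltr_wpDl// modulus_ge0.
have [|N hN] := h (e / (modulus a + 1)); first by rewrite divr_gt0.
exists N => n /hN; rewrite -mulrBr modulusM ler_pdivlMr// mulrDr mulr1 mulrC.
have := modulus_ge0 (u n - l); lra.
Qed.

Lemma climN u l : clim u l -> clim (fun n => - u n) (- l).
Proof.
by move=> h e /h[N hN]; exists N => n /hN; rewrite -opprD modulusN.
Qed.

Lemma climM u v l m : clim u l -> clim v m -> clim (fun n => u n * v n) (l * m).
Proof.
move=> hu hv e e0; have [M M0 [N hN]] := clim_bounded hu.
have c1 : 0 < modulus m + 1 by rewrite ltr_wpDl// modulus_ge0.
have [|N1 hN1] := hu (e / 2 / (modulus m + 1)); first by rewrite !divr_gt0.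
have [|N2 hN2] := hv (e / 2 / M); first by rewrite !divr_gt0.
exists (maxn N (maxn N1 N2)) => n; rewrite !geq_max => /and3P[/hN h /hN1 h1 /hN2 h2].
have -> : u n * v n - l * m = u n * (v n - m) + (u n - l) * m by ring.
rewrite (le_trans (modulusD _ _))// !modulusM.
move: h1 h2; rewrite !ler_pdivlMr// => h1 h2.
have h3 : modulus (u n) * modulus (v n - m) <= modulus (v n - m) * M.
  by rewrite mulrC ler_wpM2l// modulus_ge0.
have := modulus_ge0 (u n - l); nra.
Qed.

Lemma clim_sum (I : Type) (s : seq I) (u : I -> nat -> C) l :
  (forall i, clim (u i) (l i)) ->
  clim (fun n => \sum_(i <- s) u i n) (\sum_(i <- s) l i).
Proof.
move=> h; elim: s => [|i s IH].
  by under eq_fun do rewrite big_nil; rewrite big_nil; exact: clim_cst.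
by under eq_fun do rewrite big_cons; rewrite big_cons; apply: climD.
Qed.

Lemma clim_ext u v l : (forall n, u n = v n) -> clim u l -> clim v l.
Proof. by move=> /funext ->. Qed.

Lemma clim_unique u l m : clim u l -> clim u m -> l = m.
Proof.
move=> hl hm; apply/eqP; rewrite -subr_eq0 -modulus_eq0; apply/eqP.
apply/eqP; rewrite eq_le modulus_ge0 andbT; apply/ler_addgt0Pl => e e0.
have e2 : 0 < e / 2 by rewrite divr_gt0.
have [N hN] := hl _ e2; have [M hM] := hm _ e2.
have := hN _ (leq_maxl N M); have := hM _ (leq_maxr N M); set k := maxn N M.
rewrite [modulus (u k - l)]modulusBC.
have := modulusD (l - u k) (u k - m); rewrite addrA subrK; lra.
Qed.

Lemma clim_shift k u l : clim u l -> clim (fun n => u (n + k)%N) l.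
Proof.
by move=> h e /h[N hN]; exists N => n hn; apply: hN; rewrite (leq_trans hn)// leq_addr.
Qed.

Lemma clim_subseq (g : nat -> nat) u l : (forall n, (n <= g n)%N) ->
  clim u l -> clim (fun n => u (g n)) l.
Proof.
by move=> g_ge h e /h[N hN]; exists N => n hn; apply: hN; rewrite (leq_trans hn).
Qed.

Lemma clim_Re u l : clim u l -> forall e : R, 0 < e -> exists N, forall n,
  (N <= n)%N -> `|complex.Re (u n) - complex.Re l| <= e.
Proof.
move=> h e /h[N hN]; exists N => n /hN; apply: le_trans.
by rewrite -ReN -ReD Re_le_modulus.
Qed.

Lemma clim_modulus_le u l (c : R) : clim u l -> (forall n, modulus (u n) <= c) ->
  modulus l <= c.
Proof.
move=> h uc; apply/ler_addgt0Pl => e /h[N /(_ _ (leqnn N))].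
have := uc N; have := modulusB (u N) (u N - l); rewrite opprB addrC subrK; lra.
Qed.

Lemma clim_ge0 u l : clim u l -> (forall n, 0 <= u n) -> 0 <= l.
Proof.
move=> h u0.
have u_re n : u n = (complex.Re (u n))%:C%C by apply: ge0_Re.
have hi : complex.Im l = 0.
  apply/eqP; rewrite -normr_eq0 eq_le normr_ge0 andbT; apply/ler_addgt0Pl => e e0.
  have [N /(_ _ (leqnn N))] := h e e0.
  have := Im_le_modulus (u N - l); rewrite ImD ImN u_re/= sub0r normrN; lra.
have hr : 0 <= complex.Re l.
  rewrite leNgt; apply/negP => l0.
  have [|N /(_ _ (leqnn N))] := clim_Re h (e := - complex.Re l / 2).
    by rewrite divr_gt0// oppr_gt0.
  have := ge0_Re_ge0 (u0 N); have := ler_norm (complex.Re (u N) - complex.Re l); lra.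
by rewrite lecE/= hi eqxx.
Qed.

Lemma climP (u : nat -> Cplx R) (l : Cplx R) : clim u l <-> (u @ \oo --> l).
Proof.
split=> [h|h].
  apply/cvgrPdist_le => e /gt0_Re[r r0 ->].
  have [N hN] := h r r0; exists N => // n /= /hN.
  by rewrite distrC norm_le.
move=> e e0; have := h; move/cvgrPdist_le => /(_ e%:C%C).
rewrite ltcR => /(_ e0)[N _ hN]; exists N => n /hN /=.
by rewrite distrC norm_le.
Qed.

Lemma geometric_small (x c e : R) : 0 <= x -> x < 1 -> 0 < e ->
  exists N, forall n, (N <= n)%N -> c * x ^+ n <= e.
Proof.
move=> x0 x1 e0.
have := cvg_expr (z := x); rewrite ger0_norm// => /(_ x1) h.
have c1 : 0 < `|c| + 1 by rewrite ltr_wpDl.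
move/cvgrPdist_le : h => /(_ (e / (`|c| + 1)))[]; first by rewrite divr_gt0.
move=> N _ hN; exists N => n /hN /=.
rewrite sub0r normrN ger0_norm ?exprn_ge0// ler_pdivlMr// mulrC => h.
apply: le_trans h; rewrite ler_wpM2r ?exprn_ge0//; have := ler_norm c; lra.
Qed.

Lemma inv_small (c e : R) : 0 < e -> exists N, forall n, (N <= n)%N -> c / n.+1%:R <= e.
Proof.
move=> e0; exists (Num.truncn (`|c| / e)).+1 => n hn.
rewrite ler_pdivrMr ?ltr0Sn// (le_trans (ler_norm c))// mulrC -ler_pdivrMr//.
rewrite (le_trans (ltW (truncnS_gt _)))// ler_nat.
by rewrite (leq_trans hn).
Qed.

End Limits.

(** * The complex exponential and its quantitative estimates *)

Section ComplexExp.
Variable R : realType.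
Local Notation C := R[i].
Implicit Types (x y z : C) (r t : R).

Definition cexp z : C :=
  Complex (expR (complex.Re z) * cos (complex.Im z))
          (expR (complex.Re z) * sin (complex.Im z)).

Lemma cexpD x y : cexp (x + y) = cexp x * cexp y.
Proof.
by apply: eqC; rewrite ?ReM ?ImM /= ReD ImD expRD ?cosD ?sinD; ring.
Qed.

Lemma cexp_real r : cexp r%:C%C = (expR r)%:C%C.
Proof. by apply: eqC => /=; rewrite ?cos0 ?sin0 ?mulr1 ?mulr0. Qed.

Lemma cexp0 : cexp 0 = 1.
Proof. by rewrite (cexp_real 0) expR0. Qed.

Lemma modulus_cexp z : modulus (cexp z) = expR (complex.Re z).
Proof.
apply/eqP; rewrite -(@eqrXn2 _ 2) ?modulus_ge0 ?expR_ge0// sqr_modulus/=.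
by rewrite !exprMn -mulrDr cos2Dsin2 mulr1.
Qed.

Lemma cexp_neq0 z : cexp z != 0.
Proof. by rewrite -modulus_gt0 modulus_cexp expR_gt0. Qed.

Lemma cexpN z : cexp (- z) = (cexp z)^-1.
Proof.
apply: (mulfI (cexp_neq0 z)); rewrite -cexpD subrr cexp0 divff//.
exact: cexp_neq0.
Qed.

Lemma cexpB x y : cexp (x - y) = cexp x / cexp y.
Proof. by rewrite cexpD cexpN. Qed.

Lemma cexpMn z n : cexp (n%:R * z) = cexp z ^+ n.
Proof.
elim: n => [|n IH]; first by rewrite mul0r cexp0.
by rewrite exprS -IH -cexpD -[n.+1]add1n natrD mulrDl mul1r.
Qed.

Lemma cexpJ z : (cexp z)^* = cexp z^*.
Proof.
by apply: eqC; rewrite ?ReJ ?ImJ /= ReJ ImJ ?cosN ?sinN ?mulrN.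
Qed.

(** Equal moduli give equal real parts. The difference [d] of the imaginary parts has [cos d = 1],
    so [sin (|d| / 2) = 0], which is impossible for [0 < |d| / 2 < pi]. *)
Lemma cexp_inj x y : cexp x = cexp y ->
  `|complex.Im x - complex.Im y| < 2 * pi -> x = y.
Proof.
move=> e h; have er : complex.Re x = complex.Re y.
  by apply: expR_inj; rewrite -!modulus_cexp e.
apply: eqC => //; set d := _ - _ in h.
have e1 : cexp (x - y) = 1 by rewrite cexpB e divff// cexp_neq0.
have : cos d = 1.
  have := congr1 (@complex.Re _) e1; rewrite /= ReD ReN ImD ImN er subrr expR0.
  by rewrite mul1r.
rewrite -cos_norm => cd; clear e e1.
have : cos (`|d| / 2) ^+ 2 = 1.
  have := cos_mulr2n (`|d| / 2); have -> : `|d| / 2 *+ 2 = `|d| by lra.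
  by rewrite cd; lra.
move=> c2; have : sin (`|d| / 2) = 0.
  by apply/eqP; rewrite -sqrf_eq0 sin2cos2 c2 subrr.
move=> s0; apply/eqP; rewrite -subr_eq0 -/d -normr_eq0; apply: contraT => d0.
have : 0 < sin (`|d| / 2).
  apply: sin_gt0_pi; have : 0 < `|d| by rewrite lt_def d0 normr_ge0.
  by move: h; lra.
by rewrite s0 ltxx.
Qed.

Lemma increment_bound (f df : R -> R) (c : R) :
  (forall t, 0 <= t <= 1 -> is_derive t (1 : R) f (df t)) ->
  (forall t, 0 <= t <= 1 -> `|df t| <= c) -> `|f 1 - f 0| <= c.
Proof.
move=> hd hb; have [] := @MVT_segment R f df 0 1 ler01.
- by move=> t; rewrite in_itv/= => /andP[a b]; apply: hd; rewrite !ltW.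
- apply: derivable_within_continuous => t; rewrite in_itv/= => /hd h.
  by apply: ex_derive.
- by move=> t; rewrite in_itv/= => /hb h ->; rewrite subr0 mulr1.
Qed.

(** The mean value theorem fails for complex-valued maps, so it is applied to real and imaginary
    parts separately; this costs the factor 2. *)
Lemma increment_boundC (f df : R -> C) (c : R) :
  (forall t, 0 <= t <= 1 -> is_derive t (1 : R) (fun s =>
    complex.Re (f s) : R) (complex.Re (df t))) ->
  (forall t, 0 <= t <= 1 -> is_derive t (1 : R) (fun s =>
    complex.Im (f s) : R) (complex.Im (df t))) ->
  (forall t, 0 <= t <= 1 -> modulus (df t) <= c) -> modulus (f 1 - f 0) <= 2 * c.
Proof.
move=> h1 h2 hb; apply: le_trans (modulus_le_ReIm _) _.
rewrite ReD ImD ReN ImN mulr_natl mulr2n lerD//.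
  apply: (increment_bound h1) => t /hb; apply: le_trans; exact: Re_le_modulus.
apply: (increment_bound h2) => t /hb; apply: le_trans; exact: Im_le_modulus.
Qed.

Lemma modulus_cexp_le z : modulus (cexp z) <= expR (modulus z).
Proof.
rewrite modulus_cexp ler_expR (le_trans (ler_norm _))//; exact: Re_le_modulus.
Qed.

Lemma is_derive_cexp_Re z t :
  is_derive t (1 : R) (fun s : R => complex.Re (cexp (s%:C%C * z))) (complex.Re (z * cexp
    (t%:C%C * z))).
Proof.
have -> : (fun s : R => complex.Re (cexp (s%:C%C * z))) =
   ((fun s => expR (complex.Re z * s)) * (fun s => cos (complex.Im z * s)))%R.
  by apply/funext => s; rewrite /= ReM ImM /= !mul0r subr0 addr0 !fctE ![s * _]mulrC.
apply: is_derive_eq; rewrite ReM /= !ReM !ImM/= /GRing.scale/= !mulr1.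
rewrite !mul0r subr0 addr0 ![t * _]mulrC; ring.
Qed.

Lemma is_derive_cexp_Im z t :
  is_derive t (1 : R) (fun s : R => complex.Im (cexp (s%:C%C * z))) (complex.Im (z * cexp
    (t%:C%C * z))).
Proof.
have -> : (fun s : R => complex.Im (cexp (s%:C%C * z))) =
   ((fun s => expR (complex.Re z * s)) * (fun s => sin (complex.Im z * s)))%R.
  by apply/funext => s; rewrite /= ReM ImM /= !mul0r subr0 addr0 !fctE ![s * _]mulrC.
apply: is_derive_eq; rewrite ImM /= !ReM !ImM/= /GRing.scale/= !mulr1.
rewrite !mul0r subr0 addr0 ![t * _]mulrC; ring.
Qed.

Lemma modulus_cexp_scale_le z t : 0 <= t <= 1 ->
  modulus (cexp (t%:C%C * z)) <= expR (modulus z).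
Proof.
move=> /andP[t0 t1]; apply: le_trans (modulus_cexp_le _) _.
by rewrite ler_expR modulusM modulus_ge0r// ler_piMl// modulus_ge0.
Qed.

Lemma cexp_sub1 z : modulus (cexp z - 1) <= 2 * (modulus z * expR (modulus z)).
Proof.
have := @increment_boundC (fun t => cexp (t%:C%C * z)) (fun t => z * cexp (t%:C%C * z))
  (modulus z * expR (modulus z)).
rewrite mul1r mul0r cexp0; apply => t ht.
- exact: is_derive_cexp_Re.
- exact: is_derive_cexp_Im.
- by rewrite modulusM ler_wpM2l ?modulus_ge0// modulus_cexp_scale_le.
Qed.

(** The increment bound for [cexp (t z) - t z], whose derivative [z (cexp (t z) - 1)] is itself
    estimated by [cexp_sub1]. *)
Lemma cexp_sub1z z :
  modulus (cexp z - 1 - z) <= 4 * (modulus z ^+ 2 * expR (modulus z)).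
Proof.
pose f t := cexp (t%:C%C * z) - t%:C%C * z.
pose df t := z * cexp (t%:C%C * z) - z.
have -> : cexp z - 1 - z = f 1 - f 0 by rewrite /f !rmorph1 !mul1r !mul0r cexp0; ring.
have -> : 4 * (modulus z ^+ 2 * expR (modulus z)) =
  2 * (modulus z * (2 * (modulus z * expR (modulus z)))) by ring.
apply: (@increment_boundC f df) => t ht.
- have -> : (fun s => complex.Re (f s)) = ((fun s : R => complex.Re (cexp (s%:C%C * z)))
     - (fun s => complex.Re z * s))%R.
    by apply/funext => s; rewrite /f/= ReD ReN ReM/= mul0r subr0 [s * _]mulrC.
  have h := is_derive_cexp_Re z t; apply: is_derive_eq.
  by rewrite /df ReD ReN /GRing.scale/= mulr1.
- have -> : (fun s => complex.Im (f s)) = ((fun s : R => complex.Im (cexp (s%:C%C * z)))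
     - (fun s => complex.Im z * s))%R.
    by apply/funext => s; rewrite /f/= ImD ImN ImM/= mul0r addr0 [s * _]mulrC.
  have h := is_derive_cexp_Im z t; apply: is_derive_eq.
  by rewrite /df ImD ImN /GRing.scale/= mulr1.
- rewrite /df -[X in _ - X]mulr1 -mulrBr modulusM ler_wpM2l ?modulus_ge0//.
  apply: le_trans (cexp_sub1 _) _; case/andP: ht => t0 t1.
  have h : modulus (t%:C%C * z) <= modulus z.
    by rewrite modulusM modulus_ge0r// ler_piMl// modulus_ge0.
  by rewrite ler_wpM2l// ler_pM ?modulus_ge0 ?expR_ge0// ler_expR.
Qed.

Lemma modulus_subX (x y : C) (M : R) n : modulus x <= M -> modulus y <= M ->
  modulus (x ^+ n - y ^+ n) <= n%:R * M ^+ n.-1 * modulus (x - y).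
Proof.
move=> hx hy; case: n => [|n]; first by rewrite !expr0 subrr modulus0 !mul0r.
have M0 : 0 <= M := le_trans (modulus_ge0 _) hx.
rewrite subrXX modulusM mulrC ler_wpM2r ?modulus_ge0//.
apply: le_trans (modulus_sum _ _ _) _.
have -> : n.+1%:R * M ^+ n.+1.-1 = \sum_(i < n.+1) M ^+ n.
  by rewrite sumr_const card_ord mulr_natl.
apply: ler_sum => i _; rewrite modulusM !modulusX /=.
have -> : M ^+ n = M ^+ (n.+1 - i.+1 + i) by rewrite subSS subnK// -ltnS.
by rewrite exprD ler_pM ?exprn_ge0 ?modulus_ge0// lerXn2r ?nnegrE ?modulus_ge0.
Qed.

Lemma clim_cexp (u : nat -> C) l : clim u l -> clim (fun n => cexp (u n)) (cexp l).
Proof.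
move=> h; have h0 : clim (fun n => u n - l) 0.
  by rewrite -(subrr l); apply: climD => //; exact: clim_cst.
have h1 : clim (fun n => cexp (u n - l) - 1) 0.
  have [M M0 [N hN]] := clim_bounded h0.
  rewrite /clim => e e0.
  have c0 : 0 < 2 * expR M by rewrite mulr_gt0// expR_gt0.
  have [|N1 hN1] := h0 (e / (2 * expR M)); first by rewrite divr_gt0.
  exists (maxn N N1) => n; rewrite geq_max => /andP[/hN a /hN1].
  rewrite !subr0 ler_pdivlMr// => b; apply: le_trans (cexp_sub1 _) _.
  apply: le_trans b; rewrite mulrCA ler_wpM2l ?modulus_ge0// ler_wpM2l//.
  by rewrite ler_expR.
apply: (@clim_ext _ (fun n => cexp l * (cexp (u n - l) - 1 + 1))).
  by move=> n; rewrite subrK -cexpD addrC subrK.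
rewrite -[cexp l in X in clim _ X]mulr1 -[1 in X in clim _ X]add0r.
by apply: climZ; apply: climD => //; exact: clim_cst.
Qed.

(** Writing [n] for [n.+1]: [cexp z] is the [n]-th power of [cexp (z / n)], which differs from
    [1 + z / n] by [O(1 / n^2)]. Both have modulus at most [expR (M / n)], so by [modulus_subX]
    taking powers multiplies the difference by at most [n * expR M]. *)
Lemma clim_cexp_pow z : clim (fun n => (1 + z / n.+1%:R) ^+ n.+1) (cexp z).
Proof.
set M := modulus z; move=> e e0.
have [N hN] := inv_small (4 * (M ^+ 2 * expR M) * expR M) e0.
exists N => n /hN; apply: le_trans.
have n0 : 0 < n.+1%:R :> R by rewrite ltr0Sn.
have zn : modulus (z / n.+1%:R) = M / n.+1%:R by rewrite modulusM modulusV modulus_nat.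
have -> : cexp z = cexp (z / n.+1%:R) ^+ n.+1.
  by rewrite -cexpMn mulrC divfK// pnatr_eq0.
rewrite modulusBC.
have M0 : 0 <= M := modulus_ge0 z.
apply: le_trans (modulus_subX _ (M := expR (M / n.+1%:R)) _ _) _.
- by rewrite -zn modulus_cexp_le.
- apply: le_trans (modulusD _ _) _; rewrite modulus1 zn; exact: expR_ge1Dx.
rewrite [n.+1.-1]/= -expRM_natl -mulrA.
have h1 : expR (n%:R * (M / n.+1%:R)) <= expR M.
  rewrite ler_expR mulrCA ler_piMr// ler_pdivrMr// mul1r ler_nat//.
have h2 : modulus (cexp (z / n.+1%:R) - (1 + z / n.+1%:R)) <=
    4 * ((M / n.+1%:R) ^+ 2 * expR M).
  rewrite opprD addrA; apply: le_trans (cexp_sub1z _) _.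
  rewrite zn ler_wpM2l// ler_wpM2l ?sqr_ge0// ler_expR ler_pdivrMr//.
  by rewrite ler_peMr// ler1n.
apply: le_trans (_ : n.+1%:R * (expR M * (4 * ((M / n.+1%:R) ^+ 2 * expR M))) <= _).
  by rewrite ler_wpM2l// ler_pM ?expR_ge0 ?modulus_ge0.
rewrite le_eqVlt; apply/orP; left; apply/eqP; field.
by rewrite addrC natr1 gt_eqF.
Qed.

End ComplexExp.

(** * The principal logarithm *)

Section ComplexLog.
Variable R : realType.
Local Notation C := R[i].
Implicit Types (x y z : C) (r t : R).

Definition clog z : C := Complex (ln (modulus z)) (Arg z).

Lemma Re_div_modulus z : z != 0 -> -1 <= complex.Re z / modulus z <= 1.
Proof.
rewrite -modulus_gt0 => z0; rewrite -ler_norml normrM normfV [`|modulus z|]ger0_norm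
  ?modulus_ge0//.
by rewrite ler_pdivrMr// mul1r Re_le_modulus.
Qed.

Lemma clogK z : z != 0 -> cexp (clog z) = z.
Proof.
move=> z0; have m0 : 0 < modulus z by rewrite modulus_gt0.
have h := Re_div_modulus z0.
have c : modulus z * cos (Arg z) = complex.Re z.
  rewrite /Arg; case: ifP => _; rewrite ?cosN acosK ?in_itv//= mulrC divfK// gt_eqF//.
have s : modulus z * Num.sqrt (1 - (complex.Re z / modulus z) ^+ 2) = `|complex.Im z|.
  rewrite -[X in X * _]ger0_norm ?modulus_ge0// -sqrtr_sqr -sqrtrM ?sqr_ge0//.
  rewrite -[RHS]sqrtr_sqr; congr Num.sqrt; rewrite mulrBr mulr1 -exprMn mulrC divfK ?gt_eqF//.
  by rewrite sqr_modulus; ring.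
apply: eqC; rewrite /= lnK ?posrE//.
move: c s; rewrite /Arg; case: ifPn => [i0 _|].
  by rewrite sin_acos// => ->; rewrite ger0_norm.
by rewrite -ltNge => i0 _; rewrite sinN sin_acos// mulrN => ->; rewrite ltr0_norm ?opprK.
Qed.

Lemma cpowE z (a : R) : z != 0 -> cpow z a = cexp (a%:C%C * clog z).
Proof.
move=> z0; have m0 : modulus z != 0 by rewrite modulus_eq0.
by rewrite /cpow /powR (negbTE m0) /cexp ReM ImM /= !mul0r subr0 addr0.
Qed.

Lemma Re_gt0_neq0 z : 0 < complex.Re z -> z != 0.
Proof. by move=> h; apply/eqP => z0; move: h; rewrite z0/= ltxx. Qed.

Lemma Arg_bound z : 0 < complex.Re z -> - (pi / 2) < Arg z < pi / 2.
Proof.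
move=> re0; have z0 := Re_gt0_neq0 re0.
have h := Re_div_modulus z0.
have q0 : 0 < complex.Re z / modulus z by rewrite divr_gt0// modulus_gt0.
have a1 : acos (complex.Re z / modulus z) < pi / 2.
  rewrite ltNge; apply/negP => hh.
  have := ltr_cos; move=> /(_ R (pi/2) (acos (complex.Re z / modulus z))).
  move: hh; rewrite le_eqVlt => /orP[/eqP e _|hh].
    by move: q0; rewrite -[_ / modulus z]acosK ?in_itv//= -e cos_pihalf ltxx.
  rewrite !in_itv/= hh acos_lepi// acos_ge0// acosK ?in_itv//= cos_pihalf.
  have p0 := @pi_gt0 R.
  have -> : 0 <= pi / 2 :> R by lra.
  have -> : pi / 2 <= pi :> R by lra.
  by rewrite ltNge ltW// => /(_ isT isT).
have a0 := acos_ge0 h; rewrite /Arg; have p0 := @pi_gt0 R.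
by case: ifP => _; apply/andP; split; lra.
Qed.

Lemma Arg_atan z : 0 < complex.Re z -> Arg z = atan (complex.Im z / complex.Re z).
Proof.
move=> re0; have z0 := Re_gt0_neq0 re0; have ab := Arg_bound re0.
have := clogK z0 => e.
have ec := congr1 (@complex.Re _) e; have es := congr1 (@complex.Im _) e.
move: ec es => /=; rewrite lnK ?posrE ?modulus_gt0// => ec es.
rewrite -{1}ec -{1}es -mulf_div divff ?mul1r ?modulus_eq0//.
by rewrite -/(tan _) tanK// in_itv/=.
Qed.

Lemma clog_real r : 0 < r -> clog r%:C%C = (ln r)%:C%C.
Proof.
move=> r0; apply: eqC => /=; first by rewrite modulus_ge0r// ltW.
by rewrite Arg_atan// mul0r atan0.
Qed.

Lemma Re_1B_gt0 x : modulus x < 1 -> 0 < complex.Re (1 - x).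
Proof.
move=> h; rewrite ReD ReN /= subr_gt0.
by rewrite (le_lt_trans (ler_norm _))// (le_lt_trans (Re_le_modulus _)).
Qed.

Lemma neq0_1B x : modulus x < 1 -> 1 - x != 0.
Proof. by move=> /Re_1B_gt0/Re_gt0_neq0. Qed.

(** Partial sums of [- log (1 - x)]; with this sign all coefficients are nonnegative, as positivity
    of kernels requires. *)
Definition log_sum (N : nat) x : C := \sum_(n < N) x ^+ n.+1 / n.+1%:R.

Lemma log_sumS N x : log_sum N.+1 x = log_sum N x + x ^+ N.+1 / N.+1%:R.
Proof. by rewrite /log_sum big_ord_recr. Qed.

Lemma is_derive_log_sum_Re N x t :
  is_derive t (1 : R) (fun s : R => complex.Re (log_sum N (s%:C%C * x)))
    (complex.Re (\sum_(n < N) x * (t%:C%C * x) ^+ n)).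
Proof.
elim: N => [|N IH].
  rewrite big_ord0/= (_ : (fun _ => _) = cst 0); first exact: is_derive_cst.
  by apply/funext => s; rewrite /log_sum big_ord0.
have -> : (fun s : R => complex.Re (log_sum N.+1 (s%:C%C * x))) =
  ((fun s : R => complex.Re (log_sum N (s%:C%C * x))) +
   (complex.Re (x ^+ N.+1) / N.+1%:R \*: (@id R ^+ N.+1)))%R.
  apply/funext => s; rewrite log_sumS ReD !fctE; congr (_ + _).
  rewrite exprMn -!rmorphXn/= -(rmorph_nat (real_complex R)) -fmorphV/=.
  by rewrite ReM/= !ReM/= !mul0r !mulr0 !subr0 /GRing.scale/=; ring.
apply: is_derive_eq; rewrite big_ord_recr/= ReD; congr (_ + _).
rewrite exprMn -!rmorphXn/= mulrCA -exprS ReM/= mul0r subr0 /GRing.scale/= mulr1.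
have n0 : N.+1%:R != 0 :> R by rewrite pnatr_eq0.
rewrite -[_ *+ _]mulr_natr; field; done.
Qed.

Lemma is_derive_log_sum_Im N x t :
  is_derive t (1 : R) (fun s : R => complex.Im (log_sum N (s%:C%C * x)))
    (complex.Im (\sum_(n < N) x * (t%:C%C * x) ^+ n)).
Proof.
elim: N => [|N IH].
  rewrite big_ord0/= (_ : (fun _ => _) = cst 0); first exact: is_derive_cst.
  by apply/funext => s; rewrite /log_sum big_ord0.
have -> : (fun s : R => complex.Im (log_sum N.+1 (s%:C%C * x))) =
  ((fun s : R => complex.Im (log_sum N (s%:C%C * x))) +
   (complex.Im (x ^+ N.+1) / N.+1%:R \*: (@id R ^+ N.+1)))%R.
  apply/funext => s; rewrite log_sumS ImD !fctE; congr (_ + _).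
  rewrite exprMn -!rmorphXn/= -(rmorph_nat (real_complex R)) -fmorphV/=.
  by rewrite ImM/= !ImM/= !mul0r !mulr0 !add0r !addr0 /GRing.scale/=; ring.
apply: is_derive_eq; rewrite big_ord_recr/= ImD; congr (_ + _).
rewrite exprMn -!rmorphXn/= mulrCA -exprS ImM/= mul0r addr0 /GRing.scale/= mulr1.
have n0 : N.+1%:R != 0 :> R by rewrite pnatr_eq0.
rewrite -[_ *+ _]mulr_natr; field; done.
Qed.

Lemma modulus_scale_lt1 x t : 0 <= t <= 1 -> modulus x < 1 -> modulus (t%:C%C * x) < 1.
Proof.
move=> /andP[t0 t1]; apply: le_lt_trans.
by rewrite modulusM modulus_ge0r// ler_piMl// modulus_ge0.
Qed.

Lemma invC (z : C) : z^-1 = (modulus z ^- 2)%:C%C * z^*.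
Proof.
have [->|z0] := eqVneq z 0; first by rewrite invr0 conjC0 mulr0.
apply: (mulfI z0); rewrite divff// mulrCA mulC_conj -rmorphM/= mulVf//.
by rewrite sqrf_eq0 modulus_eq0.
Qed.

Lemma is_derive_clog_Re x t : 0 <= t <= 1 -> modulus x < 1 ->
  is_derive t (1 : R) (fun s : R => complex.Re (clog (1 - s%:C%C * x)))
    (complex.Re (- x / (1 - t%:C%C * x))).
Proof.
move=> ht hx; have h1 := modulus_scale_lt1 ht hx.
have z0 := neq0_1B h1.
pose q := complex.Re x; pose y := complex.Im x.
pose D (s : R) := (1 - q * s) ^+ 2 + (y * s) ^+ 2.
have mE s : modulus (1 - s%:C%C * x) ^+ 2 = D s.
  rewrite sqr_modulus ReD ImD ReN ImN ReM ImM /= !mul0r subr0 addr0 sub0r sqrrN.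
  by rewrite /D ![_ * s]mulrC.
have Dt : 0 < D t by rewrite -mE exprn_gt0// modulus_gt0.
have -> : (fun s : R => complex.Re (clog (1 - s%:C%C * x))) =
  2^-1 \*: (@ln R \o D).
  apply/funext => s; rewrite /= -mE.
  (* The equality of functions has to hold for every real [s], including one with [1 - s x = 0];
     there both sides vanish because [ln 0 = 0]. *)
  have [->|m0] := eqVneq (modulus (1 - s%:C%C * x)) 0.
    by rewrite expr0n/= ln0// scaler0.
  rewrite lnXn; last by rewrite lt_def m0 modulus_ge0.
  by rewrite /GRing.scale/= mulr2n; field.
have dD : is_derive t (1 : R) D (- q * 2 * (1 - q * t) + 2 * y * (y * t)).
  rewrite /D.
  have -> : (fun s => (1 - q * s) ^+ 2 + (y * s) ^+ 2) =
   ((cst 1 - (fun s => q * s)) ^+ 2 + (fun s => y * s) ^+ 2)%R by apply/funext.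
  apply: is_derive_eq; rewrite /GRing.scale/= !fctE !expr1; ring.
have dl := is_derive1_ln Dt.
apply: is_derive_eq.
rewrite invC ReM ReM ImM ReJ ImJ mE !ReD !ImD !ReN !ImN !ReM !ImM /=.
rewrite -/q -/y /GRing.scale/=; clear - Dt; field; lra.
Qed.

Lemma is_derive_clog_Im x t : 0 <= t <= 1 -> modulus x < 1 ->
  is_derive t (1 : R) (fun s : R => complex.Im (clog (1 - s%:C%C * x)))
    (complex.Im (- x / (1 - t%:C%C * x))).
Proof.
move=> ht hx; have h1 := modulus_scale_lt1 ht hx.
have z0 := neq0_1B h1.
pose q := complex.Re x; pose y := complex.Im x.
have rE s : complex.Re (1 - s%:C%C * x) = 1 - q * s.
  by rewrite ReD ReN ReM /= mul0r subr0 [s * _]mulrC.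
have iE s : complex.Im (1 - s%:C%C * x) = - (y * s).
  by rewrite ImD ImN ImM /= mul0r addr0 add0r [s * _]mulrC.
have r0 : 0 < 1 - q * t by rewrite -rE Re_1B_gt0.
have dw : is_derive t (1 : R) ((fun s => - (y * s)) * (fun s => (1 - q * s)^-1))%R
   (- y / (1 - q * t) ^+ 2).
  have d1 : is_derive t (1 : R) (fun s => 1 - q * s) (- q).
    have -> : (fun s => 1 - q * s) = (cst 1 - (fun s => q * s))%R by apply/funext.
    by apply: is_derive_eq; rewrite /GRing.scale/= mulr1 sub0r.
  have d2 : is_derive t (1 : R) (fun s => (1 - q * s)^-1) (- (1 - q * t) ^- 2 *: (- q)).
    by apply: is_deriveV; rewrite gt_eqF.
  apply: is_derive_eq; rewrite /GRing.scale/=; field; lra.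
have da : is_derive t (1 : R) (atan \o ((fun s => - (y * s)) * (fun s => (1 - q * s)^-1))%R)
  (complex.Im (- x / (1 - t%:C%C * x))).
  apply: is_derive_eq.
  rewrite invC ImM ReM ImM ReJ ImJ /= !mul0r subr0 addr0 sqr_modulus !rE !iE ReN ImN.
  rewrite -/q -/y /GRing.scale/= !fctE.
  have e0 : (1 - q * t) ^+ 2 + (y * t) ^+ 2 != 0.
    by rewrite gt_eqF// ltr_wpDr ?sqr_ge0// exprn_gt0.
  clear - r0 e0; field.
  by rewrite sqrrN e0 gt_eqF.
(* [Arg] is given by the arctangent only where the real part is positive, an open condition on [s]
   that holds at [t]. *)
apply: near_eq_is_derive da.
have : \forall s \near t, q * s < 1.
  have hc : (fun s : R => q * s) @ t --> q * t by exact: mulrl_continuous.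
  by have := @cvgr_lt _ _ _ _ _ _ hc 1; rewrite -subr_gt0; exact.
apply: filterS => s hs.
by rewrite /= Arg_atan rE ?subr_gt0// iE.
Qed.

(** Along the ray [t x] the remainder has derivative [- x (t x)^N / (1 - t x)], by summing the
    geometric progression, and [|1 - t x| >= 1 - |x|]. *)
Lemma clog_series_bound x N : modulus x < 1 ->
  modulus (clog (1 - x) + log_sum N x) <= 2 * (modulus x ^+ N.+1 / (1 - modulus x)).
Proof.
move=> hx.
pose f t := clog (1 - t%:C%C * x) + log_sum N (t%:C%C * x).
pose df t := - x / (1 - t%:C%C * x) + \sum_(n < N) x * (t%:C%C * x) ^+ n.
have -> : clog (1 - x) + log_sum N x = f 1 - f 0.
  rewrite /f rmorph1 rmorph0 !mul1r !mul0r (_ : 1 - 0 = 1%:C%C); last exact: subr0.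
  rewrite (clog_real ltr01) ln1 (_ : log_sum N 0 = 0) ?addr0 ?subr0//.
  by rewrite /log_sum big1// => i _; rewrite expr0n/= mul0r.
apply: (@increment_boundC _ f df) => t ht.
- have -> : (fun s => complex.Re (f s)) = ((fun s => complex.Re (clog (1 - s%:C%C * x))) +
    (fun s => complex.Re (log_sum N (s%:C%C * x))))%R.
    by apply/funext => s; rewrite /f ReD fctE.
  have d1 := is_derive_clog_Re ht hx; have d2 := is_derive_log_sum_Re N x t.
  by apply: is_derive_eq; rewrite /df ReD.
- have -> : (fun s => complex.Im (f s)) = ((fun s => complex.Im (clog (1 - s%:C%C * x))) +
    (fun s => complex.Im (log_sum N (s%:C%C * x))))%R.
    by apply/funext => s; rewrite /f ImD fctE.
  have d1 := is_derive_clog_Im ht hx; have d2 := is_derive_log_sum_Im N x t.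
  by apply: is_derive_eq; rewrite /df ImD.
have h1 := modulus_scale_lt1 ht hx; have z0 := neq0_1B h1.
have -> : df t = - (x * (t%:C%C * x) ^+ N) / (1 - t%:C%C * x).
  rewrite /df -mulr_sumr; apply: (mulIf z0); rewrite mulrDl !divfK//.
  have := subrX1 (t%:C%C * x) N => e.
  rewrite -mulrA [_ * (1 - _)]mulrC -opprB mulNr -e; ring.
rewrite modulusM modulusN modulusV modulusM modulusX.
have tx : modulus (t%:C%C * x) <= modulus x.
  by case/andP: ht => t0 t1; rewrite modulusM modulus_ge0r// ler_piMl// modulus_ge0.
rewrite exprS ler_pM ?mulr_ge0 ?exprn_ge0 ?invr_ge0 ?modulus_ge0//.
  by rewrite ler_wpM2l ?modulus_ge0// lerXn2r ?nnegrE ?modulus_ge0.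
rewrite lef_pV2 ?posrE ?subr_gt0 ?modulus_gt0//.
by have := modulusB 1 (1 - t%:C%C * x); rewrite modulus1 subKr => ?;
  have := modulusD (1 - t%:C%C * x) (t%:C%C * x); rewrite subrK modulus1; lra.
Qed.

Lemma clim_log_sum x : modulus x < 1 -> clim (fun N => log_sum N x) (- clog (1 - x)).
Proof.
move=> hx e e0.
have h0 : 0 < 1 - modulus x by rewrite subr_gt0.
have [N hN] := geometric_small (2 / (1 - modulus x)) (modulus_ge0 x) hx e0.
exists N => n hn; rewrite opprK addrC; apply: le_trans (clog_series_bound _ hx) _.
have := hN n.+1 (leqW hn); rewrite mulrAC -mulrA; exact.
Qed.

Lemma Im_clog_1B x : modulus x < 1 -> `|complex.Im (clog (1 - x))| < pi / 2.
Proof.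
move=> h; have /andP[a b] := Arg_bound (Re_1B_gt0 h).
by rewrite /= ltr_norml a b.
Qed.

End ComplexLog.

(** * Positive kernels *)

Section Psd.
Variables (R : realType) (X : Type).
Local Notation C := R[i].
Implicit Types (K Q : X -> X -> C) (s : seq (C * X)).

Definition qform K s : C := \sum_(p <- s) \sum_(q <- s) p.1 * (q.1)^* * K p.2 q.2.

Definition psd K := forall s, 0 <= qform K s.

(* Rank-one kernels are [schur], and [schur] kernels are closed under sums, products and limits;
   working with this class avoids the Schur product theorem. *)
Definition schur Q := forall K, psd K -> psd (fun z w => Q z w * K z w).

Lemma psd_ext K Q : (forall z w, K z w = Q z w) -> psd K -> psd Q.
Proof. by move=> h; have -> // : K = Q by apply/funext => z; apply/funext => w. Qed.

Lemma schur_ext K Q : (forall z w, K z w = Q z w) -> schur K -> schur Q.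
Proof. by move=> h; have -> // : K = Q by apply/funext => z; apply/funext => w. Qed.

Lemma qformD K Q s : qform (fun z w => K z w + Q z w) s = qform K s + qform Q s.
Proof.
rewrite /qform -big_split; apply: eq_bigr => p _; rewrite -big_split.
by apply: eq_bigr => q _; rewrite mulrDr.
Qed.

Lemma qformZ (a : C) K s : qform (fun z w => a * K z w) s = a * qform K s.
Proof.
rewrite /qform mulr_sumr; apply: eq_bigr => p _; rewrite mulr_sumr.
by apply: eq_bigr => q _; ring.
Qed.

Lemma qform_rank1 (f : X -> C) K s : qform (fun z w => f z * (f w)^* * K z w) s =
  qform K [seq (p.1 * f p.2, p.2) | p <- s].
Proof.
rewrite /qform big_map; apply: eq_bigr => p _; rewrite big_map.
by apply: eq_bigr => q _ /=; rewrite rmorphM; ring.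
Qed.

Lemma qform_sqr (f : X -> C) s : qform (fun z w => f z * (f w)^*) s =
  (modulus (\sum_(p <- s) p.1 * f p.2) ^+ 2)%:C%C.
Proof.
rewrite -mulC_conj rmorph_sum mulr_suml; apply: eq_bigr => p _.
rewrite mulr_sumr; apply: eq_bigr => q _; rewrite rmorphM; ring.
Qed.

Lemma psdD K Q : psd K -> psd Q -> psd (fun z w => K z w + Q z w).
Proof. by move=> hK hQ s; rewrite qformD addr_ge0. Qed.

Lemma psd_rank1 (f : X -> C) K : psd K -> psd (fun z w => f z * (f w)^* * K z w).
Proof. by move=> hK s; rewrite qform_rank1. Qed.

Lemma psd_lim (Kn : nat -> X -> X -> C) K : (forall n, psd (Kn n)) ->
  (forall z w, clim (fun n => Kn n z w) (K z w)) -> psd K.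
Proof.
move=> h hl s; apply: (@clim_ge0 _ (fun n => qform (Kn n) s)) => [|n]; last exact: h.
by apply: clim_sum => p; apply: clim_sum => q; apply: climZ.
Qed.

Lemma schur_rank1 (f : X -> C) : schur (fun z w => f z * (f w)^*).
Proof. by move=> K hK; exact: psd_rank1. Qed.

Lemma schurD Q Q' : schur Q -> schur Q' -> schur (fun z w => Q z w + Q' z w).
Proof.
move=> h h' K hK; apply: psd_ext (psdD (h _ hK) (h' _ hK)) => z w.
by rewrite mulrDl.
Qed.

Lemma schurM Q Q' : schur Q -> schur Q' -> schur (fun z w => Q z w * Q' z w).
Proof.
by move=> h h' K hK; apply: psd_ext (h _ (h' _ hK)) => z w; rewrite mulrA.
Qed.

Lemma schur_cst (r : R) : 0 <= r -> schur (fun _ _ => r%:C%C).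
Proof. by move=> r0 K hK s; rewrite qformZ mulr_ge0// ler0c. Qed.

Lemma schur1 : schur (fun _ _ => 1).
Proof. by move=> K hK; apply: psd_ext hK => z w; rewrite mul1r. Qed.

Lemma schurZ (r : R) Q : 0 <= r -> schur Q -> schur (fun z w => r%:C%C * Q z w).
Proof. by move=> r0; apply: schurM; exact: schur_cst. Qed.

Lemma schurX Q n : schur Q -> schur (fun z w => Q z w ^+ n).
Proof.
move=> h; elim: n => [|n IH]; first exact: schur1.
by apply: schur_ext (schurM h IH) => z w; rewrite exprS.
Qed.

Lemma schur_lim (Kn : nat -> X -> X -> C) K : (forall n, schur (Kn n)) ->
  (forall z w, clim (fun n => Kn n z w) (K z w)) -> schur K.
Proof.
move=> h hl K' hK'; apply: (psd_lim (fun n => h n _ hK')) => z w.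
by apply: climM => //; exact: clim_cst.
Qed.

Lemma psd1 : psd (fun _ _ => 1).
Proof.
move=> s; have := qform_sqr (fun=> 1) s.
under eq_fun do under eq_fun do rewrite conjC1 mulr1.
by move=> ->; rewrite ler0c exprn_ge0// modulus_ge0.
Qed.

Lemma schur_psd Q : schur Q -> psd Q.
Proof. by move=> h; apply: psd_ext (h _ psd1) => z w; rewrite mulr1. Qed.

(** [Q^(n+1) - Q'^(n+1) = (Q - Q') Q^n + Q' (Q^n - Q'^n)]. *)
Lemma schur_subX Q Q' n : schur (fun z w => Q z w - Q' z w) -> schur Q -> schur Q' ->
  schur (fun z w => Q z w ^+ n - Q' z w ^+ n).
Proof.
move=> h hQ hQ'; elim: n => [|n IH].
  by apply: schur_ext (schur_cst (lexx 0)) => z w; rewrite !expr0 subrr.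
apply: schur_ext (schurD (schurM h (schurX n hQ)) (schurM hQ' IH)) => z w.
by rewrite !exprS; ring.
Qed.

(** Bernoulli's inequality in the kernel order, from [(1 + Q)^(n+1) - 1 - (n+1) Q = ((1 + Q)^n - 1 -
    n Q) (1 + Q) + n Q^2]. Applied to [Q / n] with [n] tending to infinity it yields [exp Q - 1 - Q]
    without the exponential series. *)
Lemma schur_bernoulli Q n : schur Q ->
  schur (fun z w => (1 + Q z w) ^+ n - 1 - n%:R * Q z w).
Proof.
move=> h; elim: n => [|n IH].
  by apply: schur_ext (schur_cst (lexx 0)) => z w; rewrite expr0 mul0r subrr subr0.
have h2 := schurD (schurM IH (schurD schur1 h)) (schurZ (ler0n R n) (schurX 2 h)).
apply: schur_ext h2 => z w /=.
by rewrite [in RHS]exprS -natr1 (rmorph_nat (real_complex R)); ring.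
Qed.

Lemma schur_divn Q n : schur Q -> schur (fun z w => Q z w / n.+1%:R).
Proof.
move=> h; apply: schur_ext (schurZ (_ : 0 <= n.+1%:R^-1 :> R) h) => //.
by move=> z w; rewrite fmorphV (rmorph_nat (real_complex R)) mulrC.
Qed.

Lemma schur_cexp_sub Q : schur Q -> schur (fun z w => cexp (Q z w) - 1 - Q z w).
Proof.
move=> h; apply: (schur_lim (fun n => schur_bernoulli n.+1 (schur_divn n h))) => z w.
apply: climD; last first.
  apply: (@clim_ext _ (fun=> - Q z w)); last exact: clim_cst.
  by move=> n; rewrite mulrC divfK// pnatr_eq0.
by apply: climD; [exact: clim_cexp_pow | exact: clim_cst].
Qed.

Lemma schur_cexp_sub1 Q : schur Q -> schur (fun z w => cexp (Q z w) - 1).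
Proof.
by move=> h; apply: schur_ext (schurD (schur_cexp_sub h) h) => z w; rewrite subrK.
Qed.

Lemma schur_cexp Q : schur Q -> schur (fun z w => cexp (Q z w)).
Proof.
by move=> h; apply: schur_ext (schurD (schur_cexp_sub1 h) schur1) => z w; rewrite subrK.
Qed.

(** Both terms are powers with exponent [n.+1], of [exp (Q / n.+1)] and of [1 + Q / n.+1], and
    [schur_subX] compares them. *)
Lemma schur_cexp_subpow Q n : schur Q ->
  schur (fun z w => cexp (Q z w) - (1 + Q z w / n.+1%:R) ^+ n.+1).
Proof.
move=> h; have hq := schur_divn n h.
have := schur_subX n.+1 (_ : schur (fun z w => cexp (Q z w / n.+1%:R) - (1 + Q z w / n.+1%:R))).
move=> /(_ _ (schur_cexp hq) (schurD schur1 hq)) hh; apply: schur_ext (hh _).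
  by move=> z w; rewrite -cexpMn mulrC divfK// pnatr_eq0.
by apply: schur_ext (schur_cexp_sub hq) => z w; rewrite opprD addrA.
Qed.

Lemma qform_cons K (a : C) (x : X) s : qform K ((a, x) :: s) =
  a * a^* * K x x + a * (\sum_(q <- s) (q.1)^* * K x q.2)
  + a^* * (\sum_(p <- s) p.1 * K p.2 x) + qform K s.
Proof.
rewrite /qform big_cons/= big_cons/= -!addrA; congr (_ + _).
rewrite mulr_sumr; congr (_ + _).
  by apply: eq_bigr => q _; rewrite mulrA.
rewrite mulr_sumr -big_split; apply: eq_bigr => p _; rewrite big_cons/=.
by congr (_ + _); ring.
Qed.

Lemma psd_diag K x : psd K -> 0 <= K x x.
Proof.
move=> /(_ [:: (1, x)]); rewrite qform_cons !big_nil /qform big_nil.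
by rewrite conjC1 !mulr0 !addr0 !mul1r.
Qed.

(** Nonnegativity in the order of [R[i]] includes being real. That the forms on two points with
    coefficients [(1, 1)] and [(i, 1)] are real gives the imaginary and the real part of the
    symmetry. *)
Lemma psd_herm K x y : psd K -> K x y = (K y x)^*.
Proof.
move=> h; have hx := ger0_Im (psd_diag x h); have hy := ger0_Im (psd_diag y h).
have h1 := h [:: (1, x); (1, y)]; have h2 := h [:: ('i%C, x); (1, y)].
have e a : qform K [:: (a, x); (1, y)] =
   a * a^* * K x x + a * K x y + a^* * K y x + K y y.
  by rewrite !qform_cons !big_cons !big_nil /qform big_nil /= !conjC1; ring.
have {h1} := ger0_Im h1; have {h2} := ger0_Im h2; rewrite !e mulC_conj.
rewrite conjC1 !mul1r !ImD hx hy ImM hx /= => e1 e2.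
by apply: eqC; rewrite ?ReJ ?ImJ; move: e1 e2; rewrite ?ImM /=; clear; lra.
Qed.

(** Cauchy-Schwarz against the point [w]: adjoin [w] with a free coefficient [t] and minimise the
    form over [t]. In terms of function spaces, [K(., w)] belongs to the space with kernel [K] and
    has squared norm at most [K w w]. *)
Lemma psd_CS K w : psd K ->
  psd (fun z z' => K w w * K z z' - K z w * (K z' w)^*).
Proof.
move=> h s; pose al := \sum_(p <- s) p.1 * K p.2 w.
have -> : qform (fun z z' => K w w * K z z' - K z w * (K z' w)^*) s =
   K w w * qform K s - al * al^*.
  rewrite (qformD _ (fun z z' => - (K z w * (K z' w)^*))) qformZ; congr (_ + _).
  rewrite mulC_conj -(qform_sqr (fun z => K z w)) -mulN1r -qformZ.
  by congr qform; apply/funext => z; apply/funext => z'; rewrite mulN1r.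
have bE : \sum_(q <- s) (q.1)^* * K w q.2 = al^*.
  by rewrite rmorph_sum; apply: eq_bigr => q _; rewrite rmorphM/= -psd_herm.
have hs := h s; have hw := psd_diag w h.
have ht t : 0 <= t * t^* * K w w + t * al^* + t^* * al + qform K s.
  by have := h ((t, w) :: s); rewrite qform_cons bE.
have [k0|k0] := eqVneq (K w w) 0.
  have -> : al = 0.
    apply/eqP; rewrite -modulus_eq0; apply/negPn/negP => a0.
    (* When [K w w = 0] the form has no quadratic part in [t]; with this [m] it takes the value
       [q - 2 (q + 1) < 0], where [q] is its value at [t = 0]. *)
    pose m := (complex.Re (qform K s) + 1).
    have hq : 0 <= complex.Re (qform K s) := ge0_Re_ge0 hs.
    have := ge0_Re_ge0 (ht (- (m / modulus al ^+ 2)%:C%C * al)).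
    set r := (m / modulus al ^+ 2)%:C%C.
    have -> : (- r * al)^* = - r * al^*.
      by rewrite rmorphM rmorphN; congr (- _ * _); apply: eqC; rewrite ?ReJ ?ImJ//= oppr0.
    have -> : - r * al * (- r * al^*) * K w w + - r * al * al^* + - r * al^* * al +
       qform K s = qform K s - 2 * r * (al * al^*) by rewrite k0; ring.
    rewrite mulC_conj ReD ReN -mulrA /r -rmorphM divfK ?sqrf_eq0// ReM/= /m; move: hq; clear; lra.
  by rewrite k0 !mul0r subrr.
(* The minimiser of the quadratic in [t]. *)
have := ht (- al / K w w).
have -> : (- al / K w w)^* = - al^* / K w w.
  have kr : (K w w)^* = K w w by rewrite -psd_herm.
  by rewrite rmorphM rmorphN; congr (_ * _); rewrite -[in RHS]kr; exact: fmorphV.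
have -> : - al / K w w * (- al^* / K w w) * K w w + - al / K w w * al^* +
   - al^* / K w w * al + qform K s = (K w w)^-1 * (K w w * qform K s - al * al^*).
  by field.
by rewrite pmulr_rge0// invr_gt0 lt_def k0.
Qed.

End Psd.

(** * Reproducing kernel Hilbert spaces *)

Section HilbertNorm.
Variables (R : realType) (H : hilbertSpace R).
Local Notation C := R[i].
Implicit Types (x y f : H) (a : C).

(* The norm of a Hilbert space over [R[i]] takes its values in [R[i]]. *)
Definition hnorm x : R := complex.Re `|x|.

Lemma norm_hnorm x : `|x| = (hnorm x)%:C%C.
Proof. exact: ge0_Re (normr_ge0 x). Qed.

Lemma hnorm_ge0 x : 0 <= hnorm x.
Proof. exact: ge0_Re_ge0 (normr_ge0 x). Qed.

Lemma hnorm0 : hnorm 0 = 0.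
Proof. by rewrite /hnorm normr0. Qed.

Lemma hnormD x y : hnorm (x + y) <= hnorm x + hnorm y.
Proof. by rewrite -lecR rmorphD/= -!norm_hnorm ler_normD. Qed.

Lemma hnormN x : hnorm (- x) = hnorm x.
Proof. by rewrite /hnorm normrN. Qed.

Lemma hnormBC x y : hnorm (x - y) = hnorm (y - x).
Proof. by rewrite -hnormN opprB. Qed.

Lemma hnormZ a x : hnorm (a *: x) = modulus a * hnorm x.
Proof. by apply: complexI; rewrite rmorphM/= -norm_hnorm normrZ norm_hnorm. Qed.

Lemma hnorm_eq0 x : hnorm x = 0 -> x = 0.
Proof. by move=> h; apply/eqP; rewrite -normr_eq0 norm_hnorm h. Qed.

Lemma innerDl x y z : inner H (x + y) z = inner H x z + inner H y z.
Proof. exact: linearDl. Qed.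
Lemma innerDr x y z : inner H z (x + y) = inner H z x + inner H z y.
Proof. exact: linearDr. Qed.
Lemma innerZl a x y : inner H (a *: x) y = a * inner H x y.
Proof. exact: linearZl_LR. Qed.
Lemma innerZr a x y : inner H x (a *: y) = a^* * inner H x y.
Proof. exact: linearZr_LR. Qed.
Lemma inner0r x : inner H x 0 = 0.
Proof. exact: linear0r. Qed.
Lemma innerC x y : inner H x y = (inner H y x)^*.
Proof. by rewrite hermC/= expr0 mul1r. Qed.
Lemma innerxx x : inner H x x = (hnorm x ^+ 2)%:C%C.
Proof. by rewrite inner_norm norm_hnorm rmorphXn. Qed.

Lemma hnormD_sqr x y : hnorm (x + y) ^+ 2 =
  hnorm x ^+ 2 + hnorm y ^+ 2 + 2 * complex.Re (inner H x y).
Proof.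
apply: complexI; rewrite -innerxx innerDl !innerDr [inner H y x]innerC !innerxx.
by rewrite 2!rmorphD/= -addC_conj; ring.
Qed.

Lemma inner_CS x y : modulus (inner H x y) <= hnorm x * hnorm y.
Proof.
set b := inner H x y.
have ht (t : R) : 0 <= hnorm x ^+ 2 + t ^+ 2 * modulus b ^+ 2 * hnorm y ^+ 2 - 2 * t * modulus b
  ^+ 2.
  have <- : hnorm (x + ((- t)%:C%C * b) *: y) ^+ 2 =
    hnorm x ^+ 2 + t ^+ 2 * modulus b ^+ 2 * hnorm y ^+ 2 - 2 * t * modulus b ^+ 2.
    rewrite hnormD_sqr hnormZ innerZr -/b conj_realM.
    rewrite -[_ * b^* * b]mulrA [b^* * b]mulrC mulC_conj.
    rewrite modulusM modulus_real normrN ReM/= mul0r subr0 exprMn exprMn.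
    by rewrite real_normK ?num_real//; ring.
  exact: sqr_ge0.
have b0 := modulus_ge0 b; have x0 := hnorm_ge0 x; have y0 := hnorm_ge0 y.
have [yz|ynz] := eqVneq (hnorm y) 0.
  by rewrite /b (hnorm_eq0 yz) inner0r modulus0 hnorm0 mulr0.
have y1 : 0 < hnorm y by rewrite lt_def ynz.
have := ht (hnorm y ^- 2); set m := modulus b in b0 *; set p := hnorm x in x0 *.
set q := hnorm y in y0 y1 ynz *.
have -> : p ^+ 2 + q ^- 2 ^+ 2 * m ^+ 2 * q ^+ 2 - 2 * q ^- 2 * m ^+ 2 =
  p ^+ 2 - m ^+ 2 / q ^+ 2 by field.
rewrite subr_ge0 ler_pdivrMr ?exprn_gt0// -exprMn.
by rewrite ler_sqr ?nnegrE ?mulr_ge0.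
Qed.

Definition hlim (u : nat -> H) f := forall e : R, 0 < e -> exists N, forall n,
  (N <= n)%N -> hnorm (u n - f) <= e.

Lemma hlim_complete (u : nat -> H) :
  (forall e : R, 0 < e -> exists N, forall m n, (N <= m)%N -> (N <= n)%N ->
     hnorm (u m - u n) <= e) -> exists f, hlim u f.
Proof.
move=> h; have hc : cvg (u @ \oo).
  apply: cauchy_cvg; apply: cauchy_exP => _ /gt0_Re[r r0 ->].
  have [|N hN] := h (r / 2); first by rewrite divr_gt0.
  exists (u N); exists N => // n /= hn; rewrite -ball_normE/= norm_hnorm ltcR.
  by apply: le_lt_trans (hN _ _ (leqnn N) hn) _; rewrite ltr_pdivrMr// ltr_pMr// ltr1n.
exists (lim (u @ \oo)) => e e0.
have := hc; move/cvgrPdist_le => /(_ e%:C%C); rewrite ltcR => /(_ e0)[N _ hN].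
by exists N => n /hN /=; rewrite norm_hnorm lecR hnormBC.
Qed.

End HilbertNorm.

Section FunctionSpace.
Variables (R : realType) (H : hilbertFunctionSpace R).
Local Notation C := R[i].

(** Positivity of kernels is quantified over all points of a type, while elements of [H] have
    meaningful values on the bidisc only; hence a subtype. *)
Definition bpt := {z : Cplx R * Cplx R | bidisc z}.
Definition fv (f : H) (x : bpt) : C := ev f (sval x).

Lemma fvP (a : C) (f g : H) x : fv (a *: f + g) x = a * fv f x + fv g x.
Proof. by apply: ev_linear; exact: svalP. Qed.

Lemma fvD (f g : H) x : fv (f + g) x = fv f x + fv g x.
Proof. by rewrite -[f]scale1r fvP mul1r scale1r. Qed.

Lemma fv0 x : fv 0 x = 0.
Proof. by have := fvP (-1) 0 0 x; rewrite scaler0 addr0 mulN1r addNr. Qed.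

Lemma fvZ (a : C) (f : H) x : fv (a *: f) x = a * fv f x.
Proof. by rewrite -[_ *: _]addr0 fvP fv0 addr0. Qed.

Lemma fvN (f : H) x : fv (- f) x = - fv f x.
Proof. by rewrite -scaleN1r fvZ mulN1r. Qed.

Lemma fvB (f g : H) x : fv (f - g) x = fv f x - fv g x.
Proof. by rewrite fvD fvN. Qed.

Lemma fv_sum (I : Type) (s : seq I) (F : I -> H) x :
  fv (\sum_(i <- s) F i) x = \sum_(i <- s) fv (F i) x.
Proof. by elim: s => [|i s IH]; rewrite ?big_nil ?fv0// !big_cons fvD IH. Qed.

Lemma fv_inj (f g : H) : (forall x, fv f x = fv g x) -> f = g.
Proof. by move=> h; apply: ev_inj => z hz; exact: h (exist _ z hz). Qed.

Variable K : Cplx R * Cplx R -> Cplx R * Cplx R -> C.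
Hypothesis hK : reproducing_kernel H K.

Let kx : forall w : bpt, {k : H | (forall z, bidisc z -> ev k z = K z (sval w)) /\
    (forall f : H, inner H f k = ev f (sval w))}.
Proof. by move=> w; apply: cid; apply: hK; exact: svalP. Qed.

Definition kvec (w : bpt) : H := sval (kx w).

Definition ker (z w : bpt) : C := K (sval z) (sval w).

Lemma fv_kvec z w : fv (kvec w) z = ker z w.
Proof. by have [h _] := svalP (kx w); apply: h; exact: svalP. Qed.

Lemma inner_kvec f w : inner H f (kvec w) = fv f w.
Proof. by have [_ h] := svalP (kx w); exact: h. Qed.

(** The coefficients are conjugated so that pairing with [comb s] is the sum of point evaluations
    weighted by [s] itself, and [|comb s|^2] is [qform ker s]. *)
Definition comb (s : seq (C * bpt)) : H := \sum_(p <- s) (p.1)^* *: kvec p.2.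

Lemma inner_comb f s : inner H f (comb s) = \sum_(p <- s) p.1 * fv f p.2.
Proof.
rewrite /comb; elim: s => [|p s IH]; first by rewrite !big_nil inner0r.
by rewrite !big_cons innerDr IH innerZr conjCK inner_kvec.
Qed.

Lemma comb_cons a x s : comb ((a, x) :: s) = a^* *: kvec x + comb s.
Proof. by rewrite /comb big_cons. Qed.

Lemma hnorm_comb s : (hnorm (comb s) ^+ 2)%:C%C = qform ker s.
Proof.
rewrite -innerxx inner_comb /qform; apply: eq_bigr => p _.
rewrite /comb fv_sum mulr_sumr; apply: eq_bigr => q _.
by rewrite fvZ fv_kvec -/(ker _ _) mulrA.
Qed.

Lemma psd_ker : psd ker.
Proof. by move=> s; rewrite -hnorm_comb ler0c sqr_ge0. Qed.

Lemma ker_diag w : ker w w = (hnorm (kvec w) ^+ 2)%:C%C.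
Proof. by rewrite -innerxx inner_kvec fv_kvec. Qed.

Lemma fv_bound f w : modulus (fv f w) <= hnorm f * hnorm (kvec w).
Proof. by rewrite -inner_kvec inner_CS. Qed.

Lemma hlim_fv u f w : hlim u f -> clim (fun n => fv (u n) w) (fv f w).
Proof.
move=> h e e0; have c0 : 0 < hnorm (kvec w) + 1 by rewrite ltr_wpDl// hnorm_ge0.
have [|N hN] := h (e / (hnorm (kvec w) + 1)); first by rewrite divr_gt0.
exists N => n /hN; rewrite ler_pdivlMr// -fvB => h1.
apply: le_trans (fv_bound _ _) _; apply: le_trans h1.
by rewrite ler_wpM2l ?hnorm_ge0// lerDl.
Qed.

(** The necessity half of Aronszajn's criterion: Cauchy-Schwarz against [comb s]. *)
Lemma psd_fv f : psd (fun z w => (hnorm f ^+ 2)%:C%C * ker z w - fv f z * (fv f w)^*).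
Proof.
move=> s; rewrite (qformD _ (fun z w => - (fv f z * (fv f w)^*))) qformZ.
have -> : qform (fun z w => - (fv f z * (fv f w)^*)) s =
   - (modulus (\sum_(p <- s) p.1 * fv f p.2) ^+ 2)%:C%C.
  rewrite -qform_sqr -mulN1r -qformZ.
  by congr qform; apply/funext => z; apply/funext => z'; rewrite mulN1r.
rewrite -hnorm_comb -inner_comb -rmorphM/= -rmorphB/= ler0c subr_ge0 -exprMn.
by rewrite ler_sqr ?nnegrE ?modulus_ge0 ?mulr_ge0 ?hnorm_ge0// inner_CS.
Qed.

(* Aronszajn: minimise [|s|^2 - 2 Re l(s)] over the span of the kernel functions, where [l] is the
   functional that [g] should represent. Minimising sequences are Cauchy by the parallelogram
   identity. *)
Lemma kernel_membership_approx (g : bpt -> C) (M : R) : 0 <= M ->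
  psd (fun z w => (M ^+ 2)%:C%C * ker z w - g z * (g w)^*) ->
  exists f, [/\ forall z, fv f z = g z, hnorm f <= M &
    forall e, 0 < e -> exists s, hnorm (f - comb s) <= e].
Proof.
move=> M0 hg; pose l s := \sum_(p <- s) p.1 * g p.2.
have lM s : modulus (l s) <= M * hnorm (comb s).
  have := hg s; rewrite (qformD _ (fun z w => - (g z * (g w)^*))) qformZ.
  have -> : qform (fun z w => - (g z * (g w)^*)) s = - (modulus (l s) ^+ 2)%:C%C.
    rewrite -qform_sqr -mulN1r -qformZ.
    by congr qform; apply/funext => z; apply/funext => z'; rewrite mulN1r.
  rewrite -hnorm_comb -rmorphM/= -rmorphB/= ler0c subr_ge0 -exprMn.
  by rewrite ler_sqr ?nnegrE ?modulus_ge0 ?mulr_ge0 ?hnorm_ge0.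
pose J s := hnorm (comb s) ^+ 2 - 2 * complex.Re (l s).
have Jge s : - M ^+ 2 <= J s.
  have := lM s; have := ler_norm (complex.Re (l s)); have := Re_le_modulus (l s).
  have := sqr_ge0 (M - hnorm (comb s)); rewrite /J; clear; nra.
pose E := [set J s | s in setT].
have hE : has_inf E.
  by split; [exists (J [::]); exists [::] | exists (- M ^+ 2) => _ [s _ <-]].
pose I := inf E.
have Ile s : I <= J s by apply: inf_lbound; [exact: hE.2 | exists s].
have /choice[sn snP] : forall n : nat, exists s, J s <= I + n.+1%:R^-1.
  move=> n; have [|x [s _ <-] hx] := @inf_adherent _ E n.+1%:R^-1 _ hE.
    by rewrite invr_gt0.
  by exists s; exact: ltW.
pose half s := [seq (2^-1 * p.1, p.2) | p <- s : seq (C * bpt)].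
have combcat s t : comb (s ++ t) = comb s + comb t by rewrite /comb big_cat.
have lcat s t : l (s ++ t) = l s + l t by rewrite /l big_cat.
have conj2 : (2^-1 : C)^* = 2^-1.
  by rewrite fmorphV rmorph_nat.
have combhalf s : comb (half s) = 2^-1 *: comb s.
  rewrite /comb big_map scaler_sumr; apply: eq_bigr => p _ /=.
  by rewrite rmorphM/= conj2 scalerA.
have lhalf s : l (half s) = 2^-1 * l s.
  by rewrite /l big_map mulr_sumr; apply: eq_bigr => p _ /=; rewrite mulrA.
have m2 : modulus (2^-1 : C) = 2^-1 by rewrite modulusV modulus_nat.
have re2 (z : C) : complex.Re (2^-1 * z) = 2^-1 * complex.Re z.
  have -> : (2^-1 : C) = (2^-1 : R)%:C%C by rewrite fmorphV rmorph_nat.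
  by rewrite ReM/= mul0r subr0.
(* [half s ++ half t] represents the midpoint of the two combinations, where [J] is still at least
   [I]. *)
have par s t : hnorm (comb s - comb t) ^+ 2 <= 2 * J s + 2 * J t - 4 * I.
  have := Ile (half s ++ half t).
  rewrite /J combcat lcat !combhalf !lhalf -scalerDr hnormZ m2 ReD !re2.
  have h1 := hnormD_sqr (comb s) (comb t).
  have h2 := hnormD_sqr (comb s) (- comb t).
  rewrite hnormN -scaleN1r innerZr scaleN1r rmorphN1 mulN1r ReN in h2.
  by rewrite exprMn h1 h2; clear; lra.
have [f hf] : exists f, hlim (comb \o sn) f.
  apply: hlim_complete => e e0.
  have e2 : 0 < e ^+ 2 by rewrite exprn_gt0.
  have [N hN] := inv_small 4 e2.
  exists N => m n hm hn; rewrite -ler_sqr ?nnegrE ?hnorm_ge0 ?(ltW e0)//.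
  apply: le_trans (par _ _) _.
  have := snP m; have := snP n; have := hN _ hm; have := hN _ hn.
  by move: (n.+1%:R^-1) (m.+1%:R^-1) (J _) (J _) => a b c d; clear; lra.
have fvf x : fv f x = g x.
  apply/eqP; rewrite -subr_eq0 -modulus_eq0; set d := fv f x - g x.
  apply: contraT => d0; have d1 : 0 < modulus d by rewrite lt_def d0 modulus_ge0.
  pose k := hnorm (kvec x) ^+ 2; have k0 : 0 <= k by rewrite sqr_ge0.
  (* Adding the kernel function at [x] with coefficient [t] cannot bring a minimising sequence below
     [I]; in the limit this is the first-order condition at the minimum. *)
  have key t : 0 <= 2 * complex.Re (t * d) + modulus t ^+ 2 * k.
    apply/ler_addgt0Pl => e e0.
    have e2 : 0 < e / 2 by rewrite divr_gt0.
    have [N1 hN1] := inv_small 1 e2.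
    have hl : clim (fun n => 2 * (t * (fv ((comb \o sn) n) x - g x))) (2 * (t * d)).
      apply: climZ; apply: climZ; apply: climD; [exact: hlim_fv|exact: clim_cst].
    have [N2 hN2] := clim_Re hl e2.
    pose n := maxn N1 N2; have := hN1 n (leq_maxl _ _); have := hN2 n (leq_maxr _ _).
    have := Ile ((t, x) :: sn n); have := snP n.
    rewrite /J comb_cons /l big_cons/= -/(l (sn n)) addrC.
    rewrite [_ + comb (sn n)]addrC hnormD_sqr hnormZ modulus_conj exprMn -/k.
    rewrite innerZr conjCK inner_kvec ReD => a1 a2 a3.
    have r2 (z : C) : complex.Re (2 * z) = 2 * complex.Re z.
      by rewrite ReM /=; ring.
    move: a3; rewrite !r2 mulrBr ReD ReN ler_norml => /andP[_ a3] a4.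
    move: a1 a2 a3 a4; rewrite /J; by move: (n.+1%:R^-1) => r; clear; lra.
  have k1 : 0 < k + 1 by rewrite ltr_wpDl.
  (* This [t] makes the right-hand side [- (k + 2) |d|^2 / (k + 1)^2]. The [+ 1] avoids a division
     by 0 when the kernel function at [x] vanishes. *)
  have := key ((- (k + 1)^-1)%:C%C * d^*).
  rewrite -[_ * d^* * d]mulrA [d^* * d]mulrC mulC_conj -rmorphM/= modulusM modulus_conj.
  rewrite modulus_real normrN ger0_norm; last by rewrite invr_ge0 ltW.
  set m := modulus d in d0 d1 *.
  have -> : 2 * (- (k + 1)^-1 * m ^+ 2) + ((k + 1)^-1 * m) ^+ 2 * k =
     - ((k + 2) * m ^+ 2 / (k + 1) ^+ 2).
    by field; rewrite gt_eqF.
  rewrite oppr_ge0 leNgt => /negP[]; rewrite divr_gt0 ?exprn_gt0// mulr_gt0 ?exprn_gt0//.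
  by rewrite ltr_wpDl.
exists f; split => //.
- have h s : modulus (inner H f (comb s)) <= M * hnorm (comb s).
    by rewrite inner_comb; under eq_bigr do rewrite fvf; exact: lM.
  have [f0|f0] := eqVneq (hnorm f) 0; first by rewrite f0.
  have f1 : 0 < hnorm f by rewrite lt_def f0 hnorm_ge0.
  (* [|f|^2] is the limit of [inner f (comb (sn n))], of modulus at most [M |comb (sn n)|], and
     these norms tend to [|f|]. *)
  suff : hnorm f * hnorm f <= M * hnorm f by rewrite ler_pM2r.
  apply/ler_addgt0Pl => e e0.
  have c0 : 0 < M + hnorm f by rewrite ltr_wpDl.
  have [|N /(_ _ (leqnn N)) hN] := hf (e / (M + hnorm f)); first by rewrite divr_gt0.
  set u := (comb \o sn) N in hN.
  have h1 := h (sn N); have h2 := inner_CS f (f - u).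
  have h3 : hnorm f * hnorm f <= modulus (inner H f u) + modulus (inner H f (f - u)).
    have := modulusD (inner H f u) (inner H f (f - u)); rewrite -innerDr addrC subrK.
    by rewrite innerxx modulus_real ger0_norm ?exprn_ge0 ?hnorm_ge0// expr2.
  have h4 := hnormD (u - f) f; rewrite subrK in h4.
  move: hN h1 h2 h3 h4; rewrite ler_pdivlMr// hnormBC -/u => hN h1 h2 h3 h4.
  have h5 : M * hnorm u <= M * hnorm (f - u) + M * hnorm f.
    by rewrite -mulrDr ler_wpM2l// hnormBC.
  by move: hN h1 h2 h3 h5; rewrite -/u; clear; lra.
- by move=> e /hf[N /(_ _ (leqnn N)) h]; exists (sn N); rewrite hnormBC.
Qed.

Lemma kernel_membership (g : bpt -> C) (M : R) : 0 <= M ->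
  psd (fun z w => (M ^+ 2)%:C%C * ker z w - g z * (g w)^*) ->
  exists2 f, forall z, fv f z = g z & hnorm f <= M.
Proof. by move=> M0 /(kernel_membership_approx M0)[f [h1 h2 _]]; exists f. Qed.

Lemma comb_dense f e : 0 < e -> exists s, hnorm (f - comb s) <= e.
Proof.
move=> e0; have [g [h1 h2]] := kernel_membership_approx (hnorm_ge0 f) (psd_fv f).
by rewrite (fv_inj h1); exact.
Qed.

End FunctionSpace.

(** * The kernel as an exponential *)

Section KernelStructure.
Variable R : realType.
Local Notation C := R[i].
Local Notation X := (bpt R).
Implicit Types (z w : X) (n N : nat).

Definition p1 z : C := (sval z).1.
Definition p2 z : C := (sval z).2.

Lemma p1_lt1 z : modulus (p1 z) < 1.
Proof. by rewrite -norm_lt1; have [] := svalP z. Qed.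

Lemma p2_lt1 z : modulus (p2 z) < 1.
Proof. by rewrite -norm_lt1; have [] := svalP z. Qed.

Lemma mulJ_lt1 (x y : C) : modulus x < 1 -> modulus y < 1 -> modulus (x * y^*) < 1.
Proof.
move=> hx hy; rewrite modulusM modulus_conj.
by rewrite mulr_ilt1 ?modulus_ge0.
Qed.

Section Exponent.
Variables (a b c : R).
Hypotheses (a0 : 0 <= a) (b0 : 0 <= b) (c0 : 0 <= c).

(** For [L x = - log (1 - x)] this is the exponent of the kernel, with [a = alpha - gamma],
    [b = beta - gamma] and [c = gamma]. Leaving [L] free lets single terms, partial sums and the
    limit share the algebra. *)
Definition Qform (L : C -> C) z w : C :=
  a%:C%C * L (p1 z * (p1 w)^*) + b%:C%C * L (p2 z * (p2 w)^*)
  + c%:C%C * (L (p1 z * (p1 w)^*) + L (p2 z * (p2 w)^*)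
              - L (p1 z * (p2 w)^*) - L (p2 z * (p1 w)^*)).

Definition Qpart N := Qform (log_sum N).
Definition Qlim := Qform (fun x => - clog (1 - x)).

Lemma clim_Qpart z w : clim (fun N => Qpart N z w) (Qlim z w).
Proof.
have h (x y : C) : modulus x < 1 -> modulus y < 1 ->
    clim (fun N => log_sum N (x * y^*)) (- clog (1 - x * y^*)).
  by move=> hx hy; apply: clim_log_sum; exact: mulJ_lt1.
have h11 := h _ _ (p1_lt1 z) (p1_lt1 w); have h22 := h _ _ (p2_lt1 z) (p2_lt1 w).
have h12 := h _ _ (p1_lt1 z) (p2_lt1 w); have h21 := h _ _ (p2_lt1 z) (p1_lt1 w).
apply: climD; first by apply: climD; exact: climZ.
apply: climZ; apply: climD; last exact: climN.
by apply: climD; [exact: climD | exact: climN].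
Qed.

Lemma schur_monomial (f : X -> C) (r : R) n : 0 <= r ->
  schur (fun z w => r%:C%C * (f z * (f w)^*) ^+ n).
Proof. by move=> r0; apply: schurZ => //; apply: schurX; exact: schur_rank1. Qed.

Lemma schur_Qterm n : schur (Qform (fun x => x ^+ n.+1 / n.+1%:R)).
Proof.
have h1 := schur_divn n (schur_monomial p1 n.+1 a0).
have h2 := schur_divn n (schur_monomial p2 n.+1 b0).
have h3 := schur_divn n (schurZ c0 (schur_rank1 (fun z => p1 z ^+ n.+1 - p2 z ^+ n.+1))).
apply: schur_ext (schurD (schurD h1 h2) h3) => z w.
rewrite /Qform rmorphB !rmorphXn /= !exprMn; ring.
Qed.

Lemma QformD (f g : C -> C) z w : Qform (fun x => f x + g x) z w = Qform f z w + Qform g z w.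
Proof. by rewrite /Qform; ring. Qed.

Lemma QpartS N z w :
  Qpart N.+1 z w = Qpart N z w + Qform (fun x => x ^+ N.+1 / N.+1%:R) z w.
Proof.
rewrite -QformD /Qpart; congr (Qform _ z w).
by apply/funext => x; exact: log_sumS.
Qed.

Lemma schur_Qpart_sub N M : schur (fun z w => Qpart (M + N) z w - Qpart N z w).
Proof.
elim: M => [|M IH].
  by apply: schur_ext (schur_cst (lexx 0)) => z w; rewrite subrr.
apply: schur_ext (schurD IH (schur_Qterm (M + N))) => z w.
by rewrite addSn QpartS; ring.
Qed.

Lemma Qpart0 z w : Qpart 0 z w = 0.
Proof.
rewrite /Qpart /Qform (_ : log_sum 0 = fun=> 0); last by apply/funext => x;
  rewrite /log_sum big_ord0.
by ring.
Qed.

Lemma schur_Qpart N : schur (Qpart N).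
Proof. by apply: schur_ext (schur_Qpart_sub 0 N) => z w; rewrite addn0 Qpart0 subr0. Qed.

Lemma schur_Qlim_sub N : schur (fun z w => Qlim z w - Qpart N z w).
Proof.
apply: (schur_lim (schur_Qpart_sub N)) => z w.
apply: climD; last exact: clim_cst.
by have := clim_shift N (clim_Qpart z w).
Qed.

Lemma schur_Qlim : schur Qlim.
Proof. by apply: schur_ext (schur_Qlim_sub 0) => z w; rewrite Qpart0 subr0. Qed.

(** A polynomial in [z] for fixed [w]. It lies below the kernel in the kernel order, so its distance
    from the kernel function at [w] is governed by the diagonal value at [w] alone. *)
Definition Bapprox N n z w : C := (1 + Qpart N z w / n.+1%:R) ^+ n.+1.

Lemma schur_Bapprox N n : schur (Bapprox N n).
Proof. exact: schurX n.+1 (schurD (@schur1 _ _) (schur_divn n (schur_Qpart N))). Qed.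

Lemma schur_cexp_mono (Q Q' : X -> X -> C) : schur (fun z w => Q z w - Q' z w) -> schur Q' ->
  schur (fun z w => cexp (Q z w) - cexp (Q' z w)).
Proof.
move=> h h'; apply: schur_ext (schurM (schur_cexp h') (schur_cexp_sub1 h)) => z w.
by rewrite mulrBr mulr1 -cexpD [_ + (_ - _)]addrC subrK.
Qed.

Lemma schur_Bapprox_sub N n : schur (fun z w => cexp (Qlim z w) - Bapprox N n z w).
Proof.
have h1 := schur_cexp_mono (schur_Qlim_sub N) (schur_Qpart N).
by apply: schur_ext (schurD h1 (schur_cexp_subpow n (schur_Qpart N))) => z w;
  rewrite /Bapprox addrA subrK.
Qed.

Lemma Bapprox_lim z w e : 0 < e -> exists N n,
  modulus (cexp (Qlim z w) - Bapprox N n z w) <= e.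
Proof.
move=> e0; have e2 : 0 < e / 2 by rewrite divr_gt0.
have [N hN] := clim_cexp (clim_Qpart z w) e2.
have [n hn] := clim_cexp_pow (Qpart N z w) e2.
exists N, n; rewrite -[X in modulus X](subrKA (cexp (Qpart N z w))).
have := hN _ (leqnn N); have := hn _ (leqnn n); rewrite modulusBC => h1.
rewrite modulusBC => h2; apply: le_trans (modulusD _ _) _.
by move: h1 h2; rewrite /Bapprox; lra.
Qed.

(* [1 - x^m/D] is the exponential of [- sum_k x^(mk) / (k D^k)]; the comparison of exponents makes
   [(D - x^m) (1 - x)^-a'] a positive kernel. *)
Lemma schur_log_block (f : X -> C) (a' D : R) m M : 0 < a' -> 1 <= D -> m.+1%:R / a' <= D ->
  schur (fun z w => a'%:C%C * log_sum (M * m.+1) (f z * (f w)^*)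
    - log_sum M ((f z * (f w)^*) ^+ m.+1 / D%:C%C)).
Proof.
move=> a'0 D1 hD; have D0 : 0 < D by apply: lt_le_trans D1.
elim: M => [|M IH].
  apply: schur_ext (schur_cst (lexx 0)) => z w.
  by rewrite mul0n /log_sum !big_ord0 mulr0 subrr.
have block k : schur (fun z w => a'%:C%C * (log_sum (k + M * m.+1) (f z * (f w)^*)
     - log_sum (M * m.+1) (f z * (f w)^*))).
  elim: k => [|k IHk].
    by apply: schur_ext (schur_cst (lexx 0)) => z w; rewrite add0n subrr mulr0.
  apply: schur_ext (schurD IHk (schur_divn (k + M * m.+1) (schur_monomial f (k + M * m.+1).+1
    (ltW a'0)))) => z w.
  by rewrite addSn log_sumS; ring.
(* The next block of [m.+1] exponents ends with a multiple of [m.+1], the only one at which both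
   series have a term. [r] is the difference of their coefficients there, nonnegative since
   [m.+1 <= a' D <= a' D ^+ M.+1]; the other [m] terms are [block m]. *)
pose r : R := a' / (M.+1 * m.+1)%:R - (M.+1%:R * D ^+ M.+1)^-1.
have r0 : 0 <= r.
  rewrite subr_ge0 natrM ler_pdivlMr; last by rewrite mulr_gt0// ltr0Sn.
  rewrite mulrC ler_pdivrMr; last by rewrite mulr_gt0 ?exprn_gt0// ltr0Sn.
  rewrite mulrCA ler_wpM2l//.
  have : D <= D ^+ M.+1 by rewrite exprS ler_peMr ?(ltW D0)// exprn_ege1.
  move: hD; rewrite ler_pdivrMr// [D * a']mulrC => h1 h2; apply: le_trans h1 _.
  by rewrite ler_wpM2l// ltW.
apply: schur_ext (schurD (schurD IH (block m)) (schur_monomial f (M.+1 * m.+1) r0)) => z w.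
set x := f z * (f w)^*.
have ke : (M.+1 * m.+1 = (m + M * m.+1).+1)%N by rewrite mulSn addSn.
have -> : (r%:C%C : C) = a'%:C%C / (m + M * m.+1).+1%:R - (M.+1%:R * D%:C%C ^+ M.+1)^-1.
  by rewrite /r rmorphB rmorphM !fmorphV rmorphM rmorphXn !rmorph_nat ke.
rewrite ke !log_sumS [(x ^+ m.+1 / _) ^+ _]exprMn -exprM exprVn [(m.+1 * _)%N]mulnC ke.
have D2 : (D%:C%C : C) != 0.
  by apply/eqP => /(congr1 (@complex.Re _)) /= hh; move: D0; rewrite hh ltxx.
have n1 : (M.+1%:R : C) != 0 by rewrite pnatr_eq0.
have n2 : ((m + M * m.+1).+1%:R : C) != 0 by rewrite pnatr_eq0.
by rewrite invfM; ring.
Qed.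

End Exponent.

End KernelStructure.

(** * Positive kernels behind the bounds on powers of the coordinates *)

Section MultiplierBounds.
Variables (R : realType) (alpha beta gamma : R).
Hypotheses (hgamma : 0 < gamma) (halpha : gamma < alpha) (hbeta : gamma < beta).
Local Notation C := R[i].
Local Notation X := (bpt R).
Local Notation B := (ker (Bkernel alpha beta gamma)).
Local Notation a := (alpha - gamma).
Local Notation b := (beta - gamma).

Let a0 : 0 < a. Proof. by rewrite subr_gt0. Qed.
Let b0 : 0 < b. Proof. by rewrite subr_gt0. Qed.
Let c0 : 0 <= gamma. Proof. exact: ltW. Qed.

Lemma BkernelE (z w : X) : B z w = cexp (Qlim a b gamma z w).
Proof.
have h (x y : C) r : modulus x < 1 -> modulus y < 1 ->
    cpow (1 - x * y^*) r = cexp (r%:C%C * clog (1 - x * y^*)).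
  by move=> hx hy; apply/cpowE/neq0_1B/mulJ_lt1.
rewrite /ker /Bkernel !h; try exact: p1_lt1; try exact: p2_lt1.
rewrite -!cexpD; congr cexp; rewrite /Qlim /Qform /p1 /p2 !rmorphB !rmorphN; ring.
Qed.

Lemma BapproxP (N n : nat) : schur (fun z w : X => B z w - Bapprox a b gamma N n z w).
Proof.
by apply: schur_ext (schur_Bapprox_sub (ltW a0) (ltW b0) c0 N n) => z w; rewrite BkernelE.
Qed.

Lemma schur_B_sub1 : schur (fun z w : X => B z w - 1).
Proof.
apply: schur_ext (schur_cexp_sub1 (schur_Qlim (ltW a0) (ltW b0) c0)) => z w.
by rewrite BkernelE.
Qed.

(** [D - x^m] is [D * exp (log (1 - x^m / D))], where [D >= 1] keeps [x^m / D] in the disc, so the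
    product is a single exponential. [Q] is the part of the exponent that does not take part in the
    comparison. *)
Lemma schur_power_bound (f : X -> C) (a' D : R) (Q : X -> X -> C) m :
  (forall z, modulus (f z) < 1) -> 0 < a' -> 1 <= D -> m.+1%:R / a' <= D ->
  schur Q ->
  schur (fun z w => (D%:C%C - (f z * (f w)^*) ^+ m.+1) *
     cexp (a'%:C%C * - clog (1 - f z * (f w)^*) + Q z w)).
Proof.
move=> hf a'0 D1 hD hQ; have D0 : 0 < D by apply: lt_le_trans D1.
have y1 z w : modulus ((f z * (f w)^*) ^+ m.+1 / D%:C%C) < 1.
  rewrite modulusM modulusV modulus_ge0r ?(ltW D0)// ltr_pdivrMr// mul1r.
  by rewrite (lt_le_trans _ D1)// modulusX exprn_ilt1 ?modulus_ge0// mulJ_lt1.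
have h : schur (fun z w => a'%:C%C * - clog (1 - f z * (f w)^*)
     - - clog (1 - (f z * (f w)^*) ^+ m.+1 / D%:C%C)).
  apply: (schur_lim (fun M => schur_log_block f M a'0 D1 hD)) => z w.
  apply: climD; last by apply/climN/clim_log_sum/y1.
  apply: climZ.
  have := clim_subseq (g := fun M => (M * m.+1)%N) _ (clim_log_sum (mulJ_lt1 (hf z) (hf w))).
  by apply => M; exact: leq_pmulr.
apply: schur_ext (schurZ (ltW D0) (schur_cexp (schurD h hQ))) => z w.
set y := _ / D%:C%C; have D2 : (D%:C%C : C) != 0.
  by rewrite -modulus_gt0 modulus_ge0r// ltW.
have -> : D%:C%C - (f z * (f w)^*) ^+ m.+1 = D%:C%C * cexp (clog (1 - y)).
  by rewrite clogK; [rewrite mulrBr mulr1 /y [_%:C%C * (_ / _)]mulrC divfK | apply: neq0_1B;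
    exact: y1].
by rewrite -mulrA -cexpD; congr (_ * cexp _); ring.
Qed.

(** [1 + m.+1 / a] is a simple constant above both 1 and [m.+1 / a]. Once the factor with exponent
    [- a] is split off, the kernel keeps the exponent [Qlim 0 b gamma], which is still positive. *)
Lemma schur_p1_power (m : nat) : schur (fun z w : X =>
  ((1 + m.+1%:R / a)%:C%C - (p1 z * (p1 w)^*) ^+ m.+1) * B z w).
Proof.
have hq : 0 <= m.+1%:R / a by rewrite divr_ge0// ltW.
have h1 : 1 <= 1 + m.+1%:R / a by rewrite lerDl.
have h2 : m.+1%:R / a <= 1 + m.+1%:R / a by rewrite lerDr.
apply: schur_ext (schur_power_bound (@p1_lt1 R) a0 h1 h2 (schur_Qlim (lexx 0) (ltW b0) c0)).
move=> z w; rewrite BkernelE; congr (_ * cexp _).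
by rewrite /Qlim /Qform rmorph0; ring.
Qed.

Lemma schur_p2_power (m : nat) : schur (fun z w : X =>
  ((1 + m.+1%:R / b)%:C%C - (p2 z * (p2 w)^*) ^+ m.+1) * B z w).
Proof.
have hq : 0 <= m.+1%:R / b by rewrite divr_ge0// ltW.
have h1 : 1 <= 1 + m.+1%:R / b by rewrite lerDl.
have h2 : m.+1%:R / b <= 1 + m.+1%:R / b by rewrite lerDr.
apply: schur_ext (schur_power_bound (@p2_lt1 R) b0 h1 h2 (schur_Qlim (ltW a0) (lexx 0) c0)).
move=> z w; rewrite BkernelE; congr (_ * cexp _).
by rewrite /Qlim /Qform rmorph0; ring.
Qed.

End MultiplierBounds.

(** * Multiplication operators from positive kernels *)

Section Multipliers.
Variables (R : realType) (H : hilbertFunctionSpace R).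
Local Notation C := R[i].
Local Notation X := (bpt R).
Variable K : Cplx R * Cplx R -> Cplx R * Cplx R -> C.
Hypothesis hK : reproducing_kernel H K.

(** Writing ['] for conjugation at [w], [M^2 |f|^2 K - m f m' f'] is [m m' (|f|^2 K - f f') + |f|^2
    (M^2 - m m') K], a sum of two positive kernels. *)
Lemma multiplier_exists (m : X -> C) (M : R) : 0 <= M ->
  psd (fun z w => ((M ^+ 2)%:C%C - m z * (m w)^*) * ker K z w) ->
  forall f : H, exists2 g : H, forall z, fv g z = m z * fv f z & hnorm g <= M * hnorm f.
Proof.
move=> M0 hm f; apply: (kernel_membership hK); first by rewrite mulr_ge0 ?hnorm_ge0.
have h1 := psd_rank1 m (psd_fv hK f).
have h2 : psd (fun z w => (hnorm f ^+ 2)%:C%C *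
    (((M ^+ 2)%:C%C - m z * (m w)^*) * ker K z w)).
  by move=> s; rewrite qformZ mulr_ge0// ler0c sqr_ge0.
apply: psd_ext (psdD h1 h2) => z w.
by rewrite rmorphM exprMn rmorphM; ring.
Qed.

Lemma multiplier_op (m : X -> C) (M : R) :
  (forall f : H, exists2 g : H, forall z, fv g z = m z * fv f z & hnorm g <= M * hnorm f) ->
  exists T : {linear H -> H}, (forall f z, fv (T f) z = m z * fv f z) /\
    forall f, hnorm (T f) <= M * hnorm f.
Proof.
move=> h; have /choice[T hT] : forall f : H, exists g : H,
    (forall z, fv g z = m z * fv f z) /\ hnorm g <= M * hnorm f.
  by move=> f; have [g] := h f; exists g.
have lin : linear T.
  move=> k f g; apply: fv_inj => z.
  by rewrite fvP !(hT _).1 fvP; ring.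
pose TL : {linear H -> H} := HB.pack T (GRing.isLinear.Build _ _ _ _ T lin).
by exists TL; split=> f; have [] := hT f.
Qed.

End Multipliers.

(** * Polynomials in the space and their density *)

Section Polynomials.
Variables (R : realType).
Local Notation C := R[i].
Local Notation X := (bpt R).

Definition poly2_fun (g : X -> C) := exists p : {poly {poly C}}, forall z, g z = p.[p1 z, p2 z].

Lemma poly2_ext (f g : X -> C) : (forall z, f z = g z) -> poly2_fun f -> poly2_fun g.
Proof. by move=> /funext ->. Qed.

Lemma poly2_cst (c : C) : poly2_fun (fun=> c).
Proof. by exists c%:P%:P => z; rewrite !hornerC. Qed.

Lemma poly2_p1 : poly2_fun (@p1 R).
Proof. by exists 'X => z; rewrite hornerX hornerC. Qed.

Lemma poly2_p2 : poly2_fun (@p2 R).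
Proof. by exists 'X%:P => z; rewrite hornerC hornerX. Qed.

Lemma poly2D f g : poly2_fun f -> poly2_fun g -> poly2_fun (fun z => f z + g z).
Proof. by move=> [p hp] [q hq]; exists (p + q) => z; rewrite !hornerD hp hq. Qed.

Lemma poly2M f g : poly2_fun f -> poly2_fun g -> poly2_fun (fun z => f z * g z).
Proof. by move=> [p hp] [q hq]; exists (p * q) => z; rewrite !hornerM hp hq. Qed.

Lemma poly2Z (c : C) f : poly2_fun f -> poly2_fun (fun z => c * f z).
Proof. exact: poly2M (poly2_cst c). Qed.

Lemma poly2X f n : poly2_fun f -> poly2_fun (fun z => f z ^+ n).
Proof.
move=> h; elim: n => [|n IH]; first exact: poly2_cst.
by apply: poly2_ext (poly2M h IH) => z; rewrite exprS.
Qed.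

Lemma poly2_sum (I : Type) (s : seq I) (f : I -> X -> C) :
  (forall i, poly2_fun (f i)) -> poly2_fun (fun z => \sum_(i <- s) f i z).
Proof.
move=> h; elim: s => [|i s IH].
  by apply: poly2_ext (poly2_cst 0) => z; rewrite big_nil.
by apply: poly2_ext (poly2D (h i) IH) => z; rewrite big_cons.
Qed.

Lemma poly2_log_sum N f (c : C) : poly2_fun f -> poly2_fun (fun z => log_sum N (f z * c)).
Proof.
move=> h; apply: poly2_sum => i.
apply: (@poly2_ext (fun z => (c ^+ i.+1 / i.+1%:R) * f z ^+ i.+1)); last exact/poly2Z/poly2X.
by move=> z; rewrite exprMn; ring.
Qed.

Lemma poly2_Bapprox a b c N n (w : X) : poly2_fun (fun z => Bapprox a b c N n z w).
Proof.
have h1 d := poly2_log_sum N d poly2_p1; have h2 d := poly2_log_sum N d poly2_p2.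
apply: poly2X; apply: poly2D; first exact: poly2_cst.
apply: (@poly2_ext (fun z => n.+1%:R^-1 * Qpart a b c N z w)); first by move=> z; rewrite mulrC.
apply: poly2Z.
have hN f : poly2_fun f -> poly2_fun (fun z => - f z).
  by move=> h; apply: poly2_ext (poly2Z (-1) h) => z; rewrite mulN1r.
apply: poly2D; first by apply: poly2D; exact: poly2Z.
apply: poly2Z; apply: poly2D; last exact: hN.
by apply: poly2D; [exact: poly2D | exact: hN].
Qed.

Variables (alpha beta gamma : R).
Hypotheses (hgamma : 0 < gamma) (halpha : gamma < alpha) (hbeta : gamma < beta).
Variable H : hilbertFunctionSpace R.
Hypothesis hH : reproducing_kernel H (Bkernel alpha beta gamma).
Local Notation B := (ker (Bkernel alpha beta gamma)).

Definition polyvec (f : H) := poly2_fun (fv f).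

Lemma polyvecP f : polyvec f <-> exists p, represents f p.
Proof.
split=> -[p hp]; exists p.
  by move=> z hz; exact: hp (exist _ z hz).
by move=> [z hz]; exact: hp.
Qed.

Lemma polyvecD f g : polyvec f -> polyvec g -> polyvec (f + g).
Proof. by move=> hf hg; apply: poly2_ext (poly2D hf hg) => z; rewrite fvD. Qed.

Lemma polyvecZ c f : polyvec f -> polyvec (c *: f).
Proof. by move=> hf; apply: poly2_ext (poly2Z c hf) => z; rewrite fvZ. Qed.

(** For [K' = B - Bapprox], [psd_CS] says that [K' w w * K' - K'(., w) K'(., w)'] is positive;
    adding [K' w w * Bapprox] replaces the first [K'] by [B]. So [K'(., w)] is in [H] with squared
    norm at most [K' w w], and convergence at the single point [(w, w)] yields convergence in
    norm. *)
Lemma kvec_approx w e : 0 < e -> exists2 g, polyvec g & hnorm (kvec hH w - g) <= e.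
Proof.
move=> e0; have [N [n hNn]] := Bapprox_lim (alpha - gamma) (beta - gamma) gamma
   w w (exprn_gt0 2 e0).
pose K' z z' := B z z' - Bapprox (alpha - gamma) (beta - gamma) gamma N n z z'.
have hK' : psd K' := schur_psd (BapproxP hgamma halpha hbeta N n).
have a0 : 0 <= alpha - gamma by rewrite subr_ge0 ltW.
have b0 : 0 <= beta - gamma by rewrite subr_ge0 ltW.
have hB : psd (Bapprox (alpha - gamma) (beta - gamma) gamma N n) :=
   schur_psd (schur_Bapprox a0 b0 (ltW hgamma) N n).
have k0 := psd_diag w hK'.
pose r := Num.sqrt (complex.Re (K' w w)).
have rE : (r ^+ 2)%:C%C = K' w w.
  by rewrite sqr_sqrtr ?ge0_Re_ge0// -ge0_Re.
have hr0 : 0 <= r by rewrite sqrtr_ge0.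
have [|h hh hr] := kernel_membership hH (g := fun z => K' z w) hr0.
  have hB' : psd (fun z z' => K' w w * Bapprox (alpha - gamma) (beta - gamma) gamma N n z z').
    by move=> s; rewrite qformZ mulr_ge0.
  apply: psd_ext (psdD (psd_CS w hK') hB') => z z'.
  by rewrite rE addrAC -mulrDr; congr (_ * _ - _); rewrite /K' subrK.
exists (kvec hH w - h).
  apply: poly2_ext (poly2_Bapprox (alpha - gamma) (beta - gamma) gamma N n w) => z.
  by rewrite fvB fv_kvec hh /K' subKr.
rewrite subKr; apply: le_trans hr _.
rewrite -ler_sqr ?nnegrE ?sqrtr_ge0 ?(ltW e0)//.
rewrite -lecR rE (ge0_Re k0) lecR; apply: le_trans (ler_norm _) _.
by apply: le_trans (Re_le_modulus _) _; rewrite /K' BkernelE.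
Qed.

Lemma poly_approx f e : 0 < e -> exists2 g, polyvec g & hnorm (f - g) <= e.
Proof.
move=> e0.
pose clo f := forall e, 0 < e -> exists2 g, polyvec g & hnorm (f - g) <= e.
have clo_comb s : clo (comb hH s).
  elim: s => [|[c x] s IH] d d0.
    exists 0; last by rewrite subr0 /comb big_nil hnorm0 ltW.
    by apply: poly2_ext (poly2_cst 0) => z; rewrite fv0.
  have [|g1 pg1 h1] := IH (d / 2); first by rewrite divr_gt0.
  have c1 : 0 < modulus c + 1 by rewrite ltr_wpDl// modulus_ge0.
  have [|g2 pg2 h2] := @kvec_approx x (d / 2 / (modulus c + 1)); first by rewrite !divr_gt0.
  exists (c^* *: g2 + g1); first exact/polyvecD/pg1/polyvecZ.
  rewrite comb_cons opprD addrACA -scalerBr; apply: le_trans (hnormD _ _) _.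
  rewrite hnormZ modulus_conj; move: h2; rewrite ler_pdivlMr// => h2.
  have := hnorm_ge0 (kvec hH x - g2); move: h1 h2; clear; lra.
have e2 : 0 < e / 2 by rewrite divr_gt0.
have [s hs] := comb_dense hH f e2; have [g pg hg] := clo_comb s _ e2.
exists g => //; rewrite -(subrKA (comb hH s)); apply: le_trans (hnormD _ _) _.
by move: hs hg; lra.
Qed.

Lemma one_vector : exists f : H, forall z, fv f z = 1.
Proof.
have h : psd (fun z w => (1 ^+ 2 : R)%:C%C * B z w - 1 * 1^*).
  apply: psd_ext (schur_psd (schur_B_sub1 hgamma halpha hbeta)) => z w.
  by rewrite expr1n rmorph1 !mul1r conjC1.
by have [f hf _] := kernel_membership hH (g := fun=> 1) ler01 h; exists f.
Qed.

Lemma p1_power_op m : exists T : {linear H -> H}, (forall f z,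
  fv (T f) z = p1 z ^+ m.+1 * fv f z) /\
  forall f, hnorm (T f) <= Num.sqrt (1 + m.+1%:R / (alpha - gamma)) * hnorm f.
Proof.
apply: (multiplier_op (m := fun z => p1 z ^+ m.+1)).
apply: (multiplier_exists hH (sqrtr_ge0 _)).
rewrite sqr_sqrtr; last by rewrite addr_ge0// divr_ge0// subr_ge0 ltW.
apply: psd_ext (schur_psd (schur_p1_power hgamma halpha hbeta m)) => z w.
by rewrite rmorphXn exprMn.
Qed.

Lemma p2_power_op m : exists T : {linear H -> H}, (forall f z,
  fv (T f) z = p2 z ^+ m.+1 * fv f z) /\
  forall f, hnorm (T f) <= Num.sqrt (1 + m.+1%:R / (beta - gamma)) * hnorm f.
Proof.
apply: (multiplier_op (m := fun z => p2 z ^+ m.+1)).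
apply: (multiplier_exists hH (sqrtr_ge0 _)).
rewrite sqr_sqrtr; last by rewrite addr_ge0// divr_ge0// subr_ge0 ltW.
apply: psd_ext (schur_psd (schur_p2_power hgamma halpha hbeta m)) => z w.
by rewrite rmorphXn exprMn.
Qed.

Lemma mul_p1 (f : H) : exists g : H, forall z, fv g z = p1 z * fv f z.
Proof. by have [T [h _]] := p1_power_op 0; exists (T f). Qed.

Lemma mul_p2 (f : H) : exists g : H, forall z, fv g z = p2 z * fv f z.
Proof. by have [T [h _]] := p2_power_op 0; exists (T f). Qed.

Lemma poly_vector (p : {poly {poly C}}) : exists f : H, represents f p.
Proof.
suff [f hf] : exists f : H, forall z, fv f z = p.[p1 z, p2 z].
  by exists f => z hz; exact: hf (exist _ z hz).
have [f1 hf1] := one_vector.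
elim/poly_ind: p => [|p c [f hf]].
  by exists 0 => z; rewrite fv0 !horner0.
have [g hg] : exists g : H, forall z, fv g z = c.[p2 z].
  elim/poly_ind: c => [|c d [g hg]].
    by exists 0 => z; rewrite fv0 horner0.
  have [h hh] := mul_p2 g; exists (h + d *: f1) => z.
  by rewrite fvD fvZ hh hg hf1 !hornerE; ring.
have [h hh] := mul_p1 f; exists (h + g) => z.
by rewrite fvD hh hg hf hornerD hornerM hornerX hornerC hornerD hornerM hornerC; ring.
Qed.

Lemma polyvec_dense : dense [set f : H | exists p, represents f p].
Proof.
move=> O [f Of] oO; have := open_nbhs_nbhs (conj oO Of).
move=> /nbhs_ballP[_ /= /gt0_Re[e e0 ->] he].
have e2 : 0 < e / 2 by rewrite divr_gt0.
have [g pg hg] := poly_approx f e2; exists g; split; last exact/polyvecP.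
apply: he; rewrite -ball_normE/= norm_hnorm ltcR; apply: le_lt_trans hg _.
by rewrite ltr_pdivrMr// ltr_pMr// ltr1n.
Qed.

End Polynomials.

(** * Functional calculus and spectrum *)

Section FunctionalCalculus.
Variables (R : realType) (H : hilbertFunctionSpace R).
Local Notation C := R[i].
Local Notation X := (bpt R).
Variable K : Cplx R * Cplx R -> Cplx R * Cplx R -> C.
Hypothesis hK : reproducing_kernel H K.

Lemma fv_iter (p : X -> C) (T : H -> H) : (forall f z, fv (T f) z = p z * fv f z) ->
  forall n f z, fv (iter n T f) z = p z ^+ n * fv f z.
Proof.
move=> hT; elim=> [|n IH] f z; first by rewrite mul1r.
by rewrite iterS hT IH exprS mulrA.
Qed.

(** One of the two factors [s^n] absorbs the linear growth, since [n s^n <= 1 + s + ... + s^(n-1) <=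
    1 / (1 - s)]. It is applied with [s] the square root of a decay rate. *)
Lemma linear_geometric_bound (s k : R) : 0 <= k -> 0 <= s < 1 -> forall n,
  (s ^+ 2) ^+ n * (1 + k * n%:R) <= (1 + k / (1 - s)) * s ^+ n.
Proof.
move=> k0 /andP[s0 s1] n; have d0 : 0 < 1 - s by rewrite subr_gt0.
have h : n%:R * s ^+ n <= (1 - s)^-1.
  rewrite -[leRHS]mul1r ler_pdivlMr//.
  have e := subrX1 s n.
  have : n%:R * s ^+ n <= \sum_(i < n) s ^+ i.
    rewrite mulr_natl -[n in _ *+ n]card_ord -sumr_const; apply: ler_sum => i _.
    by rewrite ler_wiXn2l ?(ltW s1)// ltnW.
  move=> h; have : n%:R * s ^+ n * (1 - s) <= (\sum_(i < n) s ^+ i) * (1 - s).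
    by rewrite ler_pM2r.
  have := exprn_ge0 n s0; move: e h; move: (\sum_(i < n) _) (s ^+ n) => u v; clear; nra.
have e0 := exprn_ge0 n s0; have e1 : s ^+ n <= 1 by rewrite exprn_ile1// ltW.
rewrite -exprM mulnC exprM expr2.
have : k * (n%:R * s ^+ n) * s ^+ n <= k / (1 - s) * s ^+ n.
  by rewrite ler_wpM2r// ler_wpM2l.
have : s ^+ n * s ^+ n <= s ^+ n by rewrite ler_piMl.
by move: (k / _) (s ^+ n) => u v; clear; lra.
Qed.

(** The decay of [c n] against the growth of [|T^n|] makes the partial sums Cauchy in operator norm.
    Since point evaluations are continuous, the sum is recognised from its values as multiplication
    by [phi (p z)], and its linearity is read off from the same values. *)
Lemma power_series_op (p : X -> C) (T : {linear H -> H}) (k A rho : R) (c : nat -> C)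
    (phi : Cplx R -> Cplx R) :
  (forall z, modulus (p z) < 1) ->
  (forall f z, fv (T f) z = p z * fv f z) -> 0 <= k ->
  (forall n f, hnorm (iter n T f) <= (1 + k * n%:R) * hnorm f) ->
  0 <= rho < 1 -> (forall n, modulus (c n) <= A * rho ^+ n) ->
  (forall x : C, modulus x < 1 -> clim (fun n => \sum_(i < n) c i * x ^+ i) (phi x)) ->
  exists2 S : {linear H -> H}, forall f z, fv (S f) z = phi (p z) * fv f z &
    functional_calculus phi T S.
Proof.
move=> hp hT k0 hpow /andP[rho0 rho1] hc hphi.
have A0 : 0 <= A by have := hc 0%N; rewrite expr0 mulr1; apply: le_trans; exact: modulus_ge0.
pose s := Num.sqrt rho; have s0 : 0 <= s := sqrtr_ge0 _.
have sE : s ^+ 2 = rho by rewrite sqr_sqrtr.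
have s1 : s < 1 by rewrite -sqrtr1 ltr_sqrt.
have d0 : 0 < 1 - s by rewrite subr_gt0.
pose D := A * (1 + k / (1 - s)).
have D0 : 0 <= D by rewrite mulr_ge0// addr_ge0// divr_ge0// ltW.
have term n f : hnorm (c n *: iter n T f) <= D * s ^+ n * hnorm f.
  rewrite hnormZ; apply: le_trans (_ : A * rho ^+ n * ((1 + k * n%:R) * hnorm f) <= _).
    by rewrite ler_pM ?modulus_ge0 ?hnorm_ge0.
  rewrite mulrA ler_wpM2r ?hnorm_ge0// /D -!mulrA ler_wpM2l// -sE.
  by apply: linear_geometric_bound => //; rewrite s0.
pose S n f := \sum_(i < n) c i *: iter i T f.
(* The factor [1 - s ^+ j] records the finite geometric sum and makes the induction on [j] an
   equality of bounds. *)
have tail m j f : hnorm (S (m + j)%N f - S m f) <= D * s ^+ m * (1 - s ^+ j) / (1 - s) * hnorm f.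
  elim: j => [|j IH].
    by rewrite addn0 subrr hnorm0 expr0 subrr mulr0 !mul0r.
  rewrite addnS /S big_ord_recr/= addrAC; apply: le_trans (hnormD _ _) _.
  apply: le_trans (lerD IH (term _ _)) _; rewrite -mulrDl ler_wpM2r ?hnorm_ge0//.
  rewrite exprD exprS le_eqVlt; apply/orP; left; apply/eqP; field.
  by rewrite gt_eqF.
have tail' m n f : (m <= n)%N -> hnorm (S n f - S m f) <= D / (1 - s) * s ^+ m * hnorm f.
  move=> mn; rewrite -(subnKC mn); apply: le_trans (tail _ _ _) _.
  rewrite ler_wpM2r ?hnorm_ge0//.
  have w0 : 0 <= D / (1 - s) * s ^+ m by rewrite mulr_ge0 ?divr_ge0 ?exprn_ge0// ltW.
  have := exprn_ge0 (n - m) s0; move: (s ^+ (n - m)) => v v0.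
  rewrite [leLHS](_ : _ = D / (1 - s) * s ^+ m * (1 - v)); last by ring.
  by rewrite ler_piMr// gerBl.
have /choice[L hL] : forall f, exists g, hlim (fun n => S n f) g.
  move=> f; apply: hlim_complete => e e0.
  have [N hN] := geometric_small (2 * (D / (1 - s) * hnorm f)) s0 s1 e0.
  have hN' := hN _ (leqnn N).
  exists N => m n hm hn; have -> : S m f - S n f = (S m f - S N f) - (S n f - S N f) by rewrite
    opprB addrA subrK.
  apply: le_trans (hnormD _ _) _; rewrite hnormN.
  have := tail' _ _ f hm; have := tail' _ _ f hn; move: hN'.
  by move: (D / _) (s ^+ N) => u v; clear; lra.
have fvS n f z : fv (S n f) z = (\sum_(i < n) c i * p z ^+ i) * fv f z.
  rewrite fv_sum mulr_suml; apply: eq_bigr => i _.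
  by rewrite fvZ (fv_iter hT) mulrA.
have fvL f z : fv (L f) z = phi (p z) * fv f z.
  apply: (clim_unique (hlim_fv hK z (hL f))).
  apply: (@clim_ext _ (fun n => fv f z * (\sum_(i < n) c i * p z ^+ i))).
    by move=> n; rewrite fvS mulrC.
  by rewrite [phi _ * _]mulrC; apply: climZ; exact: hphi.
have Llin : linear L.
  by move=> a f g; apply: fv_inj => z; rewrite fvP !fvL fvP; ring.
pose SL : {linear H -> H} := HB.pack L (GRing.isLinear.Build _ _ _ _ L Llin).
exists SL; first exact: fvL.
have near_bound n f : hnorm (S n f - L f) <= D / (1 - s) * s ^+ n * hnorm f.
  apply/ler_addgt0Pl => e /(hL f)[N hN].
  have := hN _ (leq_maxl N n); have := tail' _ _ f (leq_maxr N n).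
  have := hnormD (S n f - S (maxn N n) f) (S (maxn N n) f - L f).
  by rewrite subrKA [hnorm (S n f - _)]hnormBC; lra.
exists c; split=> [z hz|e /gt0_Re[r r0 ->]].
  by apply/climP; apply: hphi; rewrite -norm_lt1.
have [N hN] := geometric_small (D / (1 - s)) s0 s1 r0.
exists N => // n /= /hN h f.
rewrite !norm_hnorm -rmorphM lecR; apply: le_trans (near_bound n f) _.
by rewrite ler_wpM2r ?hnorm_ge0.
Qed.

Lemma geometric_clim (c x : C) : modulus (x * c) < 1 ->
  clim (fun n => \sum_(i < n) c ^+ i * x ^+ i) ((1 - x * c)^-1).
Proof.
move=> h; have d0 := neq0_1B h.
have d1 : 0 < modulus (1 - x * c) by rewrite modulus_gt0.
move=> e e0; have [N hN] := geometric_small (modulus (1 - x * c))^-1 (modulus_ge0 (x * c)) h e0.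
exists N => n /hN; apply: le_trans.
have -> : \sum_(i < n) c ^+ i * x ^+ i - (1 - x * c)^-1 = - (x * c) ^+ n / (1 - x * c).
  apply: (mulIf d0); rewrite mulrBl mulVf// divfK//.
  have := subrX1 (x * c) n.
  under [\sum_(i < n) (x * c) ^+ i]eq_bigr do rewrite exprMn mulrC.
  by move=> e1; rewrite -[1 - x * c]opprB mulrN mulrC -e1; ring.
by rewrite mulNr modulusN [modulus (_ / _)]modulusM modulusX modulusV mulrC.
Qed.

(** [1 / (x - l) = - sum_n x^n / l^(n+1)] has coefficients decaying at rate [1 / |l| < 1], which
    outweighs the linear growth of the powers of [T]. *)
Lemma resolvent_op (p : X -> C) (T : {linear H -> H}) (k : R) (l : C) :
  (forall z, modulus (p z) < 1) ->
  (forall f z, fv (T f) z = p z * fv f z) -> 0 <= k ->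
  (forall n f, hnorm (iter n T f) <= (1 + k * n%:R) * hnorm f) ->
  1 < modulus l ->
  exists S : {linear H -> H}, forall f z, fv (S f) z = (p z - l)^-1 * fv f z.
Proof.
move=> hp hT k0 hpow l1; have l0 : 0 < modulus l by apply: lt_trans l1.
have ln0 : l != 0 by rewrite -modulus_gt0.
have [|||S hS _] := @power_series_op p T k (modulus l)^-1 (modulus l)^-1
   (fun n => - l^-1 * l^-1 ^+ n) (fun x => (x - l)^-1) hp hT k0 hpow.
- by rewrite invr_ge0 ltW//= invf_lt1.
- by move=> n; rewrite modulusM modulusN modulusX modulusV.
- move=> x hx.
  have h : modulus (x * l^-1) < 1.
    by rewrite modulusM modulusV ltr_pdivrMr// mul1r (lt_trans hx).
  have := climZ (- l^-1) (geometric_clim h).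
  have -> : - l^-1 * (1 - x * l^-1)^-1 = (x - l)^-1.
    have := neq0_1B h => d0; rewrite mulNr -invfM -invrN; congr _^-1.
    by field.
  by apply: clim_ext => n; rewrite mulr_sumr; apply: eq_bigr => i _; rewrite mulrA.
by exists S.
Qed.

(** One invertible component makes the complex exact: [S] is the multiplication operator inverse to
    [T1] and provides a contracting homotopy. *)
Lemma koszul_exact_mult (T1 T2 S : {linear H -> H}) (q1 q2 : X -> C) :
  (forall f z, fv (T1 f) z = q1 z * fv f z) ->
  (forall f z, fv (T2 f) z = q2 z * fv f z) ->
  (forall z, q1 z != 0) -> (forall f z, fv (S f) z = (q1 z)^-1 * fv f z) ->
  koszul_exact T1 T2.
Proof.
move=> h1 h2 q0 hS; split.
- move=> h e _; apply: fv_inj => z; have := congr1 (fun u => fv u z) e; rewrite h1 fv0.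
  by move/eqP; rewrite mulf_eq0 (negbTE (q0 z)) => /eqP.
- move=> x y e; exists (S x); split; apply: fv_inj => z; rewrite ?h1 ?h2 hS.
    by rewrite mulrA divff ?mul1r.
  have := congr1 (fun u => fv u z) e; rewrite fvB fv0 h1 h2 => /eqP; rewrite subr_eq0 => /eqP e1.
  by rewrite mulrCA -e1 mulrA mulVf ?mul1r.
- move=> h; exists 0, (S h); rewrite linear0 subr0; apply: fv_inj => z.
  by rewrite h1 hS mulrA divff ?mul1r.
Qed.

Lemma koszul_exact_mult2 (T1 T2 S : {linear H -> H}) (q1 q2 : X -> C) :
  (forall f z, fv (T1 f) z = q1 z * fv f z) ->
  (forall f z, fv (T2 f) z = q2 z * fv f z) ->
  (forall z, q2 z != 0) -> (forall f z, fv (S f) z = (q2 z)^-1 * fv f z) ->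
  koszul_exact T1 T2.
Proof.
move=> h1 h2 q0 hS; have [e1 e2 e3] := koszul_exact_mult h2 h1 q0 hS; split.
- by move=> h a b; exact: e1.
- move=> x y /eqP; rewrite -oppr_eq0 opprB => /eqP /e2 [h [a b]].
  by exists h.
- move=> h; have [x [y e]] := e3 (- h); exists y, x.
  by rewrite -[RHS]opprK -e opprB.
Qed.

Lemma taylor_spectrum_closed_bidisc (T1 T2 : {linear H -> H}) (k1 k2 : R) :
  (forall f z, fv (T1 f) z = p1 z * fv f z) ->
  (forall f z, fv (T2 f) z = p2 z * fv f z) -> 0 <= k1 -> 0 <= k2 ->
  (forall n f, hnorm (iter n T1 f) <= (1 + k1 * n%:R) * hnorm f) ->
  (forall n f, hnorm (iter n T2 f) <= (1 + k2 * n%:R) * hnorm f) ->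
  taylor_spectrum T1 T2 `<=` closed_bidisc.
Proof.
move=> h1 h2 k10 k20 b1 b2 [l1 l2] /= hl.
have shiftl (T : {linear H -> H}) (l : C) : linear (fun x => T x - l *: x).
  move=> a f g; rewrite linearP scalerBr scalerDr opprD addrACA; congr (_ - _ + _).
  by rewrite !scalerA mulrC.
pose A1 : {linear H -> H} := HB.pack (fun x => T1 x - (l1 : C) *: x) (GRing.isLinear.Build _ _ _
  _ _ (shiftl T1 l1)).
pose A2 : {linear H -> H} := HB.pack (fun x => T2 x - (l2 : C) *: x) (GRing.isLinear.Build _ _ _
  _ _ (shiftl T2 l2)).
have hA1 f z : fv (A1 f) z = (p1 z - l1) * fv f z by rewrite /A1/= fvB fvZ h1 mulrBl.
have hA2 f z : fv (A2 f) z = (p2 z - l2) * fv f z by rewrite /A2/= fvB fvZ h2 mulrBl.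
have nz (x l : C) : modulus x < 1 -> 1 < modulus l -> x - l != 0.
  move=> hx hl'; rewrite subr_eq0; apply/eqP => e; move: hx; rewrite e.
  by rewrite ltNge ltW.
apply: contra_notP hl => hn.
have : 1 < modulus l1 \/ 1 < modulus l2.
  rewrite /closed_bidisc/= in hn; case: (ltP 1 (modulus l1)) => h; [by left|right].
  rewrite ltNge; apply/negP => h'; apply: hn.
  by rewrite !norm_le1.
case=> h.
  have [S hS] := resolvent_op (@p1_lt1 R) h1 k10 b1 h.
  by apply: (koszul_exact_mult hA1 hA2 _ hS) => z; apply: nz => //; exact: p1_lt1.
have [S hS] := resolvent_op (@p2_lt1 R) h2 k20 b2 h.
by apply: (koszul_exact_mult2 hA1 hA2 _ hS) => z; apply: nz => //; exact: p2_lt1.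
Qed.

End FunctionalCalculus.

(** * Moebius covariance of the kernel *)

Section DiscAutomorphism.
Variable R : realType.
Local Notation C := R[i].
Local Notation X := (bpt R).
Variables (u a : C).
Hypotheses (u1 : modulus u = 1) (a1 : modulus a < 1).

Definition mobius (z : C) : C := u * (z - a) / (1 - z * a^*).

Lemma mobius_kernel (z w : C) : modulus z < 1 -> modulus w < 1 ->
  1 - mobius z * (mobius w)^* =
  (1 - modulus a ^+ 2)%:C%C * (1 - z * w^*) / (1 - z * a^*) / (1 - w * a^*)^*.
Proof.
move=> hz hw; have dz := neq0_1B (mulJ_lt1 hz a1); have dw := neq0_1B (mulJ_lt1 hw a1).
have dw' : 1 - w^* * a != 0.
  by apply: contraNneq dw => e; apply/eqP/(inv_inj (@conjCK _));
    rewrite conjC0 conjCB conjCM conjC1 conjCK.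
have cJ : (1 - w * a^*)^* = 1 - w^* * a by rewrite conjCB conjCM conjC1 conjCK.
have muJ : (mobius w)^* = u^* * (w^* - a^*) / (1 - w^* * a).
  by rewrite /mobius !conjCM conjCV conjCB cJ.
have uu : u * u^* = 1 by rewrite mulC_conj u1 expr1n.
have aE : (1 - modulus a ^+ 2)%:C%C = 1 - a * a^* :> C.
  by rewrite mulC_conj rmorphB rmorph1.
rewrite muJ cJ aE /mobius.
have -> : u * (z - a) / (1 - z * a^*) * (u^* * (w^* - a^*) / (1 - w^* * a)) =
  (u * u^*) * ((z - a) / (1 - z * a^*) * ((w^* - a^*) / (1 - w^* * a))) by ring.
by rewrite uu; field; rewrite dz dw'.
Qed.

(** The exponentials of both sides agree by [mobius_kernel]. Four logarithms of numbers in the right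
    half-plane occur, each with imaginary part below [pi / 2] in absolute value, so the sides differ
    by less than [2 pi] and [cexp_inj] applies. *)
Lemma clog_mobius (z w : C) : modulus z < 1 -> modulus w < 1 ->
  modulus (mobius z) < 1 -> modulus (mobius w) < 1 ->
  clog (1 - mobius z * (mobius w)^*) = (ln (1 - modulus a ^+ 2))%:C%C + clog (1 - z * w^*)
    - clog (1 - z * a^*) - (clog (1 - w * a^*))^*.
Proof.
move=> hz hw hmz hmw.
have k0 : 0 < 1 - modulus a ^+ 2 by rewrite subr_gt0 exprn_ilt1 ?modulus_ge0.
have b1 := Im_clog_1B (mulJ_lt1 hmz hmw); have b2 := Im_clog_1B (mulJ_lt1 hz a1).
have b3 := Im_clog_1B (mulJ_lt1 hz hw); have b4 := Im_clog_1B (mulJ_lt1 hw a1).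
have d1 := neq0_1B (mulJ_lt1 hmz hmw); have d2 := neq0_1B (mulJ_lt1 hz a1).
have d3 := neq0_1B (mulJ_lt1 hz hw); have d4 := neq0_1B (mulJ_lt1 hw a1).
have e : clog (1 - mobius z * (mobius w)^*) + clog (1 - z * a^*) =
    (ln (1 - modulus a ^+ 2))%:C%C + clog (1 - z * w^*) - (clog (1 - w * a^*))^*.
  apply: cexp_inj.
    rewrite cexpB !cexpD -cexpJ !clogK// cexp_real lnK// mobius_kernel//.
    have d5 : (1 - w * a^*)^* != 0 by rewrite conjC_eq0.
    by move: ((1 - w * a^*)^*) d5 => q d5; field; rewrite d2 d5.
  rewrite !ImD ImN ImJ; move: b1 b2 b3 b4; rewrite !ltr_norml.
  move: (complex.Im _) (complex.Im _) (complex.Im _) (complex.Im _) => x1 x2 x3 x4.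
  move=> /andP[i1 i2] /andP[i3 i4] /andP[i5 i6] /andP[i7 i8] /=.
  by apply/andP; split; clear -i1 i2 i3 i4 i5 i6 i7 i8; lra.
by rewrite addrAC -e addrK.
Qed.

(** Up to a unimodular constant this is [phi'(z_1)^(- al / 2) phi'(z_2)^(- be / 2)] with
    [phi' = d phi / dz] for the Moebius map [phi]. By [clog_mobius] each logarithm in the exponent
    gains a function of [z_i], a function of [w_j] and a constant. The constant is shared equally
    between [z] and [w], and all gains cancel in the [gamma] combination, so only [alpha - gamma]
    and [beta - gamma] enter. *)
Definition mobius_cocycle (al be : R) (z : X) : C :=
  cexp (al%:C%C * clog (1 - p1 z * a^*) + be%:C%C * clog (1 - p2 z * a^*)
   - ((al + be) / 2 * ln (1 - modulus a ^+ 2))%:C%C).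

Lemma Bkernel_mobius (alpha beta gamma : R) (Phi : X -> X) :
  (forall z, p1 (Phi z) = mobius (p1 z)) -> (forall z, p2 (Phi z) = mobius (p2 z)) ->
  forall z w, ker (Bkernel alpha beta gamma) (Phi z) (Phi w) =
   mobius_cocycle (alpha - gamma) (beta - gamma) z *
   (mobius_cocycle (alpha - gamma) (beta - gamma) w)^* * ker (Bkernel alpha beta gamma) z w.
Proof.
move=> h1 h2 z w; rewrite !BkernelE /mobius_cocycle cexpJ -!cexpD; congr cexp.
have m1 x : modulus (mobius (p1 x)) < 1 by rewrite -h1; exact: p1_lt1.
have m2 x : modulus (mobius (p2 x)) < 1 by rewrite -h2; exact: p2_lt1.
have q1 := @p1_lt1 R; have q2 := @p2_lt1 R.
rewrite /Qlim /Qform !h1 !h2 !clog_mobius//.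
rewrite !conjCB !conjCD !conj_realM conj_realC.
have -> (x y k : R) : ((x + y) / 2 * k)%:C%C = (x%:C%C + y%:C%C) / 2 * k%:C%C :> C.
  by rewrite !rmorphM rmorphD fmorphV rmorph_nat.
by rewrite !rmorphB; field.
Qed.

(** Taylor coefficients at 0, read off from [mobius x = - u a + u (1 - a a') x / (1 - x a')] with
    [a'] the conjugate of [a]. *)
Definition mobius_coef (n : nat) : C :=
  if n is k.+1 then u * (1 - a * a^*) * a^* ^+ k else - (u * a).

(** The rate is the midpoint of [|a|] and 1 rather than [|a|], which would be 0 for [a = 0] although
    the coefficient of degree 1 is then [u]. *)
Lemma mobius_coef_bound n : modulus (mobius_coef n) <= 2 * ((1 + modulus a) / 2) ^+ n.
Proof.
have a0 := modulus_ge0 a.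
have h : modulus a <= (1 + modulus a) / 2 by have := a1; lra.
case: n => [|n] /=.
  by rewrite expr0 modulusN modulusM u1 mul1r mulr1; lra.
rewrite !modulusM modulusX modulus_conj u1 mul1r mulC_conj [in leRHS]exprS mulrA.
have -> : modulus (1 - (modulus a ^+ 2)%:C%C) = 1 - modulus a ^+ 2.
  by rewrite -(rmorph1 (real_complex R)) -rmorphB modulus_ge0r// subr_ge0 exprn_ile1// ltW.
have : modulus a ^+ n <= ((1 + modulus a) / 2) ^+ n.
  by rewrite lerXn2r// nnegrE; lra.
have := exprn_ge0 n a0; have := sqr_ge0 (modulus a).
move: (modulus a ^+ n) (((1 + modulus a) / 2) ^+ n) => s t; nra.
Qed.

Lemma mobius_series (x : C) : modulus x < 1 ->
  clim (fun n => \sum_(i < n) mobius_coef i * x ^+ i) (mobius x).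
Proof.
move=> hx; have h := mulJ_lt1 hx a1; have d := neq0_1B h.
have h1 := climD (clim_cst (- (u * a))) (climZ (u * (1 - a * a^*) * x) (geometric_clim h)).
have -> : mobius x = - (u * a) + u * (1 - a * a^*) * x * (1 - x * a^*)^-1.
  by rewrite /mobius; field.
move=> e /h1[N hN]; exists N.+1 => -[//|n] /hN; apply: le_trans.
rewrite big_ord_recl/= expr0 mulr1 mulr_sumr le_eqVlt; apply/orP; left; apply/eqP.
congr (modulus (_ + _ - _)); apply: eq_bigr => i _.
by rewrite /bump/= add1n exprS; ring.
Qed.

End DiscAutomorphism.

(** * Weighted composition operators *)

Section CompositionOperator.
Variables (R : realType) (H : hilbertFunctionSpace R).
Local Notation C := R[i].
Local Notation X := (bpt R).
Variable K : Cplx R * Cplx R -> Cplx R * Cplx R -> C.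
Hypothesis hK : reproducing_kernel H K.

Lemma psd_comp (Phi : X -> X) (Q : X -> X -> C) : psd Q -> psd (fun z w => Q (Phi z) (Phi w)).
Proof.
move=> h s; have := h [seq (p.1, Phi p.2) | p <- s].
rewrite /qform big_map; under eq_bigr do rewrite big_map; exact.
Qed.

(** Substituting [Phi] in the positive kernel [|f|^2 K(z, w) - f(z) f(w)'] and dividing by
    [j(z) j(w)'] gives exactly the membership criterion for the weighted composition. *)
Lemma composition_exists (Phi : X -> X) (j : X -> C) : (forall z, j z != 0) ->
  (forall z w, ker K (Phi z) (Phi w) = j z * (j w)^* * ker K z w) ->
  forall f : H, exists2 g : H, forall z, fv g z = (j z)^-1 * fv f (Phi z) & hnorm g <= hnorm f.
Proof.
move=> j0 hj f; apply: (kernel_membership hK (hnorm_ge0 f)).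
apply: psd_ext (psd_rank1 (fun z => (j z)^-1) (psd_comp Phi (psd_fv hK f))) => z w.
have d1 := j0 z; have d2 : (j w)^* != 0 by rewrite conjC_eq0.
by rewrite hj conjCM conjCV; field; rewrite d1 d2.
Qed.

(** Polarisation: norms determine the real parts of inner products, and replacing [f] by [i f] gives
    the imaginary parts. *)
Lemma isometry_inner (U : {linear H -> H}) : (forall f, hnorm (U f) = hnorm f) ->
  forall f g, inner H (U f) (U g) = inner H f g.
Proof.
move=> h; have hr f g : complex.Re (inner H (U f) (U g)) = complex.Re (inner H f g).
  have := hnormD_sqr (U f) (U g); rewrite -linearD !h hnormD_sqr; lra.
move=> f g; apply: eqC; first exact: hr.
have := hr ('i%C *: f) g; rewrite linearZ !innerZl !ReM/= !mul0r !mul1r !sub0r.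
by move/oppr_inj.
Qed.

(** [U] and its inverse are both weighted compositions that do not increase norms, by
    [composition_exists], so both are isometric. *)
Lemma composition_unitary (Phi Psi : X -> X) (j : X -> C) :
  cancel Phi Psi -> cancel Psi Phi -> (forall z, j z != 0) ->
  (forall z w, ker K (Phi z) (Phi w) = j z * (j w)^* * ker K z w) ->
  exists U : {linear H -> H}, unitary_op U /\
    forall f z, fv (U f) z = j (Psi z) * fv f (Psi z).
Proof.
move=> c1 c2 j0 hj.
have h1 := composition_exists j0 hj.
have j0' z : (j (Psi z))^-1 != 0 by rewrite invr_eq0.
have hj' z w : ker K (Psi z) (Psi w) = (j (Psi z))^-1 * ((j (Psi w))^-1)^* * ker K z w.
  have := hj (Psi z) (Psi w); rewrite !c2 => ->.
  have d1 := j0 (Psi z); have d2 : (j (Psi w))^* != 0 by rewrite conjC_eq0.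
  by rewrite conjCV; field; rewrite d1 d2.
have h2 := composition_exists j0' hj'.
have /choice[T hT] : forall f : H, exists g : H,
   (forall z, fv g z = j (Psi z) * fv f (Psi z)) /\ hnorm g <= hnorm f.
  by move=> f; have [g hg hn] := h2 f; exists g; split=> // z; rewrite hg invrK.
have lin : linear T.
  by move=> k f g; apply: fv_inj => z; rewrite fvP !(hT _).1 fvP; ring.
pose U : {linear H -> H} := HB.pack T (GRing.isLinear.Build _ _ _ _ T lin).
have inv1 f : exists2 g, U g = f & hnorm g <= hnorm f.
  have [g hg hn] := h1 f; exists g => //; apply: fv_inj => z.
  by rewrite (hT g).1 hg c2 mulrA divff ?mul1r.
have inj f g : U f = U g -> f = g.
  move=> e; apply: fv_inj => z; have := congr1 (fun u => fv u (Phi z)) e.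
  by rewrite /U/= !(hT _).1 !c1 => /(mulfI (j0 z)).
exists U; split; last by move=> f z; exact: (hT f).1.
split=> [f|]; first by have [g hg _] := inv1 f; exists g.
apply: isometry_inner => f; apply/eqP; rewrite eq_le (hT f).2/=.
by have [g /inj -> ] := inv1 (U f).
Qed.

End CompositionOperator.

(** * Schwarz lemma and disc automorphisms *)

Section Bisection.
Variable R : realType.

Lemma nested_intervals (u v : nat -> R) : (forall n, u n <= u n.+1) ->
  (forall n, v n.+1 <= v n) -> (forall n, u n <= v n) -> exists p, forall n, u n <= p <= v n.
Proof.
move=> hu hv huv.
have mu : {homo u : m n / (m <= n)%N >-> m <= n} by exact: homo_leq (@lexx _ _) (@le_trans _ _)
  hu.
have mv : {homo v : m n / (m <= n)%N >-> n <= m}.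
  by apply: (@homo_leq _ v (fun x y => y <= x)) => // x y z h1 h2; exact: le_trans h2 h1.
have uv m n : u m <= v n.
  apply: le_trans (mu _ _ (leq_maxl m n)) _; apply: le_trans (huv _) _.
  exact: mv (leq_maxr m n).
exists (sup (range u)) => n; apply/andP; split.
  apply: ub_le_sup; first by exists (v 0%N) => _ [m _ <-].
  by exists n.
apply: ge_sup; first by exists (u 0%N); exists 0%N.
by move=> _ [m _ <-].
Qed.

(** The common scheme of Goursat's theorem, of the existence of a maximum and, with [b = 0], of the
    vanishing of increments along a segment. [Bad x y t] speaks of the rectangle with lower left
    corner [(x, y)] and sides [t a], [t b]. *)
Lemma bisection (a b x0 y0 : R) (Bad : R -> R -> R -> Prop) : 0 <= a -> 0 <= b ->
  Bad x0 y0 1 ->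
  (forall x y t, 0 < t -> Bad x y t -> exists i j : bool,
      Bad (x + i%:R * (t / 2 * a)) (y + j%:R * (t / 2 * b)) (t / 2)) ->
  exists p q, forall d, 0 < d -> exists x y t,
    [/\ 0 < t <= d, (x0 <= x) && (x + t * a <= x0 + a), (y0 <= y) && (y + t * b <= y0 + b),
        x <= p <= x + t * a & y <= q <= y + t * b] /\ Bad x y t.
Proof.
move=> a0 b0 bad0 hbad.
have /choice[step hstep] : forall s : R * R * R, exists ij : bool * bool,
    0 < s.2 -> Bad s.1.1 s.1.2 s.2 ->
    Bad (s.1.1 + ij.1%:R * (s.2 / 2 * a)) (s.1.2 + ij.2%:R * (s.2 / 2 * b)) (s.2 / 2).
  move=> [[x y] t] /=; case: (pselect (0 < t /\ Bad x y t)) => [[t0 bxy]|hn].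
    by have [i [j hij]] := hbad _ _ _ t0 bxy; exists (i, j).
  by exists (false, false) => t0 bxy; case: hn.
pose next (s : R * R * R) := (s.1.1 + (step s).1%:R * (s.2 / 2 * a),
   s.1.2 + (step s).2%:R * (s.2 / 2 * b), s.2 / 2).
pose st n := iter n next (x0, y0, 1).
have tE n : (st n).2 = 2^-1 ^+ n.
  by elim: n => [|n IH]; rewrite ?expr0// /st iterS /= -/(st n) IH exprSr.
have t0 n : 0 < (st n).2 by rewrite tE exprn_gt0// invr_gt0.
have bn n : Bad (st n).1.1 (st n).1.2 (st n).2.
  by elim: n => [//|n IH]; rewrite /st iterS /=; exact: (hstep _ (t0 n) IH).
have half (i : bool) (t c : R) : 0 < t -> 0 <= c ->
    0 <= i%:R * (t / 2 * c) /\ i%:R * (t / 2 * c) + t / 2 * c <= t * c.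
  move=> t1 c0; have h : 0 <= t / 2 * c by rewrite mulr_ge0// divr_ge0// ltW.
  by case: i; rewrite ?mul1r ?mul0r; split=> //; lra.
have [p hp] : exists p, forall n, (st n).1.1 <= p <= (st n).1.1 + (st n).2 * a.
  apply: nested_intervals => n.
  - by rewrite /st iterS /= lerDl; exact: (half _ _ _ (t0 n) a0).1.
  - by rewrite /st iterS /= -addrA lerD2l; exact: (half _ _ _ (t0 n) a0).2.
  - by rewrite lerDl mulr_ge0// ltW.
have [q hq] : exists q, forall n, (st n).1.2 <= q <= (st n).1.2 + (st n).2 * b.
  apply: nested_intervals => n.
  - by rewrite /st iterS /= lerDl; exact: (half _ _ _ (t0 n) b0).1.
  - by rewrite /st iterS /= -addrA lerD2l; exact: (half _ _ _ (t0 n) b0).2.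
  - by rewrite lerDl mulr_ge0// ltW.
have inx n : x0 <= (st n).1.1 /\ (st n).1.1 + (st n).2 * a <= x0 + a.
  elim: n => [|n [h1 h2]]; first by rewrite /= mul1r.
  have [k1 k2] := half (step (st n)).1 _ _ (t0 n) a0.
  rewrite /st iterS /= -/(st n); split; first by apply: (le_trans h1); rewrite lerDl.
  by apply: le_trans h2; rewrite -addrA lerD2l.
have iny n : y0 <= (st n).1.2 /\ (st n).1.2 + (st n).2 * b <= y0 + b.
  elim: n => [|n [h1 h2]]; first by rewrite /= mul1r.
  have [k1 k2] := half (step (st n)).2 _ _ (t0 n) b0.
  rewrite /st iterS /= -/(st n); split; first by apply: (le_trans h1); rewrite lerDl.
  by apply: le_trans h2; rewrite -addrA lerD2l.
exists p, q => d d0.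
have [||N /(_ _ (leqnn N)) hN] := @geometric_small R 2^-1 1 d _ _ d0.
  by rewrite invr_ge0.
  by rewrite invf_lt1// ltr1n.
exists (st N).1.1, (st N).1.2, (st N).2; split; last exact: bn.
split; rewrite ?hp ?hq//.
- by rewrite t0 tE -[leLHS]mul1r.
- by have [-> ->] := inx N.
- by have [-> ->] := iny N.
Qed.

End Bisection.

(** * Continuity and complex differentiability at a point *)

Section ComplexDifferentiation.
Variable R : realType.
Local Notation C := R[i].
Implicit Types (f g q : C -> C) (z w d : C).

Definition ccont f z := forall e : R, 0 < e -> exists2 r : R, 0 < r &
  forall w, modulus (w - z) <= r -> modulus (f w - f z) <= e.

(* Caratheodory's form of the derivative: [q] is the continuous extension of the difference
   quotient. *)
Definition cdiff f z d := exists q, [/\ ccont q z, q z = d & exists2 r : R, 0 < r &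
  forall w, modulus (w - z) <= r -> f w - f z = q w * (w - z)].

Lemma ccont_cst c z : ccont (fun=> c) z.
Proof. by move=> e e0; exists 1 => // w _; rewrite subrr modulus0 ltW. Qed.

Lemma ccont_id z : ccont id z.
Proof. by move=> e e0; exists e. Qed.

Lemma ccontD f g z : ccont f z -> ccont g z -> ccont (fun w => f w + g w) z.
Proof.
move=> hf hg e e0; have e2 : 0 < e / 2 by rewrite divr_gt0.
have [r1 r10 h1] := hf _ e2; have [r2 r20 h2] := hg _ e2.
exists (Num.min r1 r2); first by rewrite lt_min r10.
move=> w; rewrite le_min => /andP[/h1 k1 /h2 k2].
rewrite opprD addrACA; apply: le_trans (modulusD _ _) _.
by move: k1 k2; clear; lra.
Qed.

Lemma ccont_bounded f z : ccont f z -> exists M r : R, [/\ 0 < M, 0 < r &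
  forall w, modulus (w - z) <= r -> modulus (f w) <= M].
Proof.
move=> /(_ 1 ltr01)[r r0 h]; exists (modulus (f z) + 1), r; split=> //.
  by rewrite ltr_wpDl// modulus_ge0.
by move=> w /h; have := modulusD (f w - f z) (f z); rewrite subrK; lra.
Qed.

Lemma ccontM f g z : ccont f z -> ccont g z -> ccont (fun w => f w * g w) z.
Proof.
move=> hf hg e e0; have [M [r [M0 r0 hM]]] := ccont_bounded hf.
have c1 : 0 < modulus (g z) + 1 by rewrite ltr_wpDl// modulus_ge0.
have [|r1 r10 h1] := hf (e / 2 / (modulus (g z) + 1)); first by rewrite !divr_gt0.
have [|r2 r20 h2] := hg (e / 2 / M); first by rewrite !divr_gt0.
exists (Num.min r (Num.min r1 r2)); first by rewrite !lt_min r0 r10.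
move=> w; rewrite !le_min => /and3P[/hM k /h1 k1 /h2 k2].
have -> : f w * g w - f z * g z = f w * (g w - g z) + (f w - f z) * g z by ring.
apply: le_trans (modulusD _ _) _; rewrite !modulusM.
move: k1 k2; rewrite !ler_pdivlMr// => k1 k2.
have k3 : modulus (f w) * modulus (g w - g z) <= modulus (g w - g z) * M.
  by rewrite mulrC ler_wpM2l// modulus_ge0.
have := modulus_ge0 (f w - f z); move: k1 k2 k3; clear; nra.
Qed.

Lemma ccont_comp f g z : ccont f z -> ccont g (f z) -> ccont (fun w => g (f w)) z.
Proof.
move=> hf hg e /hg[r1 r10 h1]; have [r r0 h] := hf _ r10.
by exists r => // w /h /h1.
Qed.

Lemma ccont_inv z : z != 0 -> ccont (fun w => w^-1) z.
Proof.
move=> z0 e e0; have m0 : 0 < modulus z by rewrite modulus_gt0.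
exists (Num.min (modulus z / 2) (e * modulus z ^+ 2 / 2)).
  by rewrite lt_min !divr_gt0// mulr_gt0// exprn_gt0.
move=> w; rewrite le_min => /andP[k1 k2].
have wm : modulus z / 2 <= modulus w.
  by have := modulusD (z - w) w; rewrite subrK modulusBC; move: k1; clear; lra.
have w1 : 0 < modulus w by apply: lt_le_trans wm; rewrite divr_gt0.
have w0 : w != 0 by rewrite -modulus_gt0.
have -> : w^-1 - z^-1 = (z - w) / (w * z) by field; rewrite w0 z0.
rewrite modulusM modulusV modulusM modulusBC ler_pdivrMr ?mulr_gt0//.
apply: le_trans k2 _; have : modulus z ^+ 2 / 2 <= modulus w * modulus z.
  by rewrite expr2 mulrAC ler_pM2r.
by rewrite -mulrA; rewrite ler_pM2l.
Qed.

Lemma ccont_ext f g z : (exists2 r : R, 0 < r & forall w, modulus (w - z) <= r -> f w = g w) ->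
  ccont f z -> ccont g z.
Proof.
move=> [r r0 h] hf e /hf[r1 r10 h1]; exists (Num.min r r1); first by rewrite lt_min r0.
have hz : f z = g z by apply: h; rewrite subrr modulus0 ltW.
by move=> w; rewrite le_min => /andP[k1 /h1]; rewrite (h _ k1) hz.
Qed.

Lemma cdiff_ccont f z d : cdiff f z d -> ccont f z.
Proof.
move=> [q [hq _ [r r0 h]]].
apply: (@ccont_ext (fun w => q w * (w - z) + f z)).
  by exists r => // w /h <-; rewrite subrK.
apply: ccontD; last exact: ccont_cst.
by apply: ccontM => //; apply: ccontD; [exact: ccont_id | exact: ccont_cst].
Qed.

Lemma cdiff_cst c z : cdiff (fun=> c) z 0.
Proof.
exists (fun=> 0); split=> //; first exact: ccont_cst.
by exists 1 => // w _; rewrite subrr mul0r.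
Qed.

Lemma cdiff_id z : cdiff id z 1.
Proof.
exists (fun=> 1); split=> //; first exact: ccont_cst.
by exists 1 => // w _; rewrite mul1r.
Qed.

Lemma cdiffD f g z d1 d2 : cdiff f z d1 -> cdiff g z d2 ->
  cdiff (fun w => f w + g w) z (d1 + d2).
Proof.
move=> [q1 [c1 <- [r1 r10 h1]]] [q2 [c2 <- [r2 r20 h2]]].
exists (fun w => q1 w + q2 w); split=> //; first exact: ccontD.
exists (Num.min r1 r2); first by rewrite lt_min r10.
move=> w; rewrite le_min => /andP[/h1 k1 /h2 k2].
by rewrite mulrDl -k1 -k2; ring.
Qed.

Lemma cdiffM f g z d1 d2 : cdiff f z d1 -> cdiff g z d2 ->
  cdiff (fun w => f w * g w) z (f z * d2 + d1 * g z).
Proof.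
move=> hf; have cf := cdiff_ccont hf; move: hf.
move=> [q1 [c1 <- [r1 r10 h1]]] [q2 [c2 <- [r2 r20 h2]]].
exists (fun w => f w * q2 w + q1 w * g z); split=> //.
  by apply: ccontD; [exact: ccontM | apply: ccontM => //; exact: ccont_cst].
exists (Num.min r1 r2); first by rewrite lt_min r10.
move=> w; rewrite le_min => /andP[/h1 k1 /h2 k2].
rewrite mulrDl -mulrA -k2 mulrAC -k1; ring.
Qed.

Lemma cdiff_comp f g z d1 d2 : cdiff f z d1 -> cdiff g (f z) d2 ->
  cdiff (fun w => g (f w)) z (d2 * d1).
Proof.
move=> hf; have cf := cdiff_ccont hf; move: hf.
move=> [q1 [c1 <- [r1 r10 h1]]] [q2 [c2 <- [r2 r20 h2]]].
have [r3 r30 h3] := cf _ r20.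
exists (fun w => q2 (f w) * q1 w); split=> //.
  by apply: ccontM => //; exact: ccont_comp.
exists (Num.min r1 r3); first by rewrite lt_min r10.
move=> w; rewrite le_min => /andP[/h1 k1 /h3 /h2 ->].
by rewrite -mulrA -k1.
Qed.

Lemma cdiff_inv z : z != 0 -> cdiff (fun w => w^-1) z (- z^-2).
Proof.
move=> z0; exists (fun w => - z^-1 * w^-1); split.
- by apply: ccontM; [exact: ccont_cst | exact: ccont_inv].
- by rewrite mulNr -invfM expr2.
have m0 : 0 < modulus z by rewrite modulus_gt0.
exists (modulus z / 2); first by rewrite divr_gt0.
move=> w k1; have w0 : w != 0.
  rewrite -modulus_gt0.
  by have := modulusD (z - w) w; rewrite subrK modulusBC; move: k1 m0; clear; lra.
by field; rewrite w0 z0.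
Qed.

Lemma cdiffV f z d : f z != 0 -> cdiff f z d -> cdiff (fun w => (f w)^-1) z (- (f z)^-2 * d).
Proof. by move=> z0 hf; apply: (cdiff_comp hf); exact: cdiff_inv. Qed.

Lemma cdiff_cexp z : cdiff (@cexp R) z (cexp z).
Proof.
exists (fun w => if w == z then cexp z else (cexp w - cexp z) / (w - z)); split.
- move=> e e0; rewrite eqxx; pose k := 4 * expR 1 * modulus (cexp z) + 1.
  have k0 : 0 < k by rewrite ltr_wpDl// !mulr_ge0 ?modulus_ge0 ?expR_ge0.
  exists (Num.min 1 (e / k)); first by rewrite lt_min ltr01 divr_gt0.
  move=> w; rewrite le_min => /andP[w1]; rewrite ler_pdivlMr// => we.
  case: eqVneq => [_|wz]; first by rewrite subrr modulus0 ltW.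
  have n0 : w - z != 0 by rewrite subr_eq0.
  have m0 : 0 < modulus (w - z) by rewrite modulus_gt0.
  have -> : (cexp w - cexp z) / (w - z) - cexp z = cexp z * (cexp (w - z) - 1 - (w - z)) / (w -
    z).
    by rewrite (_ : cexp w = cexp (w - z) * cexp z); [field | rewrite -cexpD subrK].
  rewrite modulusM modulusV ler_pdivrMr// modulusM.
  have := cexp_sub1z (w - z).
  have : expR (modulus (w - z)) <= expR 1 by rewrite ler_expR.
  have := modulus_ge0 (cexp z); have := expR_ge0 (modulus (w - z)).
  have := modulus_ge0 (cexp (w - z) - 1 - (w - z)).
  move: we; rewrite /k; move: (modulus (cexp z)) (expR (modulus _)) (modulus (cexp _ - _ - _))
    (expR 1) m0.
  move: (modulus (w - z)) => m A B D E m0 h1 h2 h3 h4 h5 h6.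
  have h7 : D <= 4 * m ^+ 2 * E.
    apply: le_trans h6 _; rewrite -mulrA ler_wpM2l// ler_wpM2l// sqr_ge0//.
  have h8 : A * D <= A * (4 * m ^+ 2 * E) by rewrite ler_wpM2l.
  apply: le_trans h8 _; rewrite [leLHS](_ : _ = m * (4 * E * A) * m); last by ring.
  by rewrite ler_wpM2r ?(ltW m0)//; move: h1 m0; clear; lra.
- by rewrite eqxx.
exists 1 => // w _; case: eqVneq => [->|wz]; first by rewrite !subrr mulr0.
by rewrite divfK// subr_eq0.
Qed.

Lemma cdiff_lin f z d (e : R) : cdiff f z d -> 0 < e -> exists2 r : R, 0 < r &
  forall w, modulus (w - z) <= r -> modulus (f w - f z - d * (w - z)) <= e * modulus (w - z).
Proof.
move=> [q [hq <- [r r0 h]]] e0; have [r1 r10 h1] := hq _ e0.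
exists (Num.min r r1); first by rewrite lt_min r0.
move=> w; rewrite le_min => /andP[/h -> /h1 k].
by rewrite -mulrBl modulusM ler_wpM2r// modulus_ge0.
Qed.

(** The Frechet differential is linear over the complex numbers, hence multiplication by its value
    at 1. *)
Lemma differentiable_cdiff (f : Cplx R -> Cplx R) (z : Cplx R) : differentiable f z ->
  exists d, cdiff f z d.
Proof.
move=> /diff_locally df; pose d : C := 'd f z (1 : Cplx R); exists d.
have lin (h : C) : 'd f z (h : Cplx R) = d * h :> C.
  by rewrite -[h in LHS]mulr1 -[h * 1]/(h *: (1 : Cplx R)) linearZ /= mulrC.
have key (e : R) : 0 < e -> exists2 r : R, 0 < r & forall w, modulus (w - z) <= r ->
    modulus (f w - f z - d * (w - z)) <= e * modulus (w - z).
  move=> e0; move/eqaddoP : df => /(_ e%:C%C); rewrite ltcR => /(_ e0).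
  move=> /nbhs_ballP[_ /= /gt0_Re[r r0 ->] hr].
  exists (r / 2); first by rewrite divr_gt0.
  move=> w hw; have hb : ball (0 : Cplx R) r%:C%C (w - z : Cplx R).
    rewrite -ball_normE /= sub0r normrN.
    suff : (modulus (w - z))%:C%C < r%:C%C :> C by [].
    by rewrite ltcR; apply: (le_lt_trans hw); move: r0; clear; lra.
  have := hr _ hb; rewrite !fctE /= subrK lin opprD addrA => h.
  by rewrite -lecR rmorphM.
exists (fun w => if w == z then d else (f w - f z) / (w - z)); split.
- move=> e e0; have [r r0 h] := key e e0; exists r => // w /h; rewrite eqxx.
  case: eqVneq => [->|wz]; first by move=> _; rewrite subrr modulus0 ltW.
  have n0 : w - z != 0 by rewrite subr_eq0.
  have m0 : 0 < modulus (w - z) by rewrite modulus_gt0.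
  rewrite -ler_pdivrMr// -modulusV -modulusM mulrBl mulfK//.
- by rewrite eqxx.
exists 1 => // w _; case: eqVneq => [->|wz]; first by rewrite !subrr mulr0.
by rewrite divfK// subr_eq0.
Qed.

End ComplexDifferentiation.

(** * Goursat's theorem for Riemann sums *)

Section DiscreteGoursat.
Variable R : realType.
Local Notation C := R[i].
Implicit Types (h f : C -> C) (z v w p d : C) (N : nat).

Definition mid N (k : nat) : C := (k%:R + 2^-1) / N%:R.

(** Midpoint Riemann sum with [N] nodes for the integral of [h] along the segment from [z] to
    [z + v]. *)
Definition seg h N z v : C := v / N%:R * \sum_(k < N) h (z + mid N k * v).

(** The corresponding sum along the oriented boundary of the parallelogram with corner [z] and sides
    [v], [w]. *)
Definition contour h N z v w : C := seg h N z v + seg h N (z + v) w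
  - seg h N (z + w) v - seg h N z w.

Lemma natC_neq0 n : (n.+1%:R : C) != 0. Proof. by rewrite pnatr_eq0. Qed.

Lemma seg_split h N z v : seg h (N + N) z v =
  seg h N z (v / 2) + seg h N (z + v / 2) (v / 2).
Proof.
case: N => [|N]; first by rewrite /seg invr0 !mulr0 !mul0r addr0.
have m0 : (N.+1%:R : C) != 0 := natC_neq0 N.
have mm : (N.+1%:R : C) + N.+1%:R != 0 by rewrite -mulr2n mulrn_eq0.
rewrite /seg natrD big_split_ord /= mulrDr; congr (_ + _).
- congr (_ * _); first by move: (N.+1%:R : C) m0 mm => m m0 mm; field; rewrite m0 mm.
  apply: eq_bigr => k _; congr (h (_ + _)).
  by rewrite /mid natrD; move: (N.+1%:R : C) m0 mm => m m0 mm; field; rewrite m0 mm.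
- congr (_ * _); first by move: (N.+1%:R : C) m0 mm => m m0 mm; field; rewrite m0 mm.
  apply: eq_bigr => k _; congr (h _).
  by rewrite /mid !natrD; move: (N.+1%:R : C) m0 mm => m m0 mm; field; rewrite m0 mm.
Qed.

Lemma contour_split h N z v w : contour h (N + N) z v w =
  contour h N z (v / 2) (w / 2) + contour h N (z + v / 2) (v / 2) (w / 2)
  + contour h N (z + w / 2) (v / 2) (w / 2) + contour h N (z + v / 2 + w / 2) (v / 2) (w / 2).
Proof.
rewrite /contour !seg_split.
have -> : z + v + w / 2 = z + v / 2 + w / 2 + v / 2 by field.
have -> : z + w + v / 2 = z + v / 2 + w / 2 + w / 2 by field.
have -> : z + v / 2 + v / 2 = z + v by field.
have -> : z + w / 2 + w / 2 = z + w by field.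
have -> : z + w / 2 + v / 2 = z + v / 2 + w / 2 by ring.
ring.
Qed.

Lemma seg_bound h N z v (M : R) : 0 <= M ->
  (forall k, (k < N)%N -> modulus (h (z + mid N k * v)) <= M) ->
  modulus (seg h N z v) <= modulus v * M.
Proof.
move=> M0 hM; rewrite /seg modulusM modulusM modulusV modulus_nat -mulrA.
rewrite ler_wpM2l ?modulus_ge0//.
case: N hM => [|N] hM; first by rewrite big_ord0 modulus0 mulr0.
rewrite mulrC ler_pdivrMr ?ltr0Sn//; apply: le_trans (modulus_sum _ _ _) _.
rewrite mulr_natr -[X in _ *+ X]card_ord -sumr_const; apply: ler_sum => k _.
exact: hM.
Qed.

Lemma segB h f N z v : seg (fun x => h x - f x) N z v = seg h N z v - seg f N z v.
Proof. by rewrite /seg -mulrBr sumrB. Qed.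

Lemma sum_mid N : \sum_(k < N.+1) mid N.+1 k = N.+1%:R / 2.
Proof.
have sE n : \sum_(k < n) (k%:R + 2^-1) = n%:R ^+ 2 / 2 :> C.
  elim: n => [|n IH]; first by rewrite big_ord0 expr0n mul0r.
  by rewrite big_ord_recr/= IH -natr1; field.
rewrite /mid -mulr_suml sE; move: (N.+1%:R : C) (natC_neq0 N) => m m0.
by field.
Qed.

Lemma seg_affine N z v (c d p : C) :
  seg (fun x => c + d * (x - p)) N.+1 z v = v * (c + d * (z + v / 2 - p)).
Proof.
have n0 := natC_neq0 N.
rewrite /seg (eq_bigr (fun k : 'I_N.+1 => (c + d * (z - p)) + d * v * mid N.+1 k)); last first.
  by move=> k _; ring.
rewrite big_split/= sumr_const card_ord -mulr_sumr sum_mid -mulr_natr.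
by field.
Qed.

Lemma contour_affine N z v w (c d p : C) :
  contour (fun x => c + d * (x - p)) N.+1 z v w = 0.
Proof. by rewrite /contour !seg_affine; field. Qed.

(* Goursat's bisection argument, run on midpoint sums rather than on integrals: they are exact on
   affine functions and add up exactly under subdivision. *)
Lemma discrete_goursat h (x0 y0 a b e : R) : 0 < a -> 0 < b -> 0 < e ->
  (forall x y, x0 <= x <= x0 + a -> y0 <= y <= y0 + b -> exists d, cdiff h (Complex x y) d) ->
  exists m0, forall m, (m0 <= m)%N ->
    modulus (contour h (2 ^ m) (Complex x0 y0) (Complex a 0) (Complex 0 b)) <= e.
Proof.
move=> a0 b0 e0 hd; apply: contrapT => hbad.
(* The tolerance scales like the area, so four good quarters make a good rectangle. *)
pose Bad x y t := ~ exists m0, forall m, (m0 <= m)%N ->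
    modulus (contour h (2 ^ m) (Complex x y) (Complex (t * a) 0) (Complex 0 (t * b))) <= e * t
      ^+ 2.
have bad0 : Bad x0 y0 1 by rewrite /Bad !mul1r expr1n mulr1.
have half (t c : R) : (Complex (t * c) 0 : C) / 2 = Complex (t / 2 * c) 0.
  have -> : (2 : C)^-1 = (2^-1 : R)%:C%C by rewrite fmorphV rmorph_nat.
  by apply: eqC; rewrite ?ReM ?ImM/=; ring.
have halfi (t c : R) : (Complex 0 (t * c) : C) / 2 = Complex 0 (t / 2 * c).
  have -> : (2 : C)^-1 = (2^-1 : R)%:C%C by rewrite fmorphV rmorph_nat.
  by apply: eqC; rewrite ?ReM ?ImM/=; ring.
have [|p [q hpq]] := bisection (ltW a0) (ltW b0) bad0.
  move=> x y t t0 bad; apply: contrapT => hn; apply: bad.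
  have good (i j : bool) : exists m0, forall m, (m0 <= m)%N ->
      modulus (contour h (2 ^ m) (Complex (x + i%:R * (t / 2 * a)) (y + j%:R * (t / 2 * b)))
        (Complex (t / 2 * a) 0) (Complex 0 (t / 2 * b))) <= e * (t / 2) ^+ 2.
    by apply: contrapT => hh; apply: hn; exists i, j.
  have [n1 h1] := good false false; have [n2 h2] := good true false.
  have [n3 h3] := good false true; have [n4 h4] := good true true.
  (* A subdivision uses up one refinement: [2 ^ m.+1] nodes on a side are [2 ^ m] nodes on each
     half, hence the successor. *)
  exists (maxn (maxn n1 n2) (maxn n3 n4)).+1 => -[//|m].
  rewrite ltnS !geq_max => /andP[/andP[/h1 k1 /h2 k2] /andP[/h3 k3 /h4 k4]].
  rewrite expnS mul2n -addnn contour_split half halfi.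
  have z1 : Complex x y = Complex (x + 0 * (t / 2 * a)) (y + 0 * (t / 2 * b)).
    by rewrite !mul0r !addr0.
  have z2 : (Complex x y : C) + Complex (t / 2 * a) 0 = Complex (x + 1 * (t / 2 * a)) (y + 0 *
    (t / 2 * b)).
    by rewrite mul0r mul1r.
  have z3 : (Complex x y : C) + Complex 0 (t / 2 * b) = Complex (x + 0 * (t / 2 * a)) (y + 1 *
    (t / 2 * b)).
    by rewrite mul0r mul1r.
  have z4 : (Complex x y : C) + Complex (t / 2 * a) 0 + Complex 0 (t / 2 * b) =
      Complex (x + 1 * (t / 2 * a)) (y + 1 * (t / 2 * b)).
    by apply: eqC; rewrite !ReD || rewrite !ImD; rewrite /= !mul1r ?addr0 ?add0r.
  rewrite z4 z2 z3 z1.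
  have -> : e * t ^+ 2 = e * (t / 2) ^+ 2 + e * (t / 2) ^+ 2 + e * (t / 2) ^+ 2 + e * (t / 2) ^+
    2.
    by field.
  do 3 (apply: le_trans (modulusD _ _) _; apply: lerD => //).
have hin : x0 <= p <= x0 + a /\ y0 <= q <= y0 + b.
  have [x [y [t [[_ /andP[A1 A2] /andP[A3 A4] /andP[A5 A6] /andP[A7 A8]] _]]]] := hpq 1 ltr01.
  by split; apply/andP; split; lra.
have [d hdp] := hd p q hin.1 hin.2.
pose ab := a + b; have ab0 : 0 < ab by rewrite addr_gt0.
(* The perimeter is [2 t ab] and the error on it at most [e1 t ab]; their product is to be
   [e t^2]. *)
pose e1 := e / (2 * ab ^+ 2).
have e10 : 0 < e1 by rewrite divr_gt0// mulr_gt0// exprn_gt0.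
have [r r0 hr] := cdiff_lin hdp e10.
have [|x [y [t [[/andP[t0 t1] _ _ A B] bad]]]] := hpq (r / ab); first by rewrite divr_gt0.
apply: bad; exists 0%N => m _.
have : exists N, (2 ^ m)%N = N.+1 by exists (2 ^ m).-1; rewrite prednK// expn_gt0.
move=> [N ->].
set z := Complex x y; set v := Complex (t * a) 0; set w := Complex 0 (t * b).
pose P := Complex p q; pose f u := h P + d * (u - P).
(* Subtract the first-order approximation at the limit point, on which the contour sum vanishes;
   what is left is small relative to the size of the rectangle. *)
have -> : contour h N.+1 z v w = contour (fun u => h u - f u) N.+1 z v w.
  by rewrite -[LHS]subr0 -(contour_affine N z v w (h P) d P) /contour !segB -/f; ring.
have mk k : (k < N.+1)%N -> exists2 s : R, mid N.+1 k = s%:C%C & 0 <= s <= 1.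
  move=> kN; exists ((k%:R + 2^-1) / N.+1%:R).
    by rewrite /mid rmorphM fmorphV rmorphD fmorphV !rmorph_nat.
  rewrite divr_ge0 ?addr_ge0//= ler_pdivrMr ?ltr0Sn// mul1r.
  have : (k.+1%:R : R) <= N.+1%:R by rewrite ler_nat.
  by rewrite -natr1; move: (N.+1%:R : R) => ?; lra.
have ta : 0 <= t * a by rewrite mulr_ge0// ltW.
have tb : 0 <= t * b by rewrite mulr_ge0// ltW.
have close (x' y' : R) : x <= x' <= x + t * a -> y <= y' <= y + t * b ->
    modulus (h (Complex x' y') - f (Complex x' y')) <= e1 * (t * ab).
  move=> /andP[B1 B2] /andP[B3 B4]; move: A B => /andP[A1 A2] /andP[A3 A4].
  have hm : modulus (Complex x' y' - P) <= t * ab.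
    apply: le_trans (modulus_le_ReIm _) _; rewrite /ab mulrDr lerD//= ler_norml.
      by apply/andP; split; lra.
    by apply/andP; split; lra.
  have := hr (Complex x' y'); rewrite /f opprD addrA => /(_ _) h1.
  apply: le_trans (h1 _) _; last by rewrite ler_wpM2l// ltW.
  by apply: le_trans hm _; rewrite -ler_pdivlMr.
have M0 : 0 <= e1 * (t * ab) by apply: mulr_ge0; [exact: ltW | apply: mulr_ge0; exact: ltW].
have sv z' : (exists y', y <= y' <= y + t * b /\ z' = Complex x y') ->
    modulus (seg (fun u => h u - f u) N.+1 z' v) <= t * a * (e1 * (t * ab)).
  move=> [y' [hy' ->]]; apply: le_trans (seg_bound M0 _) _; last first.
    by rewrite (modulus_ge0r ta).
  move=> k /mk [s -> /andP[s0 s1]].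
  have -> : Complex x y' + s%:C%C * v = Complex (x + s * (t * a)) y'.
    by apply: eqC; rewrite ?ReD ?ImD ?ReM ?ImM/=; ring.
  apply: close => //; rewrite lerDl mulr_ge0//= lerD2l.
  by rewrite ler_piMl.
have sw z' : (exists x', x <= x' <= x + t * a /\ z' = Complex x' y) ->
    modulus (seg (fun u => h u - f u) N.+1 z' w) <= t * b * (e1 * (t * ab)).
  move=> [x' [hx' ->]]; apply: le_trans (seg_bound M0 _) _; last first.
    have -> : w = 'i%C * (t * b)%:C%C by apply: eqC; rewrite ?ReM ?ImM/=; ring.
    by rewrite modulus_mulCi (modulus_ge0r tb).
  move=> k /mk [s -> /andP[s0 s1]].
  have -> : Complex x' y + s%:C%C * w = Complex x' (y + s * (t * b)).
    by apply: eqC; rewrite ?ReD ?ImD ?ReM ?ImM/=; ring.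
  apply: close => //; rewrite lerDl mulr_ge0//= lerD2l.
  by rewrite ler_piMl.
have s1 := sv z; have s2 := sw (z + v); have s3 := sv (z + w); have s4 := sw z.
have -> : e * t ^+ 2 = t * a * (e1 * (t * ab)) + t * b * (e1 * (t * ab)) +
   t * a * (e1 * (t * ab)) + t * b * (e1 * (t * ab)).
  by rewrite /e1 /ab; field; rewrite gt_eqF.
rewrite /contour; apply: le_trans (modulusB _ _) _; apply: lerD; last first.
  by apply: s4; exists x; split=> //; rewrite lexx lerDl.
apply: le_trans (modulusB _ _) _; apply: lerD; last first.
  apply: s3; exists (y + t * b); split; first by rewrite lexx lerDl tb.
  by apply: eqC; rewrite ?ReD ?ImD/= ?addr0.
apply: le_trans (modulusD _ _) _; apply: lerD.
  by apply: s1; exists y; split=> //; rewrite lexx lerDl.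
apply: s2; exists (x + t * a); split; first by rewrite lexx lerDl ta.
by apply: eqC; rewrite ?ReD ?ImD/= ?addr0.
Qed.

End DiscreteGoursat.

(** * The Schwarz lemma and the Schwarz-Pick inequality *)

Section Schwarz.
Variable R : realType.
Local Notation C := R[i].
Implicit Types (f g phi : C -> C) (z w a d : C).

Definition self_map f := (forall z, modulus z < 1 -> exists d, cdiff f z d) /\
  (forall z, modulus z < 1 -> modulus (f z) < 1).

Lemma cexp_2pi : cexp (Complex 0 (2 * pi) : C) = 1.
Proof.
by apply: eqC; rewrite /= expR0 mul1r mulr_natl ?cos2pi ?sin2pi.
Qed.

(* The midpoint sums of [f e^z / e^z] over a period do not depend on [Re z] (up to an error going to
   0): letting [Re z] go to [-oo] this is the mean value property of [f z / z] at [0]. *)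
Lemma schwarz_derivative f d : self_map f -> f 0 = 0 -> cdiff f 0 d -> modulus d <= 1.
Proof.
move=> [hf fD] f0 hd; rewrite leNgt; apply/negP => d1.
(* The final estimate is [|d| <= expR (- s1) + 2 eta], where [expR (- s1)] is the midpoint of 1 and
   [|d|]; its right-hand side falls short of [|d|] by [(|d| - 1) / 6]. *)
pose eta := (modulus d - 1) / 6; have eta0 : 0 < eta by rewrite divr_gt0// subr_gt0.
have pi0 := @pi_gt0 R.
pose s1 := - ln ((1 + modulus d) / 2) : R.
have m1 : 1 < (1 + modulus d) / 2 by lra.
have s10 : s1 < 0 by rewrite oppr_lt0 ln_gt0.
have es1 : expR (- s1) = (1 + modulus d) / 2 by rewrite opprK lnK// posrE; lra.
have [q [hq q0 [r0 r00 hr0]]] := hd; have [r1 r10 hr1] := hq _ eta0.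
pose rr := Num.min r0 r1; have rr0 : 0 < rr by rewrite lt_min r00.
(* On the line [Re z = s0] the point [cexp z] lies within [rr] of 0, where [f w / w] is within [eta]
   of [d]. *)
pose s0 := Num.min (s1 - 1) (ln rr).
have s01 : 0 < s1 - s0.
  have : s0 <= s1 - 1 by rewrite ge_min lexx.
  by lra.
have es0 : expR s0 <= rr by rewrite -[leRHS]lnK ?posrE// ler_expR ge_min lexx orbT.
pose h z := f (cexp z) * (cexp z)^-1.
have cin z : complex.Re z <= s1 -> modulus (cexp z) < 1.
  by move=> hz; rewrite modulus_cexp expR_lt1 (le_lt_trans hz).
have [|||m0 hm0] := @discrete_goursat R h s0 0 (s1 - s0) (2 * pi) (2 * pi * eta) s01.
- by rewrite mulr_gt0.
- by rewrite mulr_gt0// mulr_gt0.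
- move=> x y /andP[_ hx] _; have [|d' hd'] := hf (cexp (Complex x y)).
    by apply: cin => /=; move: hx; rewrite addrC subrK.
  eexists; apply: cdiffM; first exact: cdiff_comp (cdiff_cexp _) hd'.
  exact: cdiffV (cexp_neq0 _) (cdiff_cexp _).
have := hm0 _ (leqnn m0).
have : exists N, (2 ^ m0)%N = N.+1 by exists (2 ^ m0).-1; rewrite prednK// expn_gt0.
move=> [N ->].
set z0 := Complex s0 0; set v := Complex (s1 - s0) 0; set w := Complex 0 (2 * pi).
have hper x : h (x + w) = h x by rewrite /h cexpD cexp_2pi mulr1.
(* [h] has period [2 pi i], so the two horizontal sides cancel and only the two vertical sums are
   compared. *)
have segper : seg h N.+1 (z0 + w) v = seg h N.+1 z0 v.
  by rewrite /seg; congr (_ * _); apply: eq_bigr => k _; rewrite addrAC hper.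
have mk (k : nat) : mid R N.+1 k = ((k%:R + 2^-1) / N.+1%:R)%:C%C.
  by rewrite /mid rmorphM fmorphV rmorphD fmorphV !rmorph_nat.
have mw : modulus w = 2 * pi.
  have -> : w = 'i%C * (2 * pi)%:C%C by apply: eqC; rewrite ?ReM ?ImM/=; ring.
  by rewrite modulus_mulCi modulus_ge0r// mulr_ge0// ltW.
have rw (t : R) (x : C) : complex.Re (x + t%:C%C * w) = complex.Re x.
  by rewrite ReD ReM/=; ring.
have b1 : modulus (seg h N.+1 (z0 + v) w) <= 2 * pi * expR (- s1).
  rewrite -mw; apply: seg_bound; first exact: expR_ge0.
  move=> k _; rewrite mk /h modulusM modulusV.
  set x := _ + _; have rx : complex.Re x = s1.
    transitivity (complex.Re (z0 + v)); first exact: rw.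
    by rewrite ReD/=; ring.
  have c1 := cin x; rewrite rx lexx in c1.
  rewrite (modulus_cexp x) rx -expRN ler_piMl ?expR_ge0// ltW// fD//; exact: c1.
have b0 : modulus (seg h N.+1 z0 w - w * d) <= 2 * pi * eta.
  have e2 : seg (fun x => d + 0 * (x - 0)) N.+1 z0 w = w * d.
    by rewrite seg_affine mul0r addr0.
  rewrite -e2 -segB -mw; apply: seg_bound; first exact: ltW.
  move=> k _; rewrite mk mul0r addr0; set x := z0 + _.
  have rx : complex.Re x = s0 by transitivity (complex.Re z0); first exact: rw.
  have mx : modulus (cexp x - 0) <= rr by rewrite subr0 modulus_cexp rx.
  have := hr0 (cexp x); have := hr1 (cexp x); move: mx; rewrite /rr le_min => /andP[k1 k2].
  move=> /(_ k2) h1 /(_ k1); rewrite f0 !subr0 => h2.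
  by rewrite /h h2 mulfK ?cexp_neq0// -q0.
rewrite /contour segper [seg h _ z0 v + _]addrC addrK => b2.
have : modulus (w * d) <= modulus (seg h N.+1 (z0 + v) w) +
   (modulus (seg h N.+1 (z0 + v) w - seg h N.+1 z0 w) + modulus (seg h N.+1 z0 w - w * d)).
  have := modulusB (seg h N.+1 (z0 + v) w) (seg h N.+1 (z0 + v) w - w * d).
  rewrite subKr => h1; apply: le_trans h1 _; rewrite lerD2l.
  have -> : seg h N.+1 (z0 + v) w - w * d = (seg h N.+1 (z0 + v) w - seg h N.+1 z0 w)
    + (seg h N.+1 z0 w - w * d) by ring.
  exact: modulusD.
rewrite modulusM mw => h1.
have : 2 * pi * modulus d <= 2 * pi * (expR (- s1) + (eta + eta)).
  apply: (le_trans h1);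
  have -> : 2 * pi * (expR (- s1) + (eta + eta)) = 2 * pi * expR (- s1) + (2 * pi * eta + 2 * pi
    * eta) by ring.
  apply: lerD => //.
  exact: lerD.
rewrite ler_pM2l ?mulr_gt0// es1 /eta; move: d1; clear; lra.
Qed.

(** The diagonal case of [mobius_kernel] writes [1 - |mobius z|^2] through positive factors. *)
Lemma mobius_modulus a z : modulus a < 1 -> modulus z < 1 -> modulus (mobius 1 a z) < 1.
Proof.
move=> ha hz; have d0 : 1 - z * a^* != 0 := neq0_1B (mulJ_lt1 hz ha).
have dJ : (1 - z * a^*)^* != 0 by rewrite conjC_eq0.
have realB (x : C) : 1 - x * x^* = (1 - modulus x ^+ 2)%:C%C by rewrite mulC_conj rmorphB rmorph1.
have e : (1 - modulus (mobius 1 a z) ^+ 2) * modulus (1 - z * a^*) ^+ 2 =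
    (1 - modulus a ^+ 2) * (1 - modulus z ^+ 2).
  have h : (1 - modulus (mobius 1 a z) ^+ 2)%:C%C * ((1 - z * a^*) * (1 - z * a^*)^*) =
      (1 - modulus a ^+ 2)%:C%C * (1 - modulus z ^+ 2)%:C%C.
    rewrite -!realB (mobius_kernel (@modulus1 R) ha hz hz) -realB.
    by move: (1 - z * a^*) ((1 - z * a^*)^*) d0 dJ => D D' d0 dJ; field; rewrite d0 dJ.
  by move: h; rewrite mulC_conj -!realCM => /complexI.
have : 0 < 1 - modulus (mobius 1 a z) ^+ 2.
  rewrite -(@pmulr_lgt0 _ (modulus (1 - z * a^*) ^+ 2)) ?exprn_gt0 ?modulus_gt0// e.
  by rewrite mulr_gt0 ?subr_gt0 ?exprn_ilt1 ?modulus_ge0.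
rewrite subr_gt0 => h; rewrite -(@ltr_pXn2r _ 2) ?nnegrE ?modulus_ge0//.
by rewrite expr1n.
Qed.

Lemma mobius_root u a : mobius u a a = 0.
Proof. by rewrite /mobius subrr mulr0 mul0r. Qed.

Lemma mobius_opp_0 a : mobius 1 (- a) 0 = a.
Proof. by rewrite /mobius mul0r mul1r sub0r opprK subr0 divr1. Qed.

Lemma mobiusK a z : modulus a < 1 -> modulus z < 1 -> mobius 1 (- a) (mobius 1 a z) = z.
Proof.
move=> ha hz; have d0 : 1 - z * a^* != 0 := neq0_1B (mulJ_lt1 hz ha).
have k0 : 1 - a * a^* != 0 := neq0_1B (mulJ_lt1 ha ha).
have nJ : (- a)^* = - a^* by exact: rmorphN.
rewrite /mobius nJ !mul1r.
have e1 : (z - a) / (1 - z * a^*) - - a = z * (1 - a * a^*) / (1 - z * a^*) by field.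
have e2 : 1 - (z - a) / (1 - z * a^*) * - a^* = (1 - a * a^*) / (1 - z * a^*) by field.
rewrite e1 e2; field; rewrite d0 k0; done.
Qed.

Lemma cdiff_mobius a z : modulus a < 1 -> modulus z < 1 ->
  cdiff (mobius 1 a) z ((1 - modulus a ^+ 2)%:C%C / (1 - z * a^*) ^+ 2).
Proof.
move=> ha hz; have d0 : 1 - z * a^* != 0 := neq0_1B (mulJ_lt1 hz ha).
have h1 : cdiff (fun w => w - a) z (1 + 0) := cdiffD (cdiff_id z) (cdiff_cst (- a) z).
have h2 : cdiff (fun w => 1 + w * - a^*) z (0 + (z * 0 + 1 * - a^*)).
  by apply: cdiffD; [exact: cdiff_cst | apply: cdiffM; [exact: cdiff_id | exact: cdiff_cst]].
have d1 : 1 + z * - a^* != 0 by rewrite mulrN.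
have h3 := cdiffM h1 (@cdiffV R (fun w => 1 + w * - a^*) z _ d1 h2).
have -> : mobius 1 a = (fun w => (w - a) * (1 + w * - a^*)^-1).
  by apply/funext => w; rewrite /mobius mul1r mulrN.
have -> : (1 - modulus a ^+ 2)%:C%C / (1 - z * a^*) ^+ 2 =
  (z - a) * (- (1 + z * - a^*) ^- 2 * (0 + (z * 0 + 1 * - a^*))) + (1 + 0) * (1 + z * - a^*)^-1.
  have -> : (1 - modulus a ^+ 2)%:C%C = 1 - a * a^* :> C by rewrite mulC_conj rmorphB rmorph1.
  by rewrite [1 + z * - _](_ : _ = 1 - z * a^*); [field | rewrite mulrN].
exact: h3.
Qed.

(** The Schwarz inequality at 0 for [f] placed between two Moebius maps, one taking 0 to [z] and one
    taking [f z] to 0. *)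
Lemma schwarz_pick f z d : self_map f -> modulus z < 1 -> cdiff f z d ->
  modulus d * (1 - modulus z ^+ 2) <= 1 - modulus (f z) ^+ 2.
Proof.
move=> [hf fD] hz hd; have hb := fD _ hz; set b := f z in hb *.
have zN : modulus (- z) < 1 by rewrite modulusN.
have zero1 : modulus (0 : C) < 1 by rewrite modulus0.
have nz : 1 - modulus z ^+ 2 > 0 by rewrite subr_gt0 exprn_ilt1 ?modulus_ge0.
have nb : 1 - modulus b ^+ 2 > 0 by rewrite subr_gt0 exprn_ilt1 ?modulus_ge0.
pose F w := mobius 1 b (f (mobius 1 (- z) w)).
have m0 : mobius 1 (- z) 0 = z := (mobius_opp_0 z).
have selfF : self_map F.
  split=> w hw; last by apply: mobius_modulus => //; apply/fD/mobius_modulus.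
  have mw := mobius_modulus zN hw; have [d1 hd1] := hf _ mw.
  eexists; apply: cdiff_comp; last by apply: cdiff_mobius => //; exact: fD.
  by apply: cdiff_comp hd1; exact: cdiff_mobius.
have F0 : F 0 = 0 by rewrite /F m0; exact: (mobius_root 1 b).
have h0 := cdiff_mobius zN zero1.
have h1 : cdiff (fun w => f (mobius 1 (- z) w)) 0 (d * ((1 - modulus (- z) ^+ 2)%:C%C / (1 - 0 *
  (- z)^*) ^+ 2)).
  by apply: cdiff_comp h0 _; rewrite m0.
have h2 : cdiff F 0 ((1 - modulus b ^+ 2)%:C%C / (1 - b * b^*) ^+ 2 *
   (d * ((1 - modulus (- z) ^+ 2)%:C%C / (1 - 0 * (- z)^*) ^+ 2))).
  by apply: cdiff_comp h1 _; rewrite m0; exact: cdiff_mobius.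
have := schwarz_derivative selfF F0 h2.
have bb : 1 - b * b^* = (1 - modulus b ^+ 2)%:C%C by rewrite mulC_conj rmorphB rmorph1.
rewrite bb mul0r subr0 expr1n divr1 modulusN !modulusM modulusV modulusX.
rewrite !modulus_ge0r ?(ltW nz) ?(ltW nb)//.
have -> (x y : R) : 0 < x -> x / x ^+ 2 * (modulus d * y) = modulus d * y / x.
  by move=> x0; field; rewrite gt_eqF.
  by rewrite ler_pdivrMr// mul1r.
done.
Qed.

(** Moving from [p] in the direction [g p * d^*] changes [g] to first order by a positive multiple
    of [g p], so the modulus would grow. *)
Lemma max_cdiff_zero g p d : cdiff g p d -> g p != 0 ->
  (exists2 r : R, 0 < r & forall w, modulus (w - p) <= r -> modulus (g w) <= modulus (g p)) ->
    d = 0.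
Proof.
move=> hd gp [r r0 hmax]; apply/eqP/negPn/negP => d0.
have md : 0 < modulus d by rewrite modulus_gt0.
have mg : 0 < modulus (g p) by rewrite modulus_gt0.
have md2 : 0 < modulus d / 2 by rewrite divr_gt0.
have [r1 r10 h1] := cdiff_lin hd md2.
pose k := modulus (g p) * modulus d; have k0 : 0 < k by rewrite mulr_gt0.
pose t := Num.min r r1 / k; have t0 : 0 < t by rewrite divr_gt0// lt_min r0.
pose w := p + t%:C%C * (g p * d^*).
have ewp : w - p = t%:C%C * (g p * d^*) by rewrite /w; ring.
have ew : modulus (w - p) = t * k.
  by rewrite ewp modulusM modulusM modulus_conj modulus_ge0r// ltW.
have tk : t * k = Num.min r r1 by rewrite /t divfK// gt_eqF.
have a1 : modulus (w - p) <= r by rewrite ew tk ge_min lexx.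
have a2 : modulus (w - p) <= r1 by rewrite ew tk ge_min lexx orbT.
have := h1 _ a2; have := hmax _ a1; rewrite ew.
have e1 : g p + d * (w - p) = (1 + t * modulus d ^+ 2)%:C%C * g p.
  have -> : (1 + t * modulus d ^+ 2)%:C%C = 1 + t%:C%C * (d * d^*).
    by rewrite mulC_conj -realCM rmorphD rmorph1.
  by rewrite ewp; ring.
move=> b1 b2.
have : modulus (g p + d * (w - p)) <= modulus (g w) + modulus (g w - g p - d * (w - p)).
  have := modulusB (g w) (g w - g p - d * (w - p)).
  have -> // : g w - (g w - g p - d * (w - p)) = g p + d * (w - p) by ring.
rewrite e1 modulusM modulus_ge0r; last by rewrite addr_ge0// mulr_ge0 ?sqr_ge0// ltW.
move: b1 b2; rewrite /k => b1 b2 b3.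
have : 0 < t * modulus d ^+ 2 * modulus (g p).
  by apply: mulr_gt0 => //; apply: mulr_gt0 => //; exact: exprn_gt0.
have e3 : modulus d / 2 * (t * (modulus (g p) * modulus d)) = t * modulus d ^+ 2 * modulus (g p)
  / 2 by field.
by move: b1 b2 b3; rewrite e3 mulrDl mul1r; clear; lra.
Qed.

Lemma disc_max g (r : R) : 0 <= r -> (forall z, modulus z <= r -> ccont g z) ->
  exists2 p, modulus p <= r & forall z, modulus z <= r -> modulus (g z) <= modulus (g p).
Proof.
move=> r0 hg.
pose inq (z : C) x y t := (x <= complex.Re z <= x + t * (2 * r)) /\ (y <= complex.Im z <= y + t
  * (2 * r)).
(* No supremum is needed: some quarter of a square on which [|g|] is cofinal has the same property. *)
pose Bad x y (t : R) := forall z, modulus z <= r ->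
  exists z', [/\ modulus z' <= r, inq z' x y t & modulus (g z) <= modulus (g z')].
have rr0 : 0 <= 2 * r by rewrite mulr_ge0.
have [||p [q hpq]] := @bisection R (2 * r) (2 * r) (- r) (- r) Bad rr0 rr0.
- move=> z hz; exists z; split=> //; rewrite /inq mul1r.
  have := le_trans (Re_le_modulus z) hz; have := le_trans (Im_le_modulus z) hz.
  rewrite !ler_norml => /andP[a b] /andP[c e].
  by split; apply/andP; split=> //; move: a b c e; clear; lra.
- move=> x y t t0 bad; apply: contrapT => hn.
  (* If no quarter is cofinal, the values of [|g|] on each one are strictly below some value of
     [|g|] on the disc; the largest of these four values then exceeds everything in the square. *)
  have dom (i j : bool) : exists z, modulus z <= r /\ forall z', modulus z' <= r ->
      inq z' (x + i%:R * (t / 2 * (2 * r))) (y + j%:R * (t / 2 * (2 * r))) (t / 2) ->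
      modulus (g z') < modulus (g z).
    apply: contrapT => h; apply: hn; exists i, j => z hz.
    apply: contrapT => h'; apply: h; exists z; split=> // z' hz' iz'.
    by rewrite ltNge; apply/negP => le; apply: h'; exists z'.
  have comb2 (P Q : C -> Prop) : (exists z, modulus z <= r /\ forall z', modulus z' <= r ->
    P z' ->
      modulus (g z') < modulus (g z)) -> (exists z, modulus z <= r /\ forall z',
        modulus z' <= r -> Q z' ->
      modulus (g z') < modulus (g z)) -> exists z, modulus z <= r /\ forall z', modulus z' <= r ->
       P z' \/ Q z' -> modulus (g z') < modulus (g z).
    move=> [z1 [h1 k1]] [z2 [h2 k2]]; case: (leP (modulus (g z1)) (modulus (g z2))) => h.
      by exists z2; split=> // z' hz' [/(k1 _ hz')/lt_le_trans|/(k2 _ hz')//]; apply.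
    by exists z1; split=> // z' hz' [/(k1 _ hz')//|/(k2 _ hz')/lt_trans]; apply.
  have [z [hz kz]] := comb2 _ _ (comb2 _ _ (dom false false) (dom true false))
     (comb2 _ _ (dom false true) (dom true true)).
  have [z' [hz' [/andP[i1 i2] /andP[i3 i4]] le]] := bad z hz.
  have : modulus (g z') < modulus (g z); last by rewrite ltNge le.
  apply: kz => //; rewrite /inq !mul0r !mul1r !addr0.
  case: (leP (complex.Re z') (x + t / 2 * (2 * r))) => h1;
  case: (leP (complex.Im z') (y + t / 2 * (2 * r))) => h2.
  + by left; left; rewrite i1 i3.
  + right; left; rewrite i1 (ltW h2) /=; split=> //.
    by apply: le_trans i4 _; rewrite -addrA -mulrDl -splitr.
  + left; right; rewrite i3 (ltW h1) /=; split=> //.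
    by apply: le_trans i2 _; rewrite -addrA -mulrDl -splitr.
  + right; right; rewrite (ltW h2) (ltW h1) /=; split.
      by apply: le_trans i2 _; rewrite -addrA -mulrDl -splitr.
    by apply: le_trans i4 _; rewrite -addrA -mulrDl -splitr.
pose P := Complex p q.
have near_P (e : R) z : 0 < e -> modulus z <= r ->
  exists z', [/\ modulus z' <= r, modulus (z' - P) <= e &
   modulus (g z) <= modulus (g z')].
  move=> e0 hz; have c0 : 0 < 4 * r + 1 by rewrite ltr_wpDl// mulr_ge0.
  have [|x [y [t [[/andP[t0 te] _ _ /andP[A1 A2] /andP[A3 A4]] bad]]]] := hpq (e / (4 * r + 1)).
    by rewrite divr_gt0.
  have [z' [h1 [/andP[i1 i2] /andP[i3 i4]] h2]] := bad z hz; exists z'; split=> //.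
  apply: le_trans (modulus_le_ReIm _) _; rewrite ReD ImD ReN ImN /=.
  have k1 : `|complex.Re z' - p| <= t * (2 * r).
    by rewrite ler_norml; apply/andP; split; move: A1 A2 i1 i2; clear; lra.
  have k2 : `|complex.Im z' - q| <= t * (2 * r).
    by rewrite ler_norml; apply/andP; split; move: A3 A4 i3 i4; clear; lra.
  move: te; rewrite ler_pdivlMr// => te; move: k1 k2 te t0; clear; lra.
have hP : modulus P <= r.
  apply/ler_addgt0Pl => e e0; have zr0 : modulus (0 : C) <= r by rewrite modulus0.
  have [z' [h1 h2 _]] := near_P e 0 e0 zr0.
  by have := modulusB z' (z' - P); rewrite subKr; move: h1 h2; clear; lra.
exists P => // z hz; apply/ler_addgt0Pl => e e0.
have [d d0 hd] := hg _ hP _ e0.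
have [z' [h1 /hd h2 h3]] := near_P d z d0 hz.
have := modulusD (g z' - g P) (g P); rewrite subrK; move: h2 h3; clear; lra.
Qed.

Lemma schwarz_lemma f z : self_map f -> f 0 = 0 -> modulus z < 1 -> modulus (f z) <= modulus z.
Proof.
move=> sf f0 hz; have [hf fD] := sf; rewrite leNgt; apply/negP => hlt.
have z0 : z != 0 by apply/eqP => e; move: hlt; rewrite e f0 modulus0 ltxx.
have mz : 0 < modulus z by rewrite modulus_gt0.
have zero1 : modulus (0 : C) < 1 by rewrite modulus0.
have [d hd] := hf 0 zero1.
have [q [hq q0 [r1 r10 hr1]]] := hd.
pose g w := if w == 0 then d else f w / w.
have lam : 1 < modulus (f z) / modulus z by rewrite ltr_pdivlMr// mul1r.
(* On the circle of radius [r] the quotient [|f w| / |w|] is below [1 / r], and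
   [1 / r < |f z| / |z|]; so its maximum over the closed disc of radius [r] is attained inside. *)
pose r := Num.max (modulus z) ((modulus z / modulus (f z) + 1) / 2).
have mf : 0 < modulus (f z) by apply: lt_trans hlt.
have ratio : modulus z / modulus (f z) < 1 by rewrite ltr_pdivrMr// mul1r.
have r_lt1 : r < 1 by rewrite gt_max hz /=; move: ratio; clear; lra.
have zr : modulus z <= r by rewrite le_max lexx.
have r0 : 0 < r by apply: lt_le_trans zr.
have rlam : r^-1 < modulus (f z) / modulus z.
  rewrite -invf_div ltf_pV2 ?posrE ?divr_gt0// lt_max; apply/orP; right.
  by move: ratio; clear; lra.
have cdg w : w != 0 -> modulus w < 1 -> forall d', cdiff f w d' ->
    cdiff g w (f w * - w^-2 + d' * w^-1).
  move=> w0 hw d' hd'; have := cdiffM hd' (cdiff_inv w0).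
  move=> [Q [c1 c2 [rho rho0 c3]]]; exists Q; split=> //.
  exists (Num.min rho (modulus w / 2)); first by rewrite lt_min rho0 divr_gt0// modulus_gt0.
  move=> x; rewrite le_min => /andP[/c3 <- k].
  have x0 : x != 0.
    apply/eqP => e; move: k; rewrite e sub0r modulusN.
    have : 0 < modulus w by rewrite modulus_gt0.
    by clear; lra.
  by rewrite /g (negbTE x0) (negbTE w0).
have cg w : modulus w <= r -> ccont g w.
  move=> hw; have w1 := le_lt_trans hw r_lt1.
  have [->|w0] := eqVneq w 0; last first.
    by have [d' hd'] := hf _ w1; exact: cdiff_ccont (cdg _ w0 w1 _ hd').
  apply: (ccont_ext _ hq); exists r1 => // x /hr1; rewrite f0 !subr0 /g => hx.
  by case: eqVneq hx => [-> _|x0 ->]; rewrite ?q0// mulfK.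
have [p hp pmax] := disc_max (ltW r0) cg.
have gp : r^-1 < modulus (g p).
  apply: lt_le_trans rlam _; have := pmax _ zr.
  by rewrite {1}/g (negbTE z0) modulusM modulusV.
have rinv : 1 < r^-1 by rewrite -invr1 ltf_pV2 ?posrE.
have [p0|p0] := eqVneq p 0.
  have := schwarz_derivative sf f0 hd; move: gp; rewrite p0 /g eqxx => h1 h2.
  by move: (lt_le_trans (lt_trans rinv h1) h2); rewrite ltxx.
have mp : 0 < modulus p by rewrite modulus_gt0.
have p1 : modulus p < 1 := le_lt_trans hp r_lt1.
have gpE : g p = f p / p by rewrite /g (negbTE p0).
have pr : modulus p < r.
  rewrite lt_def hp andbT; apply/negP => /eqP e.
  move: gp; rewrite gpE modulusM modulusV -e => h.
  have : modulus (f p) / r < r^-1 by rewrite ltr_pdivrMr// mulVf ?gt_eqF// fD.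
  by rewrite ltNge ltW.
have [d' hd'] := hf _ p1.
have gp0 : g p != 0 by rewrite -modulus_gt0; apply: lt_trans gp; rewrite invr_gt0.
have dz : f p * - p^-2 + d' * p^-1 = 0.
  apply: (max_cdiff_zero (cdg _ p0 p1 _ hd') gp0).
  exists (r - modulus p); first by rewrite subr_gt0.
  by move=> w hw; apply: pmax; have := modulusD (w - p) p; rewrite subrK; move: hw; clear; lra.
(* Schwarz-Pick forbids a critical point of [f z / z] where its modulus exceeds 1. *)
have d'E : d' = g p.
  rewrite gpE; apply: (mulIf (_ : p^-1 != 0)); first by rewrite invr_eq0.
  apply/eqP; rewrite -subr_eq0 -dz; apply/eqP; field; exact: p0.
have := schwarz_pick sf p1 hd'; rewrite d'E.
have -> : modulus (f p) = modulus (g p) * modulus p.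
  by rewrite gpE modulusM modulusV divfK// gt_eqF.
have lam1 := lt_trans rinv gp.
move: (modulus (g p)) (modulus p) lam1 mp => L m L1 m0.
(* Schwarz-Pick now reads [L (1 - m^2) <= 1 - L^2 m^2], that is [(L - 1) (1 + L m^2) <= 0]. *)
have : 0 < (L - 1) * (1 + L * m ^+ 2).
  by rewrite mulr_gt0 ?subr_gt0// ltr_wpDr// mulr_ge0 ?sqr_ge0//; move: L1; clear; lra.
by clear; nra.
Qed.

End Schwarz.

(** * Disc automorphisms are Moebius maps *)

Section DiscAutomorphisms.
Variable R : realType.
Local Notation C := R[i].
Implicit Types (f g phi : C -> C) (z w a d : C).

(** An increment larger than [e] would, by bisection, leave arbitrarily short pieces whose increment
    exceeds [e] times their relative length, around a point where the derivative vanishes. The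
    segment starts at [s > 0] because the derivative is controlled only off 0. *)
Lemma segment_increment g z (s e : R) : 0 < s < 1 -> 0 < e ->
  (forall t : R, 0 < t <= 1 -> cdiff g (t%:C%C * z) 0) -> modulus (g z - g (s%:C%C * z)) <= e.
Proof.
move=> /andP[s0 s1] e0 hg; rewrite leNgt; apply/negP => hlt.
pose Bad (x y t : R) := e * t < modulus (g ((x + t * (1 - s))%:C%C * z) - g (x%:C%C * z)).
have a0 : 0 <= 1 - s by rewrite subr_ge0 ltW.
have [||p [q hpq]] := @bisection R (1 - s) 0 s 0 Bad a0 (lexx 0).
- by rewrite /Bad mulr1 (_ : s + 1 * (1 - s) = 1) ?rmorph1 ?mul1r//; ring.
- move=> x y t t0 bad; apply: contrapT => hn.
  have good (i : bool) : modulus (g ((x + i%:R * (t / 2 * (1 - s)) + t / 2 * (1 - s))%:C%C * z)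
      - g ((x + i%:R * (t / 2 * (1 - s)))%:C%C * z)) <= e * (t / 2).
    by rewrite leNgt; apply/negP => h; apply: hn; exists i, false.
  move: bad; rewrite /Bad ltNge => /negP; apply.
  have := good true; have := good false; rewrite /= !mul0r !mul1r !addr0.
  have -> : x + t / 2 * (1 - s) + t / 2 * (1 - s) = x + t * (1 - s) by field.
  set u := g (x%:C%C * z); set v := g ((x + t / 2 * (1 - s))%:C%C * z).
  set w := g _ => h1 h2; have := modulusD (w - v) (v - u); rewrite subrKA.
  by move: h1 h2; clear; lra.
have p1 : 0 < p <= 1.
  have [x [y [t [[_ /andP[A1 A2] _ /andP[A3 A4] _] _]]]] := hpq 1 ltr01.
  by apply/andP; split; move: s0 s1 A1 A2 A3 A4; clear; lra.
pose k := (1 - s) * modulus z; have k0 : 0 <= k by rewrite mulr_ge0// modulus_ge0.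
have k1 : 0 < k + 1 by rewrite ltr_wpDl.
have e2 : 0 < e / 2 / (k + 1) by rewrite !divr_gt0.
have [r r0 hr] := cdiff_lin (hg p p1) e2.
have [|x [y [t [[/andP[t0 t1] _ _ /andP[A3 A4] _] bad]]]] := hpq (r / (k + 1));
  first by rewrite divr_gt0.
move: bad; rewrite /Bad ltNge => /negP; apply.
have near x' : `|x' - p| <= t * (1 - s) -> modulus (g (x'%:C%C * z) - g (p%:C%C * z)) <= e / 2 *
  t.
  move=> hx.
  have m1 : modulus (x'%:C%C * z - p%:C%C * z) <= t * k.
    rewrite -mulrBl modulusM (_ : x'%:C%C - p%:C%C = (x' - p)%:C%C :> C); last by rewrite rmorphB.
    by rewrite modulus_real /k mulrA ler_wpM2r ?modulus_ge0.
  have := hr (x'%:C%C * z); rewrite mul0r subr0 => h.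
  apply: le_trans (h _) _.
    apply: (le_trans m1); move: t1; rewrite ler_pdivlMr//; move: t0 k0; clear; nra.
  rewrite mulrAC ler_pdivrMr// -[leRHS]mulrA ler_wpM2l//; first by rewrite ltW// divr_gt0.
  by apply: (le_trans m1); rewrite ler_wpM2l ?(ltW t0)// lerDl.
have n1 := near (x + t * (1 - s)); have n2 := near x.
have := modulusB (g ((x + t * (1 - s))%:C%C * z) - g (p%:C%C * z)) (g (x%:C%C * z) - g (p%:C%C *
  z)).
rewrite opprB subrKA => h; apply: (le_trans h).
have -> : e * t = e / 2 * t + e / 2 * t by field.
apply: lerD; [apply: n1 | apply: n2]; rewrite ler_norml; apply/andP; split;
  move: A3 A4 t0 a0; clear; nra.
Qed.

Lemma radially_constant g z : (forall t : R, 0 < t <= 1 -> cdiff g (t%:C%C * z) 0) ->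
  ccont g 0 -> g z = g 0.
Proof.
move=> hg hc; apply/eqP; rewrite -subr_eq0 -modulus_eq0 eq_le modulus_ge0 andbT.
apply/ler_addgt0Pl => e e0; rewrite addr0; have e2 : 0 < e / 2 by rewrite divr_gt0.
have [r r0 hr] := hc _ e2.
pose s := Num.min (2^-1) (r / (modulus z + 1)).
have z1 : 0 < modulus z + 1 by rewrite ltr_wpDl// modulus_ge0.
have s0 : 0 < s by rewrite lt_min invr_gt0 ltr0Sn divr_gt0.
have s1 : s < 1 by rewrite gt_min invf_lt1// ltr1n.
have s01 : 0 < s < 1 by rewrite s0.
have h1 := segment_increment s01 e2 hg.
have h2 : modulus (g (s%:C%C * z) - g 0) <= e / 2.
  apply: hr; rewrite subr0 modulusM modulus_ge0r ?(ltW s0)//.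
  have : s <= r / (modulus z + 1) by rewrite ge_min lexx orbT.
  by rewrite ler_pdivlMr//; apply: le_trans; rewrite ler_wpM2l ?(ltW s0)// lerDl.
have := modulusD (g z - g (s%:C%C * z)) (g (s%:C%C * z) - g 0).
by rewrite subrKA; move: h1 h2; clear; lra.
Qed.

(** Schwarz' lemma for [f] and for its inverse gives [|f z| = |z|]. So [f z / z] has constant
    modulus, every point off 0 is a local maximum of it, its derivative vanishes there, and it is
    constant. *)
Lemma rotation_of_automorphism f fi : self_map f -> self_map fi -> f 0 = 0 -> fi 0 = 0 ->
  (forall z, modulus z < 1 -> fi (f z) = z) ->
  exists2 c, modulus c = 1 & forall z, modulus z < 1 -> f z = c * z.
Proof.
move=> sf sfi f0 fi0 hfi; have [hf fD] := sf.
have fm z : modulus z < 1 -> modulus (f z) = modulus z.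
  move=> hz; apply/eqP; rewrite eq_le schwarz_lemma//=.
  by rewrite -[in leLHS](hfi z hz); apply: schwarz_lemma => //; exact: fD.
have zero1 : modulus (0 : C) < 1 by rewrite modulus0.
have [d hd] := hf 0 zero1; have [q [hq q0 [r1 r10 hr1]]] := hd.
pose g w := if w == 0 then d else f w / w.
have cg0 : ccont g 0.
  apply: (ccont_ext _ hq); exists r1 => // x /hr1; rewrite f0 !subr0 /g => hx.
  by case: eqVneq hx => [-> _|x0 ->]; rewrite ?q0// mulfK.
have gm w : w != 0 -> modulus w < 1 -> modulus (g w) = 1.
  by move=> w0 hw; rewrite /g (negbTE w0) modulusM modulusV fm// divff// modulus_eq0.
have gd w : w != 0 -> modulus w < 1 -> cdiff g w 0.
  move=> w0 hw; have [d' hd'] := hf _ hw.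
  have mw : 0 < modulus w by rewrite modulus_gt0.
  have near_w (rho : R) : 0 < rho -> exists2 r : R, 0 < r & forall x, modulus (x - w) <= r ->
      [/\ modulus (x - w) <= rho, x != 0 & modulus x < 1].
    move=> rho0; exists (Num.min rho (Num.min (modulus w / 2) ((1 - modulus w) / 2))).
      by rewrite !lt_min rho0 !divr_gt0// subr_gt0.
    move=> x; rewrite !le_min => /and3P[k1 k2 k3]; split=> //.
      apply/eqP => e; move: k2; rewrite e sub0r modulusN.
      by move: mw; clear; lra.
    by have := modulusD (x - w) w; rewrite subrK; move: k3 hw; clear; lra.
  have hgw : cdiff g w (f w * - w^-2 + d' * w^-1).
    have := cdiffM hd' (cdiff_inv w0); move=> [Q [c1 c2 [rho rho0 c3]]]; exists Q; split=> //.
    have [r r0 hr] := near_w _ rho0; exists r => // x /hr[/c3 <- x0 _].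
    by rewrite /g (negbTE x0) (negbTE w0).
  have g0 : g w != 0 by rewrite -modulus_gt0 gm.
  rewrite -(max_cdiff_zero hgw g0)//.
  have [r r0 hr] := near_w _ ltr01; exists r => // x /hr[_ x0 hx].
  by rewrite !gm.
have gc z : modulus z < 1 -> g z = d.
  move=> hz; have [->|z0] := eqVneq z 0; first by rewrite /g eqxx.
  have -> : d = g 0 by rewrite /g eqxx.
  apply: radially_constant => // t /andP[t0 t1]; apply: gd.
    by rewrite mulf_neq0// -modulus_gt0 modulus_ge0r// ltW.
  by apply: modulus_scale_lt1 => //; rewrite (ltW t0).
exists d.
  have h2 : modulus (2^-1 : C) < 1 by rewrite modulusV modulus_nat invf_lt1// ltr1n.
  by rewrite -(gc _ h2) gm// invr_eq0 pnatr_eq0.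
move=> z hz; have [->|z0] := eqVneq z 0; first by rewrite f0 mulr0.
by rewrite -(gc _ hz) /g (negbTE z0) divfK.
Qed.

(** With [a = psi 0], precomposition with [mobius 1 (- a)] gives an automorphism fixing 0, hence a
    rotation. *)
Lemma Mob_mobius (phi : Cplx R -> Cplx R) : Mob phi -> exists u a : C,
  [/\ modulus u = 1, modulus a < 1 & forall z : C, modulus z < 1 -> phi z = mobius u a z].
Proof.
move=> [hphi phiD [psi [hpsi psiD psiK phiK]]].
have dE (z : C) : disc (z : Cplx R) <-> modulus z < 1 by rewrite /disc/= norm_lt1.
have sphi : self_map phi.
  split=> z /dE hz; first by apply: differentiable_cdiff; exact: hphi.
  by apply/dE/phiD.
have spsi : self_map psi.
  split=> z /dE hz; first by apply: differentiable_cdiff; exact: hpsi.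
  by apply/dE/psiD.
have zero1 : modulus (0 : C) < 1 by rewrite modulus0.
pose a : C := psi 0; have ha : modulus a < 1 by apply: spsi.2.
have haN : modulus (- a) < 1 by rewrite modulusN.
have comp_self f g : self_map f -> self_map g -> self_map (fun z => f (g z)).
  move=> [hf fD] [hg gD]; split=> z hz; last exact/fD/gD.
  have [d1 hd1] := hg _ hz; have [d2 hd2] := hf _ (gD _ hz).
  by eexists; exact: cdiff_comp hd1 hd2.
have mob_self (b : C) : modulus b < 1 -> self_map (mobius 1 b).
  by move=> hb; split=> z hz; [eexists; exact: cdiff_mobius | exact: mobius_modulus].
have [c c1 hc] : exists2 c, modulus c = 1 &
    forall z : C, modulus z < 1 -> phi (mobius 1 (- a) z) = c * z.
  apply: (@rotation_of_automorphism (fun z => phi (mobius 1 (- a) z)) (fun z =>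
    mobius 1 a (psi z))).
  - exact: comp_self _ _ sphi (mob_self _ haN).
  - exact: comp_self _ _ (mob_self _ ha) spsi.
  - by rewrite (mobius_opp_0 a); apply: phiK; apply/dE.
  - exact: (mobius_root 1 a).
  - move=> z hz; rewrite psiK; last by apply/dE/mobius_modulus.
    by have := mobiusK haN hz; rewrite opprK.
exists c, a; split=> // z hz.
have := hc _ (mobius_modulus ha hz); rewrite mobiusK// => ->.
by rewrite /mobius mul1r mulrA.
Qed.

End DiscAutomorphisms.

(** * Holomorphy *)

Section PolynomialEstimates.
Variable R : realType.
Local Notation C := R[i].
Implicit Types (q : {poly C}) (x y : C).

Lemma cdiff_horner q x : exists d, cdiff (fun w => q.[w]) x d.
Proof.
elim/poly_ind: q => [|q c [d hd]].
  by exists 0; under eq_fun do rewrite horner0; exact: cdiff_cst.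
eexists; under eq_fun do rewrite hornerMXaddC.
exact: cdiffD (cdiffM hd (cdiff_id x)) (cdiff_cst c x).
Qed.

(** Schwarz' lemma for [(q - q.[y]) / (2 M)] after scaling to the unit disc and a Moebius map taking
    0 to [v = y / r]. The denominator [r - rho] is a lower bound for [r |1 - x v' / r|], with [v']
    the conjugate of [v]. *)
Lemma poly_lipschitz q (r rho M : R) : 0 < r -> rho < r ->
  (forall x, modulus x < r -> modulus q.[x] < M) ->
  forall x y, modulus x < r -> modulus y <= rho ->
  modulus (q.[x] - q.[y]) <= 2 * M / (r - rho) * modulus (x - y).
Proof.
move=> r0 rr hM x y hx hy; have hyr := le_lt_trans hy rr.
have M0 : 0 < M by apply: le_lt_trans (hM _ hx); exact: modulus_ge0.
have rC0 : (r%:C%C : C) != 0 by rewrite -modulus_gt0 modulus_ge0r// ltW.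
have M2 : 0 < 2 * M by rewrite mulr_gt0.
have mM : modulus ((2 * M)%:C%C : C) = 2 * M by rewrite modulus_ge0r// ltW.
have scale w : modulus w < r -> modulus (w / r%:C%C) < 1.
  by move=> hw; rewrite modulusM modulusV modulus_ge0r ?(ltW r0)// ltr_pdivrMr// mul1r.
pose v := y / r%:C%C; have hv : modulus v < 1 := scale _ hyr.
have hvN : modulus (- v) < 1 by rewrite modulusN.
pose F u := (q.[mobius 1 (- v) u * r%:C%C] + - q.[y]) * ((2 * M)%:C%C)^-1.
have inr u : modulus u < 1 -> modulus (mobius 1 (- v) u * r%:C%C) < r.
  move=> hu; rewrite modulusM modulus_ge0r ?(ltW r0)// -[ltRHS]mul1r ltr_pM2r//.
  exact: mobius_modulus.
have sF : self_map F.
  split=> u hu.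
    have [d hd] := cdiff_horner q (mobius 1 (- v) u * r%:C%C).
    eexists; apply: cdiffM; last exact: cdiff_cst.
    apply: cdiffD; last exact: cdiff_cst.
    apply: (@cdiff_comp _ (fun u => mobius 1 (- v) u * r%:C%C) (fun w => q.[w])); last exact: hd.
    by apply: cdiffM; [exact: cdiff_mobius | exact: cdiff_cst].
  rewrite /F modulusM modulusV mM ltr_pdivrMr// mul1r; apply: le_lt_trans (modulusB _ _) _.
  by have := hM _ hyr; have := hM _ (inr _ hu); clear; lra.
have F0 : F 0 = 0.
  by rewrite /F (mobius_opp_0 v) /v divfK// subrr mul0r.
have hxr := scale _ hx; have mx := mobius_modulus hv hxr.
have := schwarz_lemma sF F0 mx; rewrite /F mobiusK// divfK//.
rewrite modulusM modulusV mM ler_pdivrMr// => h; apply: (le_trans h).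
rewrite [leRHS](_ : _ = modulus (x - y) / (r - rho) * (2 * M)); last by ring.
rewrite ler_wpM2r ?(ltW M2)//.
have d0 := neq0_1B (mulJ_lt1 hxr hv).
have dpos : 0 < modulus (1 - x / r%:C%C * v^*) by rewrite modulus_gt0.
rewrite /mobius mul1r modulusM modulusV ler_pdivrMr//.
have -> : x / r%:C%C - v = (x - y) / r%:C%C by rewrite /v mulrBl.
rewrite modulusM modulusV modulus_ge0r ?(ltW r0)// -[leRHS]mulrA ler_wpM2l ?modulus_ge0//.
rewrite [leRHS]mulrC ler_pdivlMr ?subr_gt0// mulrC ler_pdivrMr//.
have vr : modulus v * r = modulus y.
  by rewrite /v modulusM modulusV modulus_ge0r ?(ltW r0)// divfK// gt_eqF.
have : 1 <= modulus (1 - x / r%:C%C * v^*) + modulus (x / r%:C%C * v^*).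
  by have := modulusD (1 - x / r%:C%C * v^*) (x / r%:C%C * v^*); rewrite subrK modulus1.
have : modulus (x / r%:C%C * v^*) <= modulus v.
  by rewrite modulusM modulus_conj ler_piMl ?modulus_ge0// ltW.
move=> h1 h2; have : 1 - modulus v <= modulus (1 - x / r%:C%C * v^*) by move: h1 h2; clear; lra.
rewrite -(ler_pM2r r0) mulrBl mul1r vr => h3.
by apply: le_trans h3; rewrite lerD2l lerN2.
Qed.

(** By the factor theorem [q - q.[y]] is [h * ('X - y)] with [h] a polynomial; the Lipschitz bound
    for [q] bounds [h] by [N], and the Lipschitz bound for [h] gives the claim. Clearing
    denominators keeps the inequality meaningful at coinciding points. One factor 2 in the constant
    comes from the strict bound [2 N]. *)
Lemma poly_second_difference q (r rho M : R) : 0 < r -> 0 <= rho -> rho < r ->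
  (forall x, modulus x < r -> modulus q.[x] < M) ->
  forall x x' y, modulus x <= rho -> modulus x' <= rho -> modulus y <= rho ->
  modulus ((q.[x] - q.[y]) * (x' - y) - (q.[x'] - q.[y]) * (x - y)) <=
  8 * M / (r - rho) ^+ 2 * (modulus (x - y) * modulus (x' - y) * modulus (x - x')).
Proof.
move=> r0 rho0 rr hM x x' y hx hx' hy.
have M0 : 0 < M by apply: le_lt_trans (hM 0 _); rewrite ?modulus_ge0// modulus0.
have k0 : 0 < r - rho by rewrite subr_gt0.
have [h hE] : exists h, q - (q.[y])%:P = h * ('X - y%:P).
  by apply/factor_theorem; rewrite /root !hornerE subrr.
have hq w : q.[w] - q.[y] = h.[w] * (w - y).
  by have := congr1 (fun p => p.[w]) hE; rewrite !hornerE.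
pose N := 2 * M / (r - rho); have N0 : 0 < N by rewrite divr_gt0// mulr_gt0.
have hN w : modulus w < r -> modulus h.[w] <= N.
  move=> hw; have [->|wy] := eqVneq w y; last first.
    have n0 : 0 < modulus (w - y) by rewrite modulus_gt0 subr_eq0.
    have := poly_lipschitz r0 rr hM hw hy; rewrite hq modulusM.
    by rewrite ler_pM2r.
  (* At [w = y] the quotient gives no bound, but [h] is continuous and bounded by [N] at nearby
     points [w']. *)
  have [d hd] := cdiff_horner h y; have cd := cdiff_ccont hd.
  apply/ler_addgt0Pl => e e0; have [s s0 hs] := cd _ e0.
  have hyr := le_lt_trans hy rr.
  pose t := Num.min s ((r - modulus y) / 2).
  have t0 : 0 < t by rewrite lt_min s0 divr_gt0// subr_gt0.
  pose w' := y + t%:C%C.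
  have ew : w' - y = t%:C%C by rewrite /w' addrC addKr.
  have mw : modulus (w' - y) = t by rewrite ew modulus_ge0r// ltW.
  have ts : t <= s by rewrite ge_min lexx.
  have tr : t <= (r - modulus y) / 2 by rewrite ge_min lexx orbT.
  have w'r : modulus w' < r.
    by have := modulusD (w' - y) y; rewrite subrK mw; move: tr hyr; clear; lra.
  have := hs w'; rewrite mw => /(_ ts) h1.
  have n0 : 0 < modulus (w' - y) by rewrite mw.
  have h2 : modulus h.[w'] <= N.
    have := poly_lipschitz r0 rr hM w'r hy; rewrite hq modulusM.
    by rewrite ler_pM2r.
  have := modulusB h.[w'] (h.[w'] - h.[y]); rewrite subKr; move: h1 h2; clear; lra.
have hN2 w : modulus w < r -> modulus h.[w] < 2 * N.
  by move=> /hN; move: N0; clear; lra.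
have := poly_lipschitz r0 rr hN2 (le_lt_trans hx rr) hx'.
rewrite !hq.
have -> : h.[x] * (x - y) * (x' - y) - h.[x'] * (x' - y) * (x - y) =
  (x - y) * (x' - y) * (h.[x] - h.[x']) by ring.
rewrite !modulusM => k1.
have -> : 8 * M / (r - rho) ^+ 2 = 2 * (2 * N) / (r - rho) by rewrite /N; field; rewrite gt_eqF.
rewrite [leRHS](_ : _ = modulus (x - y) * modulus (x' - y) *
   (2 * (2 * N) / (r - rho) * modulus (x - x'))); last by ring.
by rewrite ler_wpM2l ?mulr_ge0 ?modulus_ge0.
Qed.

End PolynomialEstimates.

(** * Derivatives as limits of difference quotients *)

Section CauchyComplex.
Variable R : realType.
Local Notation C := R[i].

Lemma real_complete (u : nat -> R) :
  (forall e : R, 0 < e -> exists N, forall m n, (N <= m)%N -> (N <= n)%N -> `|u m - u n| <= e) ->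
  exists l, forall e : R, 0 < e -> exists N, forall n, (N <= n)%N -> `|u n - l| <= e.
Proof.
move=> h; have hc : cvg (u @ \oo).
  apply: (@cauchy_cvg R^o); apply: (@cauchy_exP _ R^o) => r r0.
  have [|N hN] := h (r / 2); first by rewrite divr_gt0.
  exists (u N); exists N => // n /= hn; rewrite -ball_normE/=.
  by apply: le_lt_trans (hN _ _ (leqnn N) hn) _; rewrite ltr_pdivrMr// ltr_pMr// ltr1n.
exists (lim (u @ \oo)) => e e0.
have := hc; move/(@cvgrPdist_le R R^o) => /(_ e e0)[N _ hN].
by exists N => n /hN /=; rewrite distrC.
Qed.

Lemma clim_complete (u : nat -> C) :
  (forall e : R, 0 < e -> exists N, forall m n, (N <= m)%N -> (N <= n)%N ->
    modulus (u m - u n) <= e) ->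
  exists l, clim u l.
Proof.
move=> h.
have [|a ha] := @real_complete (fun n => complex.Re (u n)).
  move=> e /h[N hN]; exists N => m n hm hn; apply: le_trans (hN m n hm hn).
  by rewrite -ReN -ReD Re_le_modulus.
have [|b hb] := @real_complete (fun n => complex.Im (u n)).
  move=> e /h[N hN]; exists N => m n hm hn; apply: le_trans (hN m n hm hn).
  by rewrite -ImN -ImD Im_le_modulus.
exists (Complex a b) => e e0; have e2 : 0 < e / 2 by rewrite divr_gt0.
have [N hN] := ha _ e2; have [M hM] := hb _ e2; exists (maxn N M) => n.
rewrite geq_max => /andP[/hN k1 /hM k2]; apply: le_trans (modulus_le_ReIm _) _.
by rewrite ReD ImD ReN ImN /=; move: k1 k2; clear; lra.
Qed.

(** The hypothesis makes the difference quotients for the increments [d / n.+1] a Cauchy sequence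
    with limit [D]; letting [x' = y + d / n.+1] tend to [y] gives the remainder bound. *)
Lemma derivative_from_second_difference (f : C -> C) (y : C) (d K : R) : 0 < d -> 0 <= K ->
  (forall x x', modulus (x - y) <= d -> modulus (x' - y) <= d ->
    modulus ((f x - f y) * (x' - y) - (f x' - f y) * (x - y)) <=
    K * (modulus (x - y) * modulus (x' - y) * modulus (x - x'))) ->
  exists D, forall x, modulus (x - y) <= d ->
    modulus (f x - f y - D * (x - y)) <= K * modulus (x - y) ^+ 2.
Proof.
move=> d0 K0 hf.
pose h n : R := d / n.+1%:R.
have h0 n : 0 < h n by rewrite divr_gt0// ltr0Sn.
have hd n : h n <= d by rewrite ler_pdivrMr ?ltr0Sn// ler_peMr ?(ltW d0)// ler1n.
have hC n : ((h n)%:C%C : C) != 0 by rewrite -modulus_gt0 modulus_ge0r// ltW.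
pose u n : C := (f (y + (h n)%:C%C) - f y) / (h n)%:C%C.
have yh n : y + (h n)%:C%C - y = (h n)%:C%C by rewrite addrC addKr.
have mh n : modulus (y + (h n)%:C%C - y) = h n by rewrite yh modulus_ge0r// ltW.
have key x n : modulus (x - y) <= d ->
    modulus (f x - f y - u n * (x - y)) <= K * (modulus (x - y) * modulus (x - (y + (h n)%:C%C))).
  move=> hx; have := hf x (y + (h n)%:C%C) hx; rewrite mh => /(_ (hd n)); rewrite yh.
  have -> : (f x - f y) * (h n)%:C%C - (f (y + (h n)%:C%C) - f y) * (x - y) =
     (f x - f y - u n * (x - y)) * (h n)%:C%C.
    by rewrite [RHS]mulrBl [u n * _ * _]mulrAC /u divfK.
  rewrite modulusM modulus_ge0r ?(ltW (h0 n))// => k.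
  rewrite -(ler_pM2r (h0 n)); apply: (le_trans k).
  by rewrite le_eqVlt; apply/orP; left; apply/eqP; ring.
have [|D hD] := @clim_complete u.
  move=> e e0; have [N hN] := inv_small (2 * K * d) e0; exists N => m n hm hn.
  have := key (y + (h m)%:C%C) n; rewrite mh => /(_ (hd m)).
  have -> : f (y + (h m)%:C%C) - f y - u n * (y + (h m)%:C%C - y) = (u m - u n) * (h m)%:C%C.
    by rewrite yh mulrBl /u divfK.
  rewrite modulusM modulus_ge0r ?(ltW (h0 m))// [leRHS]mulrCA [leLHS]mulrC ler_pM2l// => k.
  apply: (le_trans k).
  have -> : y + (h m)%:C%C - (y + (h n)%:C%C) = (h m)%:C%C - (h n)%:C%C by ring.
  have := modulusB (h m)%:C%C (h n)%:C%C; rewrite !modulus_ge0r ?(ltW (h0 _))// => k2.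
  apply: le_trans (_ : K * (h m + h n) <= _); first by rewrite ler_wpM2l.
  have := hN _ hm; have := hN _ hn; rewrite /h -!mulrA.
  by move: (d * m.+1%:R^-1) (d * n.+1%:R^-1) => s t; clear; lra.
exists D => x hx.
have hl : clim (fun n => f x - f y - u n * (x - y)) (f x - f y - D * (x - y)).
  apply: climD; first exact: clim_cst.
  apply: climN; apply: (@clim_ext _ (fun n => (x - y) * u n)); first by move=> n; rewrite mulrC.
  by rewrite mulrC; exact: climZ.
apply/ler_addgt0Pl => e e0; have e2 : 0 < e / 2 by rewrite divr_gt0.
have [N1 h1] := hl _ e2; have [N2 h2] := inv_small (K * modulus (x - y) * d) e2.
pose n := maxn N1 N2; have := h1 n (leq_maxl _ _); have := h2 n (leq_maxr _ _).
have := key x n hx.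
have -> : x - (y + (h n)%:C%C) = (x - y) - (h n)%:C%C by ring.
have := modulusB (x - y) (h n)%:C%C; rewrite (modulus_ge0r (ltW (h0 n))).
set A := f x - f y - _; set B := f x - f y - D * _ => k1 k2 k3 k4.
have k5 := modulusB A (A - B); rewrite subKr in k5.
have k6 : K * (modulus (x - y) * modulus (x - y - (h n)%:C%C)) <=
   K * (modulus (x - y) * (modulus (x - y) + h n)).
  by rewrite ler_wpM2l// ler_wpM2l// modulus_ge0.
have k7 : K * (modulus (x - y) * (modulus (x - y) + h n)) = K * modulus (x - y) ^+ 2 + K *
  modulus (x - y) * d / n.+1%:R.
  by rewrite /h; ring.
move: k2 k3 k4 k5 k6; rewrite k7; move: (K * modulus (x - y) * d / n.+1%:R) (K * modulus (x - y)
  ^+ 2) => s t.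
by clear; lra.
Qed.

End CauchyComplex.

(** * Local bounds and holomorphy of the elements of the space *)

Section Holomorphy.
Variables (R : realType) (alpha beta gamma : R).
Hypotheses (hgamma : 0 < gamma) (halpha : gamma < alpha) (hbeta : gamma < beta).
Variable H : hilbertFunctionSpace R.
Hypothesis hH : reproducing_kernel H (Bkernel alpha beta gamma).
Local Notation C := R[i].
Local Notation X := (bpt R).

Lemma clog_bound (x : C) (r : R) : modulus x <= r -> r < 1 ->
  modulus (clog (1 - x)) <= 2 / (1 - r).
Proof.
move=> hx r1; have x1 := le_lt_trans hx r1; have := clog_series_bound 0 x1.
rewrite /log_sum big_ord0 addr0 expr1 => h; apply: (le_trans h).
rewrite ler_wpM2l// -[leRHS]mul1r ler_pM ?modulus_ge0 ?invr_ge0 ?subr_ge0 ?(ltW x1)//.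
by rewrite lef_pV2 ?posrE ?subr_gt0// lerD2l lerN2.
Qed.

(** [|f z| <= |f| |k_z|] and [|k_z|^2 = exp Q(z, z)], where every logarithm in [Q] is at most [c].
    Since [expR L >= 1], it bounds [|k_z|] as well as its square. *)
Lemma evaluation_bound (r : R) : r < 1 -> exists2 k : R, 0 < k & forall (f : H) (z : X),
  modulus (p1 z) <= r -> modulus (p2 z) <= r -> modulus (fv f z) <= k * hnorm f.
Proof.
move=> r1; pose c := 2 / (1 - r); have c0 : 0 < c by rewrite divr_gt0// subr_gt0.
have a0 : 0 < alpha - gamma by rewrite subr_gt0.
have b0 : 0 < beta - gamma by rewrite subr_gt0.
pose L := (alpha - gamma) * c + (beta - gamma) * c + gamma * (c + c + c + c).
exists (expR L); first exact: expR_gt0.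
move=> f z h1 h2; apply: le_trans (fv_bound hH f z) _; rewrite mulrC ler_wpM2r ?hnorm_ge0//.
have L0 : 0 <= L by have := mulr_gt0 a0 c0; have := mulr_gt0 b0 c0; have := mulr_gt0 hgamma c0;
  rewrite /L; lra.
have lc (x y : C) : modulus x <= r -> modulus y <= r -> modulus (- clog (1 - x * y^*)) <= c.
  move=> hx hy; rewrite modulusN; apply: clog_bound => //.
  rewrite modulusM modulus_conj; apply: le_trans hx; rewrite ler_piMr ?modulus_ge0//.
  by apply: (le_trans hy); exact: ltW.
have kb : hnorm (kvec hH z) ^+ 2 <= expR L.
  rewrite -lecR -(ker_diag hH) BkernelE.
  have := psd_diag z (psd_ker hH); rewrite BkernelE => /ge0_Re ->; rewrite lecR.
  apply: le_trans (ler_norm _) _; apply: le_trans (Re_le_modulus _) _.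
  apply: le_trans (modulus_cexp_le _) _; rewrite ler_expR.
  have m_real (t : R) (x : C) : 0 <= t -> modulus x <= c -> modulus (t%:C%C * x) <= t * c.
    by move=> t0 hx; rewrite modulusM modulus_ge0r// ler_wpM2l.
  rewrite /Qlim /Qform /L; apply: le_trans (modulusD _ _) _; apply: lerD.
    by apply: le_trans (modulusD _ _) _; apply: lerD; apply: m_real;
      rewrite ?(ltW a0) ?(ltW b0)//; exact: lc.
  rewrite modulusM modulus_ge0r ?(ltW hgamma)// ler_wpM2l ?(ltW hgamma)//.
  apply: le_trans (modulusB _ _) _; apply: lerD; last exact: lc.
  apply: le_trans (modulusB _ _) _; apply: lerD; last exact: lc.
  by apply: le_trans (modulusD _ _) _; apply: lerD; exact: lc.
have h1L : 1 <= expR L by rewrite -expR0 ler_expR.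
rewrite -ler_sqr ?nnegrE ?hnorm_ge0 ?expR_ge0//; apply: (le_trans kb).
by rewrite expr2 ler_peMl// expR_ge0.
Qed.

Lemma bidiscP (a b : C) : modulus a < 1 -> modulus b < 1 -> bidisc ((a, b) : Cplx R * Cplx R).
Proof. by move=> ha hb; split; rewrite /= norm_lt1. Qed.

Lemma horner2_fst (P : {poly {poly C}}) (b : C) : exists q : {poly C}, forall x, q.[x] = P.[x, b].
Proof.
exists (map_poly (horner_eval b) P) => x.
by rewrite -[in LHS](hornerC x b) -/(horner_eval b x%:P) horner_map.
Qed.

(** The inequalities involve finitely many values of [f], so they follow from the same inequalities,
    with one [K], for approximating polynomials, which [evaluation_bound] bounds uniformly. The
    first two give partial derivatives with quadratic remainder; the third controls the mixed
    difference that a joint expansion requires. *)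
Lemma local_estimates (f : H) (r rho : R) : 0 < r < 1 -> 0 <= rho -> rho < r ->
  exists K : R, 0 <= K /\ forall x x' y b b' : C, modulus x <= rho -> modulus x' <= rho ->
    modulus y <= rho -> modulus b <= rho -> modulus b' <= rho ->
    [/\ modulus ((ev f (x, b) - ev f (y, b)) * (x' - y) - (ev f (x', b) - ev f (y, b)) * (x - y))
          <= K * (modulus (x - y) * modulus (x' - y) * modulus (x - x')),
        modulus ((ev f (b, x) - ev f (b, y)) * (x' - y) - (ev f (b, x') - ev f (b, y)) * (x - y))
          <= K * (modulus (x - y) * modulus (x' - y) * modulus (x - x')) &
        modulus (ev f (x, b) - ev f (y, b) - ev f (x, b') + ev f (y, b'))
          <= K * (modulus (x - y) * modulus (b - b'))].
Proof.
move=> /andP[r0 r1] rho0 rr; have [k k0 hk] := evaluation_bound r1.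
have d0 : 0 < r - rho by rewrite subr_gt0.
have hf0 := hnorm_ge0 f.
(* The approximants have norm at most [hnorm f + 1]; the last 1 makes the bound strict. *)
pose M := k * (hnorm f + 1) + 1.
have M0 : 0 < M by rewrite ltr_wpDl// mulr_ge0 ?addr_ge0// ltW.
pose K1 := 8 * M / (r - rho) ^+ 2.
exists K1; split; first by rewrite divr_ge0 ?exprn_ge0 ?mulr_ge0// ltW.
move=> x x' y b b' hx hx' hy hb hb'.
have toD (a : C) : modulus a <= rho -> modulus a < 1 by move=> h;
  apply: le_lt_trans h (lt_trans rr r1).
have /choice[g hg] : forall n : nat, exists g : H, polyvec g /\ hnorm (f - g) <= n.+1%:R^-1.
  by move=> n; have [|g] := poly_approx hgamma halpha hbeta hH f (e := n.+1%:R^-1);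
    [rewrite invr_gt0 ltr0Sn | exists g].
have hlg : hlim g f.
  move=> e e0; have [N hN] := inv_small 1 e0; exists N => n /hN; rewrite hnormBC mul1r.
  by apply: le_trans; exact: (hg n).2.
have evl (a c : C) : modulus a < 1 -> modulus c < 1 ->
  clim (fun n => ev (g n) (a, c)) (ev f (a, c)).
  move=> ha hc; exact: (hlim_fv hH (exist _ (a, c) (bidiscP ha hc)) hlg).
have gb n (a c : C) : modulus a < r -> modulus c < r -> modulus (ev (g n) (a, c)) < M.
  move=> ha hc; have a1 := lt_trans ha r1; have c1 := lt_trans hc r1.
  have := hk (g n) (exist _ (a, c) (bidiscP a1 c1)) (ltW ha) (ltW hc).
  rewrite /fv/= => h; apply: (le_lt_trans h); rewrite /M ltr_pwDr// ler_wpM2l ?(ltW k0)//.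
  have := hnormD f (g n - f); rewrite addrC subrK hnormBC => h2; apply: (le_trans h2).
  rewrite lerD2l; apply: le_trans (hg n).2 _.
  by rewrite invf_le1 ?ltr0Sn// ler1n.
have slices n : exists P : {poly {poly C}}, forall a c : C, modulus a < 1 -> modulus c < 1 ->
  ev (g n) (a, c) = P.[a, c].
  have [[P hP] _] := hg n; exists P => a c ha hc.
  exact: hP (exist _ (a, c) (bidiscP ha hc)).
split.
- apply: (@clim_modulus_le _ (fun n => (ev (g n) (x, b) - ev (g n) (y,
  b)) * (x' - y) - (ev (g n) (x', b) - ev (g n) (y, b)) * (x - y))).
    apply: climD; [|apply: climN]; apply: climM; try exact: clim_cst;
    by apply: climD; [|apply: climN]; apply: evl; exact: toD.
  move=> n; have [P hP] := slices n; have [q hq] := horner2_fst P b.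
  rewrite !hP ?toD// -!hq; apply: poly_second_difference => // w hw.
  by rewrite hq -hP ?(lt_trans hw)// ?toD//; apply: gb => //; exact: le_lt_trans rr.
- apply: (@clim_modulus_le _ (fun n => (ev (g n) (b, x) - ev (g n) (b,
  y)) * (x' - y) - (ev (g n) (b, x') - ev (g n) (b, y)) * (x - y))).
    apply: climD; [|apply: climN]; apply: climM; try exact: clim_cst;
    by apply: climD; [|apply: climN]; apply: evl; exact: toD.
  move=> n; have [P hP] := slices n.
  rewrite !hP ?toD//; apply: poly_second_difference => // w hw.
  by rewrite -hP ?(lt_trans hw)// ?toD//; apply: gb => //; exact: le_lt_trans rr.
- apply: (@clim_modulus_le _ (fun n => ev (g n) (x, b) - ev (g n) (y, b) - ev (g n) (x,
  b') + ev (g n) (y, b'))).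
    apply: climD; last by apply: evl; exact: toD.
    apply: climD; last by apply: climN; apply: evl; exact: toD.
    by apply: climD; [|apply: climN]; apply: evl; exact: toD.
  move=> n; have [P hP] := slices n.
  pose N := 2 * M / (r - rho) * modulus (x - y) ; have N0 : 0 <= N.
    by rewrite mulr_ge0 ?modulus_ge0// divr_ge0 ?mulr_ge0// ltW.
  (* The Lipschitz bound in the first variable bounds [P.[x, c] - P.[y, c]] as a polynomial in [c],
     to which the Lipschitz bound in the second variable is then applied. *)
  have hN c : modulus c < r -> modulus (P.[x, c] - P.[y, c]) <= N.
    move=> hc; have [q hq] := horner2_fst P c; rewrite -!hq.
    apply: poly_lipschitz => //; last exact: le_lt_trans rr.
    move=> w hw; rewrite hq -hP ?(lt_trans hw)// ?(lt_trans hc)//.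
    exact: gb.
  rewrite !hP ?toD//.
  have [xy|xy] := eqVneq x y; first by rewrite xy !subrr modulus0 !mul0r mulr0 sub0r addNr
    modulus0.
  have N1 : 0 < N by rewrite mulr_gt0 ?modulus_gt0 ?subr_eq0// divr_gt0// mulr_gt0.
  have := @poly_lipschitz _ (P.[x%:P] - P.[y%:P]) r rho (2 * N) r0 rr _ b b' (le_lt_trans hb rr)
    hb'.
  have hB (c : C) : (P.[x%:P] - P.[y%:P]).[c] = P.[x, c] - P.[y, c] by rewrite hornerD hornerN.
  rewrite !hB => h.
  have -> : P.[x, b] - P.[y, b] - P.[x, b'] + P.[y, b'] =
    P.[x, b] - P.[y, b] - (P.[x, b'] - P.[y, b']) by ring.
  apply: le_trans (h _) _; last first.
    by rewrite le_eqVlt; apply/orP; left; apply/eqP; rewrite /K1 /N; field; rewrite gt_eqF.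
  by move=> c hc; rewrite hB; apply: le_lt_trans (hN _ hc) _; move: N1; lra.
Qed.

(** The remainder of the joint expansion is the sum of two one-variable remainders and the mixed
    difference, each at most [K] times the squared sup norm of the increment. *)
Lemma ev_holomorphic (f : H) : holomorphic_on bidisc (ev f).
Proof.
move=> [a b] [/= ha hb]; move: ha hb; rewrite !norm_lt1 => ha hb.
pose s := Num.max (modulus a) (modulus b).
have s1 : s < 1 by rewrite gt_max ha.
have s0 : 0 <= s by rewrite le_max modulus_ge0.
(* Thirds of the gap to the boundary: increments up to [d] stay within radius [rho = s + d], and
   [r = rho + d] is still below 1. *)
pose d := (1 - s) / 3; have d0 : 0 < d by rewrite divr_gt0// subr_gt0.
pose rho := s + d; pose r := s + d + d.
have r01 : 0 < r < 1 by apply/andP; split; rewrite /r /d; move: s0 s1; lra.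
have rho0 : 0 <= rho by rewrite addr_ge0// ltW.
have rr : rho < r by rewrite ltrDl.
have [K [K0 hK]] := local_estimates f r01 rho0 rr.
have inrho (x c : C) : modulus c <= s -> modulus (x - c) <= d -> modulus x <= rho.
  by move=> h1 h2; have := modulusD (x - c) c; rewrite subrK /rho; move: h1 h2; lra.
have as_ : modulus a <= s by rewrite le_max lexx.
have bs : modulus b <= s by rewrite le_max lexx orbT.
have cs (c : C) : modulus c <= s -> modulus c <= rho.
  by move=> h; apply: (le_trans h); rewrite lerDl ltW.
have [D1 hD1] := @derivative_from_second_difference _ (fun x => ev f (x, b)) a d K d0 K0
  (fun x x' h1 h2 => let: And3 e _ _ := hK x x' a b b (inrho _ _ as_ h1) (inrho _ _ as_ h2) (cs
    _ as_) (cs _ bs) (cs _ bs) in e).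
have [D2 hD2] := @derivative_from_second_difference _ (fun x => ev f (a, x)) b d K d0 K0
  (fun x x' h1 h2 => let: And3 _ e _ := hK x x' b a a (inrho _ _ bs h1) (inrho _ _ bs h2) (cs _
    bs) (cs _ as_) (cs _ as_) in e).
pose df (h : Cplx R * Cplx R) : Cplx R := D1 * h.1 + D2 * h.2.
have dflin : linear df.
  by move=> k u v; rewrite /df /= /GRing.scale/=; ring.
pose DF : {linear (Cplx R * Cplx R)%type -> Cplx R} := HB.pack df (GRing.isLinear.Build _ _ _ _
  df dflin).
have dfc : continuous DF.
  move=> h; apply: (@cvgD _ (Cplx R)); apply: (@cvgM R[i]); try exact: cvg_cst.
    exact: cvg_fst.
  exact: cvg_snd.
have dfE : ev f \o shift (a, b) = cst (ev f (a, b)) + DF +o_ (0 : Cplx R * Cplx R) id.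
  apply/eqaddoP => e /gt0_Re[e' e'0 ->].
  pose rad := Num.min d (e' / (3 * K + 1)).
  have K1 : 0 < 3 * K + 1 by rewrite ltr_wpDl// mulr_ge0.
  have rad0 : 0 < rad by rewrite lt_min d0 divr_gt0.
  apply/nbhs_ballP; exists rad%:C%C => /=; first by rewrite ltcR.
  move=> [h1 h2] [/= k1 k2].
  have m1 : modulus h1 < rad by move: k1; rewrite -ball_normE /= sub0r normrN -norm_lt.
  have m2 : modulus h2 < rad by move: k2; rewrite -ball_normE /= sub0r normrN -norm_lt.
  rewrite !fctE /= [X in _ * X]prod_normE /=.
  pose N := Num.max (modulus h1) (modulus h2).
  have -> : Num.max `|h1| `|h2| = N%:C%C :> R[i].
    by rewrite /N !/Order.max -ltcR; case: ifP.
  suff : modulus (ev f (h1 + a, h2 + b) - (ev f (a, b) + (D1 * h1 + D2 * h2))) <= e' * N.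
    by rewrite -lecR realCM.
  have n1 : modulus h1 <= N by rewrite le_max lexx.
  have n2 : modulus h2 <= N by rewrite le_max lexx orbT.
  have Nr : N <= rad by rewrite ge_max !ltW.
  have rd : rad <= d by rewrite ge_min lexx.
  have re : rad * (3 * K + 1) <= e' by rewrite -ler_pdivlMr// ge_min lexx orbT.
  have x1 : h1 + a - a = h1 by rewrite addrK.
  have y1 : h2 + b - b = h2 by rewrite addrK.
  have := hD1 (h1 + a); have := hD2 (h2 + b); rewrite x1 y1.
  have d1 : modulus h1 <= d := le_trans (ltW m1) rd.
  have d2 : modulus h2 <= d := le_trans (ltW m2) rd.
  move=> /(_ d2) e2 /(_ d1) e1.
  have ix : modulus (h1 + a) <= rho by apply: (inrho _ a) => //; rewrite x1.
  have iy : modulus (h2 + b) <= rho by apply: (inrho _ b) => //; rewrite y1.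
  have [_ _] := hK (h1 + a) (h1 + a) a (h2 + b) b ix ix (cs _ as_) iy (cs _ bs).
  rewrite x1 y1 => e3.
  set E1 := ev f (h1 + a, b) - _ - _ in e1; set E2 := ev f (a, h2 + b) - _ - _ in e2.
  set E3 := _ + ev f (a, b) in e3.
  have -> : ev f (h1 + a, h2 + b) - (ev f (a, b) + (D1 * h1 + D2 * h2)) = E1 + E2 + E3.
    by rewrite /E1 /E2 /E3; ring.
  apply: le_trans (modulusD _ _) _; apply: le_trans (lerD (modulusD _ _) (lexx _)) _.
  have g1 := modulus_ge0 h1; have g2 := modulus_ge0 h2.
  have N0 : 0 <= N := le_trans g1 n1.
  have q1 : K * modulus h1 ^+ 2 <= K * (N * N) by rewrite ler_wpM2l// expr2 ler_pM.
  have q2 : K * modulus h2 ^+ 2 <= K * (N * N) by rewrite ler_wpM2l// expr2 ler_pM.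
  have q3 : K * (modulus h1 * modulus h2) <= K * (N * N) by rewrite ler_wpM2l// ler_pM.
  apply: le_trans (_ : N * (3 * K + 1) * N <= _); last first.
    rewrite ler_wpM2r//; apply: le_trans re; rewrite ler_wpM2r//; exact: ltW.
  have q4 : N * (3 * K + 1) * N = 3 * (K * (N * N)) + N * N by ring.
  have q5 : 0 <= N * N by rewrite mulr_ge0.
  rewrite q4; move: e1 e2 e3 q1 q2 q3 q5.
  move: (modulus E1) (modulus E2) (modulus E3) (K * _) (K * _) (K * _) (K * (N * N)) (N * N).
  by move=> A1 A2 A3 B1 B2 B3 B4 B5 *; lra.
apply/diff_locallyP; split; first by rewrite (diff_unique dfc dfE).
by rewrite (diff_unique dfc dfE).
Qed.

End Holomorphy.

(** * Separability *)

Section Separability.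
Variables (R : realType) (alpha beta gamma : R).
Hypotheses (hgamma : 0 < gamma) (halpha : gamma < alpha) (hbeta : gamma < beta).
Variable H : hilbertFunctionSpace R.
Hypothesis hH : reproducing_kernel H (Bkernel alpha beta gamma).
Local Notation C := R[i].
Local Notation X := (bpt R).

Lemma rational_approx (c : C) (e : R) : 0 < e -> exists q : rat * rat,
  modulus (c - Complex (ratr q.1) (ratr q.2)) <= e.
Proof.
move=> e0; have h (x : R) : exists q : rat, `|x - ratr q| <= e / 2.
  have [|q] := @rat_in_itvoo R (x - e / 2) (x + e / 2); first by lra.
  by rewrite in_itv/= => /andP[k1 k2]; exists q; rewrite ler_norml; apply/andP; split; lra.
have [q1 h1] := h (complex.Re c); have [q2 h2] := h (complex.Im c).
exists (q1, q2); apply: le_trans (modulus_le_ReIm _) _.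
by rewrite ReD ImD ReN ImN /=; lra.
Qed.

Lemma monomial_vectors : exists v : nat -> nat ->
  H, forall i j z, fv (v i j) z = p1 z ^+ i * p2 z ^+ j.
Proof.
have [T1 [h1 _]] := p1_power_op hgamma halpha hbeta hH 0.
have [T2 [h2 _]] := p2_power_op hgamma halpha hbeta hH 0.
have [f hf] := one_vector hgamma halpha hbeta hH.
exists (fun i j => iter i T1 (iter j T2 f)) => i j z.
rewrite (fv_iter (p := @p1 R)); last by move=> g w; rewrite h1 expr1.
rewrite (fv_iter (p := @p2 R)); last by move=> g w; rewrite h2 expr1.
by rewrite hf mulr1.
Qed.

(** Polynomials with coefficients in [Q + iQ] are dense among polynomials, and finite sequences over
    a countable type enumerate them. *)
Lemma separable : separable_space H.
Proof.
have [v hv] := monomial_vectors.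
pose vec (s : seq ((nat * nat) * (rat * rat))) : H :=
  \sum_(p <- s) (Complex (ratr p.2.1) (ratr p.2.2) : C) *: v p.1.1 p.1.2.
pose clo (f : H) := forall e : R, 0 < e -> exists s, hnorm (f - vec s) <= e.
have cloD f g : clo f -> clo g -> clo (f + g).
  move=> hf hg e e0; have e2 : 0 < e / 2 by rewrite divr_gt0.
  have [s hs] := hf _ e2; have [t ht] := hg _ e2; exists (s ++ t).
  rewrite /vec big_cat opprD addrACA; apply: le_trans (hnormD _ _) _.
  by move: hs ht; rewrite /vec; lra.
have clo0 : clo 0.
  by move=> e e0; exists [::]; rewrite /vec big_nil subrr hnorm0 ltW.
have cloZ (c : C) i j : clo (c *: v i j).
  move=> e e0; have k0 : 0 < hnorm (v i j) + 1 by rewrite ltr_wpDl// hnorm_ge0.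
  have [|q hq] := @rational_approx c (e / (hnorm (v i j) + 1)); first by rewrite divr_gt0.
  exists [:: ((i, j), q)]; rewrite /vec big_seq1 /= -scalerBl hnormZ.
  move: hq; rewrite ler_pdivlMr//; apply: le_trans.
  by rewrite ler_wpM2l ?modulus_ge0// lerDl.
have cloS (I : Type) (s : seq I) (F : I -> H) : (forall i, clo (F i)) -> clo (\sum_(i <- s) F i).
  by move=> h; elim/big_rec: _ => // i f _; exact: cloD.
have cloP f : polyvec f -> clo f.
  move=> [p hp].
  have -> : f = \sum_(i < size p) \sum_(j < size p`_i) p`_i`_j *: v i j.
    apply: fv_inj => z; rewrite hp (horner_coef p) horner_sum fv_sum; apply: eq_bigr => i _.
    rewrite hornerM -rmorphXn hornerC (horner_coef p`_i) fv_sum mulr_suml; apply: eq_bigr => j _.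
    by rewrite fvZ hv; ring.
  by apply: (cloS) => i; apply: (cloS) => j; exact: cloZ.
exists (range vec).
  exact: sub_countable (card_image_le vec setT) (countableP _).
move=> O [f Of] oO; have := open_nbhs_nbhs (conj oO Of).
move=> /nbhs_ballP[_ /= /gt0_Re[e e0 ->] he].
have e3 : 0 < e / 3 by rewrite divr_gt0.
have [g pg hg] := poly_approx hgamma halpha hbeta hH f e3.
have [s hs] := cloP _ pg _ e3; exists (vec s); split; last by exists s.
apply: he; rewrite -ball_normE/= norm_hnorm ltcR.
have := hnormD (f - g) (g - vec s); rewrite subrKA.
by move: hg hs; lra.
Qed.

End Separability.

(** * Growth of powers and homogeneity of the module *)

Lemma sqrt_le_self (R : realType) (x : R) : 1 <= x -> Num.sqrt x <= x.
Proof.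
move=> x1; have x0 : 0 <= x by apply: le_trans x1.
rewrite -ler_sqr ?nnegrE ?sqrtr_ge0// sqr_sqrtr// expr2.
by rewrite ler_peMl.
Qed.

(** The norm bounds involve [sqrt (1 + m / a)]; since [sqrt x <= x] for [x >= 1], they take the
    linear form used by the functional calculus. *)
Lemma power_growth (R : realType) (H : hilbertFunctionSpace R) (p : bpt R -> R[i]) (a : R)
    (T : {linear H -> H}) : 0 < a -> (forall f z, fv (T f) z = p z * fv f z) ->
  (forall m, exists T' : {linear H -> H}, (forall f z, fv (T' f) z = p z ^+ m.+1 * fv f z) /\
     forall f, hnorm (T' f) <= Num.sqrt (1 + m.+1%:R / a) * hnorm f) ->
  forall n f, hnorm (iter n T f) <= (1 + a^-1 * n%:R) * hnorm f.
Proof.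
move=> a0 hT h [|m] f; first by rewrite /= mulr0 addr0 mul1r.
have [T' [hT' hn]] := h m.
have -> : iter m.+1 T f = T' f by apply: fv_inj => z; rewrite (fv_iter hT) hT'.
apply: le_trans (hn f) _; rewrite ler_wpM2r ?hnorm_ge0// [a^-1 * _]mulrC.
by apply: sqrt_le_self; rewrite lerDl divr_ge0// ltW.
Qed.

Theorem corollary3p11 (R : realType) (alpha beta gamma : R)
    (hgamma : 0 < gamma) (halpha : gamma < alpha) (hbeta : gamma < beta)
    (H : hilbertFunctionSpace R)
    (hH : reproducing_kernel H (Bkernel alpha beta gamma)) :
  analytic_Hilbert_module H /\ Mob_homogeneous_module H.
Proof.
have a0 : 0 < alpha - gamma by rewrite subr_gt0.
have b0 : 0 < beta - gamma by rewrite subr_gt0.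
have [M1 [hM1' nM1]] := p1_power_op hgamma halpha hbeta hH 0.
have [M2 [hM2' nM2]] := p2_power_op hgamma halpha hbeta hH 0.
have hM1 f z : fv (M1 f) z = p1 z * fv f z by rewrite hM1' expr1.
have hM2 f z : fv (M2 f) z = p2 z * fv f z by rewrite hM2' expr1.
have mul1 : multiplication_op fst M1 by move=> f z hz; exact: hM1 f (exist _ z hz).
have mul2 : multiplication_op snd M2 by move=> f z hz; exact: hM2 f (exist _ z hz).
have bdd (M : {linear H -> H}) (c : R) : (forall f, hnorm (M f) <= c * hnorm f) -> bounded_op M.
  by move=> h; exists c%:C%C => f; rewrite !norm_hnorm -realCM lecR.
have bM1 := bdd _ _ nM1; have bM2 := bdd _ _ nM2.
have g1 := power_growth a0 hM1 (p1_power_op hgamma halpha hbeta hH).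
have g2 := power_growth b0 hM2 (p2_power_op hgamma halpha hbeta hH).
have ai : 0 <= (alpha - gamma)^-1 by rewrite invr_ge0 ltW.
have bi : 0 <= (beta - gamma)^-1 by rewrite invr_ge0 ltW.
split.
  split.
  - exact: (ev_holomorphic hgamma halpha hbeta hH).
  - by exists (Bkernel alpha beta gamma).
  - exact: (poly_vector hgamma halpha hbeta hH).
  - exact: (polyvec_dense hgamma halpha hbeta hH).
  - by exists M1, M2.
exists M1, M2; split=> //; split=> //.
- exact: (separable hgamma halpha hbeta hH).
- by move=> f; apply: fv_inj => z; rewrite !(hM1, hM2); ring.
- exact: (taylor_spectrum_closed_bidisc hH hM1 hM2 ai bi g1 g2).
move=> phi mphi; have [u [a [u1 a1 hphi]]] := Mob_mobius mphi.
have [_ phiD [psi [_ psiD psiK phiK]]] := mphi.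
have rho01 : 0 <= (1 + modulus a) / 2 < 1.
  by have := modulus_ge0 a; move=> ?; apply/andP; split; lra.
have ser (x : R[i]) : modulus x < 1 ->
    clim (fun n => \sum_(i < n) mobius_coef u a i * x ^+ i) (phi x).
  by move=> hx; rewrite hphi//; exact: mobius_series.
have [S1 hS1 fS1] := power_series_op hH (@p1_lt1 R) hM1 ai g1 rho01 (mobius_coef_bound u1 a1) ser.
have [S2 hS2 fS2] := power_series_op hH (@p2_lt1 R) hM2 bi g2 rho01 (mobius_coef_bound u1 a1) ser.
exists S1, S2; split=> //.
pose Phi (z : bpt R) : bpt R := exist _ (phi (sval z).1, phi (sval z).2)
   (conj (phiD _ (svalP z).1) (phiD _ (svalP z).2)).
pose Psi (z : bpt R) : bpt R := exist _ (psi (sval z).1, psi (sval z).2)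
   (conj (psiD _ (svalP z).1) (psiD _ (svalP z).2)).
have bptE (z w : bpt R) : sval z = sval w -> z = w.
  case: z => z hz; case: w => w hw /= e; move: hz; rewrite e => hz.
  by congr exist; exact: Prop_irrelevance.
have c1 : cancel Phi Psi.
  move=> z; apply: bptE; rewrite /= !psiK; [by case: (sval z) | exact: (svalP z).2 | exact:
    (svalP z).1].
have c2 : cancel Psi Phi.
  move=> z; apply: bptE; rewrite /= !phiK; [by case: (sval z) | exact: (svalP z).2 | exact:
    (svalP z).1].
have k := Bkernel_mobius u1 a1 alpha beta gamma (Phi := Phi) (fun z =>
  hphi _ (p1_lt1 z)) (fun z => hphi _ (p2_lt1 z)).
have [U [hU fU]] := composition_unitary hH c1 c2 (fun z => cexp_neq0 _) k.
(* At [z], both sides are [j (Psi z) * fv f (Psi z)] times a scalar: [phi] of a coordinate of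
   [Psi z] on the left, the same coordinate of [z = Phi (Psi z)] on the right. *)
exists U; split=> // f; apply: fv_inj => z; rewrite ?hM1 ?hM2 !fU ?hS1 ?hS2.
  by rewrite mulrCA; congr (_ * _); rewrite -[in RHS](c2 z).
by rewrite mulrCA; congr (_ * _); rewrite -[in RHS](c2 z).
Qed.
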